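(* Let $\alpha([3]^n)$ be the number of antichains of the poset $[3]^n$, and let $\alpha(L_{[n-1,n+1]})$ be the number of antichains of $[3]^n$ contained in $L_{[n-1,n+1]}=L_{n-1}\cup L_n\cup L_{n+1}$. Then $$\alpha([3]^n)=\left(1+e^{-\Omega(n^2)}\right)\alpha(L_{[n-1,n+1]}).$$
   Context: $[3]^n=\{0,1,2\}^n$ with the coordinatewise order. For an integer $k$, the $k$-th layer is $L_k=\{v\in[3]^n:\sum_{i=1}^n v_i=k\}$. An antichain is a set of pairwise incomparable elements (the empty set included). The notation $1+e^{-\Omega(n^2)}$ denotes a quantity $1+\varepsilon_n$ with $|\varepsilon_n|\le e^{-cn^2}$ for some constant $c>0$ and all sufficiently large $n$. *)

(* Defs.v *)
From mathcomp Require Import all_boot all_order all_algebra.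
From mathcomp Require Import all_classical all_reals all_analysis.

Set Implicit Arguments.
Unset Strict Implicit.
Unset Printing Implicit Defensive.

Import Order.TTheory GRing.Theory Num.Theory.
Import numFieldNormedType.Exports.

Local Open Scope ring_scope.

Definition antichain d (T : finPOrderType d) (A : {set T}) : bool :=
  [forall x in A, forall y in A, (x != y) ==> (x >< y)%O].

Definition alpha d (T : finPOrderType d) (S : {set T}) : nat :=
  #|[set A : {set T} | (A \subset S) && antichain A]|.

(* [_.-tupleprod] is the tuple type carrying the coordinatewise order. *)
Definition grid3 (n : nat) := n.-tupleprod 'I_3.

(* The layer index is an integer so that layer n (n%:Z - 1) is empty, rather
   than equal to layer n 0, when n = 0. *)
Definition layer (n : nat) (k : int) : {set grid3 n} :=
  [set v : grid3 n | (\sum_(i < n) tnth v i)%N%:Z == k].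

Definition middle_layers (n : nat) : {set grid3 n} :=
  layer n (n%:Z - 1) :|: layer n n%:Z :|: layer n (n%:Z + 1).

(* eps n = e^{-Omega(n^2)}, as an error term of either sign. *)
Definition exp_neg_Omega_sq (R : realType) (eps : nat -> R) : Prop :=
  exists2 c : R, 0 < c &
    \forall n \near \oo%classic, `|eps n| <= expR (- (c * n%:R ^+ 2)).

(* Main.v *)
Require Import Defs.
From mathcomp Require Import all_boot all_order all_algebra.
From mathcomp Require Import reals sequences exp.
From mathcomp Require Import ring lra zify.

(* By the symmetry that reverses the grid it suffices to bound the number of antichains with
   an element of rank at least n+2, that is, of down-sets D that contain some x of rank n+2.
   Let Z be the linked component, in the layer n+1 of D, that contains the lower covers of x.
   Deleting from D the set Z, all that lies above Z, and any subset of the shadow N(Z) leaves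
   a down-set. Hence the proportion of such D is at most the sum over Z of 2^-|N(Z)| times
   the number of ways to continue a down-set above Z. Since |N(Z)| is of order n^2 at least,
   it remains to see that this sum is dominated by its smallest terms. By induction on the
   number of layers the number of continuations is (2 + o(1))^|Z|. Clusters with |N(Z)| at
   most n^4 expand by a factor n / log n by edge isoperimetry, and are few because they are
   connected. Larger ones expand only by 1 + 1/(8n), but they are covered by few containers
   (the method of Sapozhenko), which gives a sum of order exp(-n^2).
   Throughout, L is a logarithm of n up to an additive constant. *)

Set Implicit Arguments.
Unset Strict Implicit.
Unset Printing Implicit Defensive.

(** * Connected sets and coverings *)

Lemma mem_split_last (T : eqType) (v u : T) p : u \in v :: p ->
  exists p1 p2, last v p1 = u /\ p = p1 ++ p2.
Proof. by case/splitPl=> p1 p2 e; exists p1, p2. Qed.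

Section ConnectedSets.
Variables (T : finType) (r : rel T).

Definition rstr (Z : {set T}) : rel T := [rel x y | [&& x \in Z, y \in Z & r x y]].

Definition rconn (v : T) (Z : {set T}) :=
  (v \in Z) && [forall u in Z, connect (rstr Z) v u].

Lemma rconn_edge v Z (S : {set T}) :
  rconn v Z -> v \in S -> S \proper Z -> exists u w, [/\ u \in S, w \in Z :\: S & r u w].
Proof.
case/andP=> vZ /forall_inP conZ vS; case/properP=> SZ [x xZ xS].
case: (boolP [exists u in S, [exists w in Z :\: S, r u w]]) => [/exists_inP[u uS /exists_inP[w wZ ruw]]|].
  by exists u, w.
rewrite negb_exists => /forallP noE.
have /connectP[p pp lastp] := conZ x xZ.
suff: last v p \in S by rewrite -lastp (negbTE xS).
elim: p v vS {vZ conZ lastp} pp => //= w p IH v vS /andP[/and3P[vZ wZ rvw] pw].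
apply: IH pw; apply: contraT => wS.
have := noE v; rewrite vS /= negb_exists => /forallP /(_ w).
by rewrite !inE wS wZ rvw.
Qed.

Lemma rconn_walk v Z k : rconn v Z -> (forall x y, r x y = r y x) -> k < #|Z| ->
  exists p : seq T, [/\ path r v p, last v p = v, size p = k.*2,
    [set x in v :: p] \subset Z & #|[set x in v :: p]| = k.+1].
Proof.
move=> conZ symr; elim: k => [|k IH] kZ.
  exists [::]; split=> //; last by rewrite set_seq1 cards1.
  by rewrite set_seq1 sub1set; case/andP: conZ.
have [p [pp lp sp subp cp]] := IH (ltnW kZ).
set S := [set x in v :: p] in subp cp.
have vS : v \in S by rewrite !inE eqxx.
have prS : S \proper Z by rewrite properEcard subp cp.
have [u [w [uS /setDP[wZ wS] ruw]]] := rconn_edge conZ vS prS.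
have uvp : u \in v :: p by rewrite inE in uS.
have [p1 [p2 [lastu ep]]] : exists p1 p2, last v p1 = u /\ p = p1 ++ p2.
  exact: mem_split_last.
subst p; exists (p1 ++ [:: w; u] ++ p2).
have eS : [set x in v :: p1 ++ [:: w; u] ++ p2] = w |: S.
  apply/setP=> x; rewrite !inE !mem_cat !inE.
  case: (x =P w) => [->|_]; first by rewrite !orbT.
  case: (x =P u) => [->|_]; last by rewrite orbF.
  move: uvp; rewrite inE mem_cat => /orP[->//|/orP[]->]; rewrite ?orbT //.
move: pp lp; rewrite cat_path last_cat => /andP[pp1 pp2] lp.
split.
- rewrite cat_path pp1 /= lastu ruw symr ruw /=; by rewrite lastu in pp2.
- by rewrite !last_cat /=; rewrite -lastu.
- by rewrite !size_cat /= addnCA -size_cat sp doubleS; rewrite !addSn add0n.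
- by rewrite eS subUset sub1set wZ.
- by rewrite eS cardsU1 wS cp.
Qed.

Fixpoint walks m v : seq (seq T) :=
  if m is m'.+1 then flatten [seq [seq w :: p | p <- walks m' w] | w <- enum (r v)] else [:: [::]].

Lemma mem_walks v p : path r v p -> p \in walks (size p) v.
Proof.
elim: p v => [|w p IH] v //= /andP[rvw pw].
apply/flattenP; exists [seq w :: q | q <- walks (size p) w]; last by rewrite map_f ?IH.
by apply/mapP; exists w; rewrite ?mem_enum.
Qed.

Lemma size_walks D m v : (forall u, #|r u| <= D) -> size (walks m v) <= D ^ m.
Proof.
move=> degr; elim: m v => [|m IH] v //=.
rewrite size_flatten /shape -map_comp sumnE big_map.
apply: (@leq_trans (\sum_(j <- enum (r v)) D ^ m)).
  by apply: leq_sum => w _ /=; rewrite size_map.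
by rewrite big_const_seq count_predT iter_addn_0 mulnC -cardE expnS leq_mul2r degr orbT.
Qed.

Lemma card_rconn D l v :
  (forall x, r x x) -> (forall x y, r x y = r y x) -> (forall u, #|r u| <= D) ->
  #|[set Z | rconn v Z & #|Z| <= l]| <= D ^ l.*2.
Proof.
move=> refr symr degr.
have sub : [set Z | rconn v Z & #|Z| <= l] \subset
    [seq [set x in v :: p] | p <- walks l.*2 v].
  apply/subsetP=> Z; rewrite inE => /andP[conZ cZ].
  have vZ : v \in Z by case/andP: conZ.
  have Z0 : 0 < #|Z| by apply/card_gt0P; exists v.
  have [|p [pp lp sp subp cp]] := rconn_walk (k := #|Z|.-1) conZ symr; first by rewrite prednK.
  have eZ : [set x in v :: p] = Z.
    by apply/eqP; rewrite eqEcard subp cp prednK ?leqnn.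
  apply/mapP; exists (p ++ nseq (l.*2 - size p) v).
    have e : l.*2 = size (p ++ nseq (l.*2 - size p) v).
      rewrite size_cat size_nseq subnKC // sp leq_double.
      by rewrite (leq_trans _ cZ) // leq_pred.
    rewrite [X in walks X]e; apply: mem_walks; rewrite cat_path pp lp /=.
    by elim: (_ - _) => //= k ->; rewrite refr.
  rewrite -eZ; apply/setP=> x; rewrite !inE mem_cat mem_nseq.
  by case: (x =P v) => //= _; rewrite andbF orbF.
apply: leq_trans (subset_leq_card sub) _.
by apply: leq_trans (card_size _) _; rewrite size_map size_walks.
Qed.

End ConnectedSets.

(* Enlarge [Z1] as long as some [M z] brings at least [psi] new points. *)
Lemma greedy_cover (I T : finType) (M : I -> {set T}) (F0 : {set T}) (Z : {set I}) psi :
  0 < psi ->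
  exists Z1 : {set I}, [/\ Z1 \subset Z,
    psi * #|Z1| <= #|(\bigcup_(i in Z1) M i) :\: F0| &
    forall z, z \in Z -> #|M z :\: (F0 :|: \bigcup_(i in Z1) M i)| < psi].
Proof.
move=> psi0.
pose P (Z1 : {set I}) := (Z1 \subset Z) && (psi * #|Z1| <= #|(\bigcup_(i in Z1) M i) :\: F0|).
have P0 : P set0 by rewrite /P sub0set cards0 muln0.
have [Z1 /maxsetP[/andP[sZ1 cZ1] maxZ1] _] := maxset_exists P0.
exists Z1; split=> // z zZ; rewrite ltnNge; apply/negP=> big.
have zZ1 : z \notin Z1.
  apply/negP=> zZ1; move: big; rewrite leqNgt => /negP; apply.
  rewrite (_ : _ :\: _ = set0) ?cards0 //; apply/eqP; rewrite setD_eq0.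
  by rewrite (subset_trans (bigcup_sup z zZ1)) // subsetUr.
suff Pz : P (z |: Z1) by rewrite -(maxZ1 _ Pz (subsetU1 _ _)) setU11 in zZ1.
rewrite /P subUset sub1set zZ sZ1 /= cardsU1 zZ1 bigcup_setU big_set1 mulnDr muln1.
have -> : (M z :|: \bigcup_(i in Z1) M i) :\: F0 =
  (M z :\: (F0 :|: \bigcup_(i in Z1) M i)) :|: ((\bigcup_(i in Z1) M i) :\: F0).
  apply/setP=> x; rewrite !inE; do 3 case: (x \in _) => //=.
rewrite cardsU (_ : _ :&: _ = set0) ?cards0 ?subn0 ?leq_add //.
by apply/setP=> x; rewrite !inE; do 3 case: (x \in _) => //=.
Qed.

Import Order.TTheory GRing.Theory Num.Theory.

Local Open Scope ring_scope.

(** * Random sampling *)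

Lemma sum_subsets (R : comNzRingType) (T : finType) (X : {set T}) (x : R) :
  \sum_(Y : {set T} | Y \subset X) x ^+ #|Y| = (1 + x) ^+ #|X|.
Proof.
pose E i := if i \in X then x else 0.
transitivity (\prod_(i : T) (E i + 1)).
  rewrite bigA_distr [RHS](bigID (fun Y : {set T} => Y \subset X)) /= [X in _ = _ + X]big1 ?addr0.
    apply: eq_bigr => Y YX; rewrite -big_mkcond /= -prodr_const.
    by apply: eq_bigr => i iY; rewrite /E (subsetP YX).
  move=> Y /subsetPn[i iY iX]; rewrite (bigD1 i) //= iY /E (negbTE iX) mul0r.
  by [].
rewrite (bigID (mem X)) /= [X in _ * X]big1 ?mulr1.
  by rewrite -prodr_const; apply: eq_bigr => i iX; rewrite /E iX addrC.
by move=> i /negbTE iX; rewrite /E iX add0r.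
Qed.

Section Reals.
Variable R : realType.

Lemma card_small_subsets (T : finType) (X : {set T}) (M y : nat) : (0 < M)%N ->
  #|[set Y : {set T} | (Y \subset X) && (#|Y| <= y)%N]|%:R
    <= M%:R ^+ y * expR (#|X|%:R / M%:R) :> R.
Proof.
move=> M0; have M0' : 0 < M%:R :> R by rewrite ltr0n.
rewrite mulrC -ler_pdivrMr ?exprn_gt0 // -exprVn.
apply: (@le_trans _ _ ((1 + M%:R^-1) ^+ #|X|)); last first.
  rewrite mulrC expRM_natr; apply: lerXn2r; rewrite ?nnegrE ?expR_ge0 ?addr_ge0 ?invr_ge0 ?ler0n//.
  exact: expR_ge1Dx.
rewrite -sum_subsets -sum1_card natr_sum mulr_suml.
rewrite [leLHS](_ : _ = \sum_(Y : {set T} | (Y \subset X) && (#|Y| <= y)%N) M%:R^-1 ^+ y); last first.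
  by apply: eq_big => Y; rewrite ?inE ?mul1r.
rewrite [leRHS](bigID (fun Y : {set T} => (#|Y| <= y)%N)) /= -[leLHS]addr0.
apply: lerD; last by apply: sumr_ge0 => Y _; rewrite exprn_ge0 // invr_ge0 ler0n.
apply: ler_sum => Y /andP[_ cY]; apply: ler_wiXn2l => //; first by rewrite invr_ge0 ler0n.
by rewrite invf_le1 // ler1n.
Qed.

Lemma bernoulli_sub (x : R) m : 0 <= x <= 1 -> 1 - m%:R * x <= (1 - x) ^+ m.
Proof.
move=> /andP[x0 x1]; elim: m => [|m IH]; first by rewrite mul0r subr0 expr0.
rewrite exprS -natr1.
apply: (@le_trans _ _ ((1 - x) * (1 - m%:R * x))); last by rewrite ler_wpM2l // subr_ge0.
have : 0 <= m%:R * x * x by rewrite !mulr_ge0.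
lra.
Qed.

Lemma exists_le_sum (I : finType) (P : {pred I}) (F : I -> R) (c : R) :
  (0 < #|P|)%N -> \sum_(i in P) F i <= #|P|%:R * c -> exists2 i, i \in P & F i <= c.
Proof.
move=> P0 le; case: (boolP [exists i, (i \in P) && (F i <= c)]) => [/existsP[i /andP[Pi Fi]]|].
  by exists i.
rewrite negb_exists => /forallP nE; suff : #|P|%:R * c < \sum_(i in P) F i by rewrite ltNge le.
rewrite mulr_natl -sumr_const; have [j Pj] := card_gt0P P0.
apply: ltr_sum => [|i Pi]; last by have := nE i; rewrite Pi /= -ltNge.
by apply/hasP; exists j; rewrite ?mem_index_enum.
Qed.

(* Draw [m] points of [N] independently and uniformly. *)
Lemma sample_exists (T : finType) (N G O : {set T}) (B : T -> {set T}) (m b D : nat) (al be : R) :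
  (0 < #|N|)%N -> 0 < al -> 0 < be -> (b <= #|N|)%N ->
  (forall y, y \in G -> (b <= #|B y :&: N|)%N) ->
  (\sum_(y in O) #|B y :&: N| <= D)%N ->
  #|G|%:R * (1 - b%:R / #|N|%:R) ^+ m <= al ->
  m%:R * D%:R / #|N|%:R <= be ->
  exists T0 : {set T}, [/\ T0 \subset N, (#|T0| <= m)%N,
    #|[set y in G | [disjoint B y & T0]]|%:R <= 2 * al &
    #|[set y in O | ~~ [disjoint B y & T0]]|%:R <= 2 * be].
Proof.
move=> g0 al0 be0 bg hG hO hal hbe; set g := #|N| in g0 bg hal hbe *.
pose PF := [pred f : {ffun 'I_m -> T} | f \in ffun_on N].
pose im (f : {ffun 'I_m -> T}) := [set f i | i in 'I_m].
have gR : 0 < g%:R :> R by rewrite ltr0n.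
have cPF : #|PF| = (g ^ m)%N by rewrite card_ffun_on card_ord.
have avoid y : #|[pred f in PF | [disjoint B y & im f]]| = ((g - #|B y :&: N|) ^ m)%N.
  have -> : (g - #|B y :&: N|)%N = #|N :\: B y| by rewrite cardsD setIC.
  rewrite -[in RHS](card_ord m) -card_ffun_on; apply: eq_card => f; rewrite !inE.
  apply/andP/ffun_onP => [[/ffun_onP fN dis] i|h].
    rewrite !inE fN andbT; apply/negP => fB; have := disjointFr dis fB.
    by rewrite imset_f.
  split; first by apply/ffun_onP=> i; have := h i; rewrite inE => /andP[].
  rewrite disjoint_subset; apply/subsetP=> x xB; rewrite inE; apply/imsetP=> -[i _ xe].
  by have := h i; rewrite inE -xe xB.
pose q y : R := #|B y :&: N|%:R / g%:R.
have q01 y : 0 <= q y <= 1.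
  rewrite divr_ge0 ?ler0n //= ler_pdivrMr // mul1r ler_nat; apply: subset_leq_card; exact: subsetIr.
have avoidR y : #|[pred f in PF | [disjoint B y & im f]]|%:R = #|PF|%:R * (1 - q y) ^+ m :> R.
  rewrite avoid cPF !natrX -exprMn; congr (_ ^+ _).
  rewrite natrB; last by apply: subset_leq_card; exact: subsetIr.
  by rewrite /q mulrBr mulr1 mulrCA mulfV ?mulr1 // gt_eqF.
pose X f : R := #|[set y in G | [disjoint B y & im f]]|%:R.
pose Y f : R := #|[set y in O | ~~ [disjoint B y & im f]]|%:R.
have swap (A : {set T}) (P : {ffun 'I_m -> T} -> pred T) :
  \sum_(f in PF) #|[set y in A | P f y]|%:R = \sum_(y in A) #|[pred f in PF | P f y]|%:R :> R.
  transitivity (\sum_(f in PF) \sum_(y in A) (P f y)%:R : R).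
    apply: eq_bigr => f _; rewrite -sum1_card natr_sum big_mkcond [RHS]big_mkcond /=.
    by apply: eq_bigr => y _; rewrite !inE; case: (y \in A); case: (P f y).
  rewrite exchange_big /=; apply: eq_bigr => y _; rewrite -sum1_card natr_sum big_mkcond [RHS]big_mkcond /=.
  by apply: eq_bigr => f _; rewrite !inE; case: [forall x, _]; case: (P f y).
have sX : \sum_(f in PF) X f <= #|PF|%:R * al.
  rewrite swap; apply: (@le_trans _ _ (\sum_(y in G) #|PF|%:R * (1 - b%:R / g%:R) ^+ m)).
    apply: ler_sum => y yG; rewrite avoidR ler_wpM2l //; have /andP[_ q1] := q01 y.
    apply: lerXn2r; rewrite ?nnegrE ?subr_ge0 //.
      by rewrite ler_pdivrMr // mul1r ler_nat.
    by rewrite lerB // ler_pM2r ?invr_gt0 // ler_nat hG.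
  by rewrite sumr_const -[_ *+ #|G|]mulr_natl mulrCA ler_wpM2l.
have sY : \sum_(f in PF) Y f <= #|PF|%:R * be.
  rewrite swap; apply: (@le_trans _ _ (\sum_(y in O) #|PF|%:R * (m%:R * q y))).
    apply: ler_sum => y yO.
    have -> : #|[pred f in PF | ~~ [disjoint B y & im f]]|%:R =
       #|PF|%:R - #|[pred f in PF | [disjoint B y & im f]]|%:R :> R.
      apply/eqP; rewrite eq_sym subr_eq -natrD; apply/eqP; congr (_%:R).
      rewrite -(cardID [pred f | [disjoint B y & im f]] PF) addnC; congr (_ + _)%N; apply: eq_card => f; rewrite !inE //.
      by rewrite andbC.
    rewrite avoidR -[X in X - _]mulr1 -mulrBr ler_wpM2l // lerBlDr -lerBlDl; exact: bernoulli_sub.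
  rewrite -mulr_sumr ler_wpM2l // -mulr_sumr /q -mulr_suml mulrA; apply: le_trans hbe.
  rewrite ler_pM2r ?invr_gt0 // ler_wpM2l // -natr_sum ler_nat //.
have [||f fPF] := @exists_le_sum _ PF (fun f => X f / al + Y f / be) 2.
- by rewrite cPF expn_gt0 g0.
- rewrite big_split /= -!mulr_suml (_ : 2 = 1 + 1) // mulrDr mulr1 lerD //.
    by rewrite ler_pdivrMr.
  by rewrite ler_pdivrMr.
move=> XY; exists (im f).
have X0 : 0 <= X f / al by rewrite divr_ge0 ?ler0n // ltW.
have Y0 : 0 <= Y f / be by rewrite divr_ge0 ?ler0n // ltW.
split.
- by apply/subsetP=> x /imsetP[i _ ->]; move/ffun_onP: fPF; apply.
- by apply: leq_trans (leq_imset_card _ _) _; rewrite card_ord.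
- by rewrite -ler_pdivrMr //; apply: le_trans XY; rewrite lerDl.
- by rewrite -ler_pdivrMr //; apply: le_trans XY; rewrite lerDr.
Qed.

End Reals.

(** * Two consecutive layers *)

Lemma card_bigcup_le (I T : finType) (P : pred I) (F : I -> {set T}) :
  (#|\bigcup_(i | P i) F i| <= \sum_(i | P i) #|F i|)%N.
Proof.
elim/big_rec2: _ => [|i m X _ le]; first by rewrite cards0.
by rewrite (leq_trans (leq_card_setU _ _)) // leq_add2l.
Qed.

Lemma leq_sum_disjoint (I T : finType) (P : {set I}) (F : I -> {set T}) :
  {in P &, forall i j, i != j -> [disjoint F i & F j]} ->
  (\sum_(i in P) #|F i| <= #|\bigcup_(i in P) F i|)%N.
Proof.
move=> dis; rewrite (eq_bigr (fun i => \sum_x (x \in F i))%N) => [|i _]; last first.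
  by rewrite -sum1_card big_mkcond.
rewrite exchange_big /= -sum1_card [leqRHS]big_mkcond /=; apply: leq_sum => x _.
case: (boolP [exists i in P, x \in F i]) => [/exists_inP[i iP xi]|nex].
  rewrite (bigD1 i) //= big1 => [|j /andP[jP ji]]; last first.
    by apply/eqP; rewrite eqb0; rewrite (disjointFl (dis _ _ jP iP ji) xi).
  by rewrite addn0; case: ifP => [_|/bigcupP[]]; [case: (_ \in _)|exists i].
rewrite big1 // => i iP; apply/eqP; rewrite eqb0; apply: contra nex => xi.
by apply/exists_inP; exists i.
Qed.

Section Shadow.
Variables (V : finType) (dn : V -> {set V}).

Definition shadow (X : {set V}) := \bigcup_(z in X) dn z.
Definition adj (z z' : V) := (z == z') || ~~ [disjoint dn z & dn z'].
Definition linked z Z := rconn adj z Z.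

Lemma mem_shadow (X : {set V}) z y : z \in X -> y \in dn z -> y \in shadow X.
Proof. by move=> zX ydn; apply/bigcupP; exists z. Qed.

Lemma shadowS (X Y : {set V}) : X \subset Y -> shadow X \subset shadow Y.
Proof. by move=> XY; apply/bigcupsP=> z zX; apply: bigcup_sup; apply: (subsetP XY). Qed.

End Shadow.

Section Bipartite.
Variables (R : realType) (V : finType) (dn : V -> {set V}) (A B : {set V}) (n L : nat) (w : V -> R).

Definition upA y := [set z in A | y \in dn z].
Notation N := (shadow dn).
Definition cl (X : {set V}) := [set z in A | dn z \subset N X].

(* [A] and [B] model two consecutive layers above the middle, [B] below [A]; [w] is a
   fractional matching that sends each element of [A] into [B]; [lp_ex] is the slack that
   it leaves. The alternative [lp_case] is needed because elements of high layers have few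
   upper covers; there the expansion is by a constant factor. *)
Record layer_pair := LayerPair {
  lp_dn : forall z, z \in A -> dn z \subset B;
  lp_dis : [disjoint A & B];
  lp_up : forall y, y \in B -> (#|upA y| <= n)%N;
  lp_dnn : forall z, z \in A -> (#|dn z| <= n)%N;
  lp_dn2 : forall z, z \in A -> (n <= 2 * #|dn z|)%N;
  lp_cod : forall z z', z \in A -> z' \in A -> z != z' -> (#|dn z :&: dn z'| <= 1)%N;
  lp_w1 : forall z, z \in A -> 1 <= \sum_(y in dn z) w y;
  lp_w2 : forall y, y \in B -> #|upA y|%:R * w y <= 1;
  lp_w3 : forall y, y \in B -> n%:R^-1 <= w y <= 2 / n%:R;
  lp_ex : forall X : {set V}, X \subset A -> (#|N X| + 8 * n * #|X| <= 8 * n * #|N X|)%N;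
  lp_case : (forall y, y \in B -> (n <= 3 * #|upA y|)%N) \/
            (forall X : {set V}, X \subset A -> (#|N X| + 10 * #|X| <= 10 * #|N X|)%N) }.

Hypothesis LP : layer_pair.
Hypothesis n0 : (0 < n)%N.

Let nR0 : 0 < n%:R :> R. Proof. by rewrite ltr0n. Qed.

Lemma w_ge0 y : y \in B -> 0 <= w y.
Proof. by case/(lp_w3 LP)/andP=> h _; apply: le_trans h; rewrite invr_ge0 ler0n. Qed.

Lemma shadow_sub (X : {set V}) : X \subset A -> N X \subset B.
Proof. by move=> XA; apply/bigcupsP=> z zX; apply: (lp_dn LP); apply: (subsetP XA). Qed.

Lemma weight_exchange (X F : {set V}) : X \subset A -> F \subset B ->
  \sum_(z in X) \sum_(y in dn z :&: F) w y = \sum_(y in F) #|upA y :&: X|%:R * w y.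
Proof.
move=> XA FB.
transitivity (\sum_(z in X) \sum_(y in F) (y \in dn z)%:R * w y).
  apply: eq_bigr => z _; rewrite big_mkcond [RHS]big_mkcond /=; apply: eq_bigr => y _.
  by rewrite !inE; case: (y \in dn z); case: (y \in F); rewrite ?mul1r ?mul0r.
rewrite exchange_big /=; apply: eq_bigr => y yF; rewrite -mulr_suml; congr (_ * _).
rewrite -natr_sum -sum1_card; congr (_%:R); rewrite big_mkcond [RHS]big_mkcond /=.
apply: eq_bigr => z _; rewrite !inE; case: (boolP (z \in X)) => zX; rewrite ?andbF ?andbT //.
by rewrite (subsetP XA) //=; case: (y \in dn z).
Qed.

Lemma weight_split (X F : {set V}) : X \subset A -> F \subset B ->
  #|X|%:R <= \sum_(y in F) #|upA y :&: X|%:R * w y + \sum_(z in X) \sum_(y in dn z :\: F) w y.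
Proof.
move=> XA FB; rewrite -weight_exchange // -big_split /= -sum1_card natr_sum.
apply: ler_sum => z zX; apply: le_trans (lp_w1 LP (subsetP XA z zX)) _.
by rewrite (big_setID F).
Qed.

Lemma weight_up_le1 (X : {set V}) y : y \in B -> #|upA y :&: X|%:R * w y <= 1.
Proof.
move=> yB; apply: le_trans (lp_w2 LP yB); rewrite ler_wpM2r ?w_ge0 // ler_nat.
by apply: subset_leq_card; exact: subsetIl.
Qed.

Lemma weight_few (X : {set V}) k : X \subset B -> (#|X| <= k)%N -> \sum_(y in X) w y <= k%:R * (2 / n%:R).
Proof.
move=> XB cX; apply: (@le_trans _ _ (\sum_(y in X) 2 / n%:R)).
  by apply: ler_sum => y yX; have /andP[] := lp_w3 LP (subsetP XB y yX).
by rewrite sumr_const -[leLHS]mulr_natl ler_wpM2r ?divr_ge0 ?ler0n // ler_nat.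
Qed.

Section FixedSet.
Variable Z : {set V}.
Hypothesis ZA : Z \subset A.

Let C := cl Z.
Let g := #|N Z|.
Let t := (g - #|C|)%N.

Lemma clA : C \subset A.
Proof. by apply/subsetP=> z; rewrite inE => /andP[]. Qed.

Lemma sub_cl : Z \subset C.
Proof.
apply/subsetP=> z zZ; rewrite inE (subsetP ZA) //=; exact: bigcup_sup.
Qed.

Lemma shadow_cl : N C = N Z.
Proof.
apply/eqP; rewrite eqEsubset; apply/andP; split; last exact: shadowS sub_cl.
by apply/bigcupsP=> z; rewrite inE => /andP[].
Qed.

Lemma def_t : (#|C| + t = g)%N.
Proof.
rewrite subnKC // /g -shadow_cl.
have := lp_ex LP clA; have := n0; nia.
Qed.

Lemma t_large : (g <= 8 * n * t)%N.
Proof. by have := lp_ex LP clA; rewrite shadow_cl -/g; have := def_t; nia. Qed.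

Lemma notin_cl z y : y \in dn z -> y \notin N Z -> z \notin C.
Proof. by move=> yz; apply: contra; rewrite inE => /andP[_ /subsetP]; apply. Qed.

Lemma deficit_sum : \sum_(y in N Z) (1 - #|upA y :&: C|%:R * w y) <= t%:R.
Proof.
rewrite sumrB sumr_const -/g.
have := weight_split clA (shadow_sub ZA).
rewrite [X in _ + X]big1 => [|z zC]; last first.
  rewrite (_ : _ :\: _ = set0) ?big_set0 //; apply/eqP; rewrite setD_eq0.
  by move: zC; rewrite inE => /andP[].
by rewrite -/g -def_t natrD; lra.
Qed.

Lemma boundary_sum : (\sum_(y in N Z) #|upA y :\: C| <= n * t)%N.
Proof.
rewrite -(ler_nat R) natr_sum natrM; apply: (@le_trans _ _ (n%:R * \sum_(y in N Z) (1 - #|upA y :&: C|%:R * w y))).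
  rewrite mulr_sumr; apply: ler_sum => y yN; have yB := subsetP (shadow_sub ZA) y yN.
  have /andP[w1 w2] := lp_w3 LP yB; have := lp_w2 LP yB; rewrite -(cardsID C (upA y)) natrD.
  set a := #|_|%:R; set b := #|_|%:R => h.
  have a0 : 0 <= a by rewrite ler0n. have b0 : 0 <= b by rewrite ler0n.
  have nw : 1 <= n%:R * w y by rewrite -ler_pdivrMl // mulr1.
  apply: (@le_trans _ _ (b * (n%:R * w y))); first by rewrite ler_peMr.
  by rewrite mulrCA ler_wpM2l ?ler0n //; lra.
by rewrite ler_wpM2l ?ler0n // deficit_sum.
Qed.

Definition thin := [set y in N Z | (2 * #|upA y :&: C| < #|upA y|)%N].

Lemma card_thin : (#|thin| <= 2 * t)%N.
Proof.
rewrite -(ler_nat R) natrM -ler_pdivrMl //; apply: le_trans deficit_sum.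
apply: (@le_trans _ _ (\sum_(y in thin) 2^-1)).
  by rewrite sumr_const -[leRHS]mulr_natr.
rewrite [leRHS](big_setID thin) /= (setIidPr _); last by apply/subsetP=> y; rewrite inE => /andP[].
rewrite -[leLHS]addr0; apply: lerD.
  apply: ler_sum => y; rewrite inE => /andP[yN]; have yB := subsetP (shadow_sub ZA) y yN.
  rewrite -(ltr_nat R) natrM => lt; have := lp_w2 LP yB; have := w_ge0 yB; nra.
apply: sumr_ge0 => y /setDP[yN _]; rewrite subr_ge0; apply: weight_up_le1.
exact: (subsetP (shadow_sub ZA)).
Qed.

Definition nbhd y := N (upA y).

Lemma nbhd_out_sum : (\sum_(y in B :\: N Z) #|nbhd y :&: N Z| <= n * n * t)%N.
Proof.
apply: (@leq_trans (\sum_(y in B :\: N Z) \sum_(y' in N Z) \sum_(z in upA y' :\: C) (y \in dn z))).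
  apply: leq_sum => y /setDP[yB yN]; rewrite -sum1_card.
  rewrite (eq_bigl (fun y' => (y' \in N Z) && (y' \in nbhd y))); last by move=> y'; rewrite inE andbC.
  rewrite big_mkcondr /=; apply: leq_sum => y' y'N; case: ifP => // /bigcupP[z].
  rewrite inE => /andP[zA yz] y'z; rewrite (bigD1 z) /=; first by rewrite yz.
  by apply/setDP; split; [rewrite inE zA | exact: notin_cl yz yN].
rewrite exchange_big /=.
apply: (@leq_trans (\sum_(y' in N Z) n * #|upA y' :\: C|)); last first.
  by rewrite -big_distrr /= -mulnA leq_mul2l boundary_sum orbT.
apply: leq_sum => y' _; rewrite exchange_big /= mulnC -sum_nat_const.
apply: leq_sum => z /setDP[]; rewrite inE => /andP[zA _] _.
apply: leq_trans (lp_dnn LP zA); rewrite -sum1_card big_mkcond [X in (_ <= X)%N]big_mkcond /=.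
by apply: leq_sum => y _; case: (y \in B :\: _); case: (y \in dn z).
Qed.

Lemma nbhd_in y : y \in N Z :\: thin -> (n <= 3 * #|upA y|)%N -> (12 <= n)%N ->
  (n * n <= 20 * #|nbhd y :&: N Z|)%N.
Proof.
move=> /setDP[yN]; rewrite inE yN /= -leqNgt => big up3 n12.
have dis : (\sum_(z in upA y :&: C) #|dn z :\ y| <= #|nbhd y :&: N Z|)%N.
  rewrite -[leqRHS](_ : #|\bigcup_(z in upA y :&: C) (dn z :\ y) :|: (nbhd y :&: N Z)| = _); last first.
    congr #|pred_of_set _|; apply/setUidPr/bigcupsP=> z; rewrite !inE => /andP[/andP[zA yz] /andP[_ zN]].
    rewrite subsetI; apply/andP; split; last exact: subset_trans (subsetDl _ _) zN.
    by apply: subset_trans (subsetDl _ _) _; apply: bigcup_sup; rewrite inE zA.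
  apply: leq_trans (subset_leq_card (subsetUl _ _)).
  have : {in upA y :&: C &, forall z z', z != z' -> [disjoint dn z :\ y & dn z' :\ y]}.
    move=> z z'; rewrite !inE => /andP[/andP[zA yz] _] /andP[/andP[z'A yz'] _] zz'.
    rewrite -setI_eq0; apply/eqP/setP=> x; rewrite !inE; apply/negP => /andP[/andP[xy xz] /andP[_ xz']].
    have := lp_cod LP zA z'A zz'; rewrite leqNgt => /negP; apply.
    apply: (@leq_trans #|[set x; y]|); first by rewrite cards2 xy.
    by apply: subset_leq_card; apply/subsetP=> u; rewrite !inE => /orP[]/eqP->; rewrite ?xz ?xz' ?yz ?yz'.
  by move=> dis; apply: leq_sum_disjoint.
apply: (@leq_trans (20 * \sum_(z in upA y :&: C) #|dn z :\ y|)); last by rewrite leq_mul2l.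
apply: (@leq_trans (20 * (#|upA y :&: C| * (n./2).-1))).
  have := odd_double_half n; nia.
rewrite leq_mul2l -sum_nat_const; apply: leq_sum => z; rewrite !inE => /andP[/andP[zA yz] _].
have := lp_dn2 LP zA; rewrite (cardsD1 y) yz; have := odd_double_half n; lia.
Qed.

End FixedSet.
End Bipartite.

(** * Containers *)

Section HasseDistance.
Variables (R : realType) (V : finType) (dn : V -> {set V}) (A B : {set V}) (n L : nat) (w : V -> R).
Hypothesis LP : layer_pair dn A B n w.
Hypothesis n0 : (0 < n)%N.
Notation N := (shadow dn).
Notation up := (upA dn A).
Notation cl := (cl dn A).
Notation nbhd := (nbhd dn A).

Definition hasse_near u x := [|| u == x, (x \in A) && (u \in dn x) | (u \in A) && (x \in dn u)].
Fixpoint within i u x := if i is j.+1 then [exists v, hasse_near u v && within j v x] else u == x.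

Lemma hasse_near_refl u : hasse_near u u. Proof. by rewrite /hasse_near eqxx. Qed.
Lemma hasse_near_sym u x : hasse_near u x = hasse_near x u. Proof. by rewrite /hasse_near eq_sym; congr (_ || _); rewrite orbC. Qed.

Lemma within_cat i j u v x : within i u v -> within j v x -> within (i + j) u x.
Proof.
elim: i u => [|i IH] u /=; first by move/eqP->.
by move=> /existsP[a /andP[ua av]] vx; apply/existsP; exists a; rewrite ua IH.
Qed.

Lemma within1 u x : within 1 u x = hasse_near u x.
Proof. by apply/existsP/idP => [[v /andP[uv /eqP<-]]|ux] //; exists x; rewrite ux /= eqxx. Qed.

Lemma within_flip i u x : within i u x -> within i x u.
Proof.
elim: i u x => [|i IH] u x /=; first by rewrite eq_sym.
move=> /existsP[v /andP[uv vx]]; change (within i.+1 x u); rewrite -addn1; apply: (within_cat (IH _ _ vx)).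
by rewrite within1 hasse_near_sym.
Qed.

Lemma within_sym i u x : within i u x = within i x u.
Proof. by apply/idP/idP; exact: within_flip. Qed.

Lemma within_refl i u : within i u u.
Proof. by elim: i => //= i IH; apply/existsP; exists u; rewrite hasse_near_refl. Qed.

Lemma within_mono i j u x : (i <= j)%N -> within i u x -> within j u x.
Proof. by move=> ij ux; rewrite -(subnKC ij); apply: (within_cat ux); exact: within_refl. Qed.

Lemma card_hasse_near u : (#|hasse_near u| <= 2 * n + 1)%N.
Proof.
have cup : (#|up u| <= n)%N.
  have [uB|uB] := boolP (u \in B); first exact: (lp_up LP uB).
  rewrite (_ : up u = set0) ?cards0 //; apply/setP=> z; rewrite !inE; apply/negP=> /andP[zA uz].
  by move: uB; rewrite (subsetP (lp_dn LP zA)).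
have cdn : (#|if u \in A then dn u else set0| <= n)%N.
  by case: ifP => uA; [exact: (lp_dnn LP uA)|rewrite cards0].
apply: (@leq_trans #|u |: (up u :|: if u \in A then dn u else set0)|).
  apply: subset_leq_card; apply/subsetP=> x; rewrite !inE unfold_in /hasse_near eq_sym.
  by case/or3P => [->|->|/andP[uA xu]]; rewrite ?orbT // uA xu !orbT.
apply: leq_trans (leq_card_setU _ _) _; rewrite cards1 addnC leq_add2r.
by apply: leq_trans (leq_card_setU _ _) _; rewrite mul2n -addnn leq_add.
Qed.

Lemma card_within i u : (#|within i u| <= (2 * n + 1) ^ i)%N.
Proof.
elim: i u => [|i IH] u /=.
  by rewrite (eq_card (B := pred1 u)) ?card1 // => x; rewrite !inE unfold_in eq_sym.
apply: (@leq_trans #|\bigcup_(v in [set v | hasse_near u v]) [set x | within i v x]|).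
  apply: subset_leq_card; apply/subsetP=> x; rewrite unfold_in => /existsP[v /andP[uv vx]].
  by apply/bigcupP; exists v; rewrite inE.
apply: leq_trans (card_bigcup_le _ _) _.
apply: (@leq_trans (\sum_(v in [set v | hasse_near u v]) (2 * n + 1) ^ i)).
  by apply: leq_sum => v _; rewrite cardsE; exact: IH.
by rewrite sum_nat_const expnS leq_mul2r cardsE card_hasse_near orbT.
Qed.

Arguments within : simpl never.

Definition sampled (T : {set V}) := [set y in B | ~~ [disjoint nbhd y & T]].

Lemma code_connected (Z Z1 T : {set V}) z0 : Z \subset A -> linked dn z0 Z ->
  T \subset N Z -> Z1 \subset Z ->
  (forall z, z \in Z -> ~~ [disjoint dn z & sampled T :|: N (z0 |: Z1)]) ->
  rconn (within 8) z0 (z0 |: (T :|: Z1)).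
Proof.
move=> ZA /andP[z0Z /forall_inP conZ] TN Z1Z cov; set S := z0 |: _.
have z0S : z0 \in S by rewrite setU11.
have near z : z \in Z -> exists2 s, s \in S & within 3 z s.
  move=> zZ; have zA := subsetP ZA z zZ.
  have := cov z zZ; rewrite -setI_eq0 => /set0Pn[y /setIP[yz /setUP[]]]; last first.
    move=> /bigcupP[z1 z1S yz1]; exists z1.
      by move: z1S; rewrite !inE => /orP[->|->] //; rewrite !orbT.
    have z1A : z1 \in A by move: z1S; rewrite !inE => /orP[/eqP->|/(subsetP Z1Z)]; apply: (subsetP ZA).
    apply: (@within_mono 2) => //; apply: (@within_cat 1 1 _ y); rewrite within1 /hasse_near.
      by rewrite zA yz !orbT.
    by rewrite z1A yz1 !orbT.
  rewrite inE => /andP[yB]; rewrite -setI_eq0 => /set0Pn[s /setIP[/bigcupP[z1]]].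
  rewrite inE => /andP[z1A yz1] sz1 sT; exists s; first by rewrite !inE sT orbT.
  apply: (@within_cat 1 2 _ y); first by rewrite within1 /hasse_near zA yz !orbT.
  by apply: (@within_cat 1 1 _ z1); rewrite within1 /hasse_near z1A ?yz1 ?sz1 !orbT.
pose P z := forall s, s \in S -> within 3 z s -> connect (rstr (within 8) S) z0 s.
have P0 : P z0.
  by move=> s sS z0s; apply: connect1; apply/and3P; split=> //; apply: within_mono z0s.
have Pstep z1 z2 : z1 \in Z -> z2 \in Z -> adj dn z1 z2 -> P z1 -> P z2.
  move=> z1Z z2Z a12 P1 s sS z2s; have [s1 s1S z1s1] := near z1 z1Z.
  apply: connect_trans (P1 _ s1S z1s1) _; apply: connect1; apply/and3P; split=> //.
  have r2 : within 2 z1 z2.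
    case/orP: a12 => [/eqP->|]; first exact: within_refl.
    rewrite -setI_eq0 => /set0Pn[y /setIP[yz1 yz2]].
    have [z1A z2A] := (subsetP ZA z1 z1Z, subsetP ZA z2 z2Z).
    by apply: (@within_cat 1 1 _ y); rewrite within1 /hasse_near ?z1A ?z2A ?yz1 ?yz2 ?orbT.
  by apply: (@within_cat 3 5 _ z1); [rewrite within_sym|apply: (@within_cat 2 3 _ z2)].
have reach z : z \in Z -> P z.
  move=> zZ; have /connectP[p pp ->] := conZ z zZ.
  have : forall z1, path (rstr (adj dn) Z) z1 p -> P z1 -> P (last z1 p).
    elim: p {pp} => [|z2 p IH] z1 //= /andP[/and3P[z1Z z2Z a12] pp] P1.
    by apply: IH pp _; apply: Pstep P1.
  exact.
rewrite /rconn z0S; apply/forall_inP=> s sS.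
have [z zZ zs] : exists2 z, z \in Z & within 1 z s.
  move: (sS); rewrite !inE => /or3P[/eqP->|/(subsetP TN)/bigcupP[z zZ sz]|/(subsetP Z1Z) sZ].
  - by exists z0; rewrite ?within_refl.
  - by exists z => //; rewrite within1 /hasse_near (subsetP ZA z zZ) sz !orbT.
  - by exists s; rewrite ?within_refl.
by apply: reach zZ _ sS _; apply: within_mono zs.
Qed.

Hypothesis hL : (2 * n + 1)%:R <= expR L%:R :> R.
Hypothesis hLn : (L ^ 8 <= n)%N.
Hypothesis hL0 : (1000 * 1000 <= L)%N.

Lemma n_ge12 : (12 <= n)%N.
Proof.
by apply: leq_trans hLn; apply: (@leq_trans L); [lia|rewrite -[leqLHS]expn1 leq_pexp2l //; lia].
Qed.

Lemma sample_miss (g b m : nat) : (0 < g)%N -> (b <= g)%N -> (2 * L * g <= m * b)%N ->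
  (1 - b%:R / g%:R) ^+ m <= (n%:R ^+ 2)^-1 :> R.
Proof.
move=> g0 bg mb; have gR : 0 < g%:R :> R by rewrite ltr0n.
have nR : 0 < n%:R :> R by rewrite ltr0n.
apply: (@le_trans _ _ (expR (- (2 * L%:R)))).
  apply: (@le_trans _ _ (expR (- (b%:R / g%:R)) ^+ m)).
    apply: lerXn2r; rewrite ?nnegrE ?expR_ge0 //; last exact: expR_ge1Dx.
    by rewrite subr_ge0 ler_pdivrMr // mul1r ler_nat.
  rewrite -expRM_natl ler_expR mulrN lerN2 mulrA ler_pdivlMr //.
  by rewrite -!natrM ler_nat.
rewrite expRN lef_pV2 ?posrE ?exprn_gt0 ?expR_gt0 // mulrC expRM_natr.
apply: lerXn2r; rewrite ?nnegrE ?expR_ge0 ?ler0n //; apply: le_trans hL.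
by rewrite ler_nat; lia.
Qed.

Section Sampling.
Variable Z : {set V}.
Hypothesis ZA : Z \subset A.
Let g := #|N Z|.
Let t := (g - #|cl Z|)%N.
Hypothesis hg : (n * n <= g)%N.

Lemma sample_set : exists T : {set V}, [/\ T \subset N Z, (#|T| * (n * n) <= 81 * L * g)%N,
  (#|N Z :\: sampled T| <= 10 * t)%N & (#|sampled T :\: N Z| <= 162 * L * t)%N].
Proof.
have tg : (g <= 8 * n * t)%N := t_large LP n0 ZA.
have n12 := n_ge12.
have g0 : (0 < g)%N by apply: leq_trans hg; nia.
have t0 : (0 < t)%N by nia.
case: (lp_case LP) => [dense|sparse]; last first.
  exists set0; have e : sampled set0 = set0.
    by apply/setP=> y; rewrite !inE disjoint_sym disjoints_subset sub0set andbF.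
  rewrite sub0set cards0 e setD0 set0D cards0; split=> //.
  have := sparse _ (clA dn A Z); rewrite (shadow_cl dn ZA) -/g.
  have := def_t LP n0 ZA; rewrite -/g -/t; lia.
pose b := ((n * n) %/ 20)%N; pose m := ((80 * L * g) %/ (n * n)).+1.
have bN : (20 * b <= n * n)%N by rewrite mulnC leq_trunc_div.
have bN2 : (n * n <= 40 * b)%N.
  have := divn_eq (n * n) 20; have := ltn_pmod (n * n) (isT : 0 < 20)%N; rewrite -/b; nia.
have mN : (m * (n * n) <= 81 * L * g)%N.
  rewrite /m mulSn; have := leq_trunc_div (80 * L * g) (n * n); nia.
have mN2 : (80 * L * g <= m * (n * n))%N.
  by rewrite /m mulnC; apply: ltnW; rewrite -ltn_divLR // muln_gt0 n0.
pose G := N Z :\: thin dn A Z.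
have bG y : y \in G -> (b <= #|nbhd y :&: N Z|)%N.
  move=> yG; have yB : y \in B by apply: (subsetP (shadow_sub LP ZA)); case/setDP: yG.
  have := nbhd_in LP n0 ZA yG (dense y yB) n12; nia.
have bg : (b <= g)%N by nia.
have gR : 0 < g%:R :> R by rewrite ltr0n.
have nR : 0 < n%:R :> R by rewrite ltr0n.
have tR : 0 < t%:R :> R by rewrite ltr0n.
have [||||T [TN cT miss extra]] := @sample_exists R V (N Z) G (B :\: N Z) nbhd m b (n * n * t) t%:R (81 * L * t)%:R g0 _ _ bg bG (nbhd_out_sum LP n0 ZA).
- by [].
- by rewrite ltr0n; nia.
- apply: (@le_trans _ _ (g%:R * (n%:R ^+ 2)^-1)).
    apply: ler_pM; rewrite ?ler0n //.
    + by rewrite exprn_ge0 // subr_ge0 ler_pdivrMr // mul1r ler_nat.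
    + by rewrite ler_nat subset_leq_card // subsetDl.
    + apply: sample_miss => //; nia.
  by rewrite ler_pdivrMr ?exprn_gt0 // -natrX -natrM ler_nat; nia.
- by rewrite ler_pdivrMr // -!natrM ler_nat; nia.
exists T; split=> //.
- by apply: leq_trans mN; rewrite leq_mul2r cT orbT.
- apply: (@leq_trans (#|thin dn A Z| + #|[set y in G | [disjoint nbhd y & T]]|)).
    apply: leq_trans (leq_card_setU _ _); apply: subset_leq_card; apply/subsetP=> y.
    move=> /setDP[yN]; have yB := subsetP (shadow_sub LP ZA) y yN; rewrite inE yB /= negbK => dis.
    by rewrite !inE dis yN andbT; case: (_ < _)%N.
  have := card_thin LP n0 ZA; rewrite -/g -/t; move: miss; rewrite -natrM ler_nat; lia.
- move: extra; rewrite -natrM ler_nat mulnA mulnA; apply: leq_trans; apply: subset_leq_card.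
  by apply/subsetP=> y; rewrite !inE => /andP[-> /andP[-> ->]].
Qed.
End Sampling.

End HasseDistance.

Section Approximation.
Variables (R : realType) (V : finType) (dn : V -> {set V}) (A B : {set V}) (n L : nat) (w : V -> R).
Hypothesis LP : layer_pair dn A B n w.
Hypothesis n0 : (0 < n)%N.
Notation N := (shadow dn).
Notation up := (upA dn A).
Notation cl := (cl dn A).
Hypothesis hL : (2 * n + 1)%:R <= expR L%:R :> R.
Hypothesis hLn : (L ^ 8 <= n)%N.
Hypothesis hL0 : (1000 * 1000 <= L)%N.

Let psi := (L ^ 5)%N.
Let kappa : R := psi%:R * (2 / n%:R).

(* A linked set [Z] is encoded by a set [Sg], the union of a sample of its shadow and of
   some elements of [Z], and by a set [Y] of elements outside its shadow. The set
   [code_set Sg Y] contains [Z], and [code_inner] lies inside the shadow of [Z]. *)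
Definition code_shadow (Sg : {set V}) := sampled dn A B (Sg :&: B) :|: N (Sg :&: A).
Definition code_hull Sg := [set z in A | (#|dn z :\: code_shadow Sg| < psi)%N].
Definition code_set Sg (Y : {set V}) := [set z in code_hull Sg | [disjoint dn z & Y]].
Definition code_inner (S : {set V}) := [set y in B | (psi <= #|up y :&: S|)%N].

Lemma psi_small : (4 * psi <= n)%N.
Proof.
apply: leq_trans hLn; rewrite (_ : 8 = 3 + 5)%N // expnD leq_mul2r; apply/orP; right.
apply: (@leq_trans L); first by move: hL0; clear; lia.
by rewrite -[leqLHS]expn1 leq_pexp2l //; move: hL0; clear; lia.
Qed.

Lemma psi_gt0 : (0 < psi)%N.
Proof. by rewrite expn_gt0; apply/orP; left; lia. Qed.

Lemma kappa_half : 0 <= kappa <= 2^-1.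
Proof.
rewrite /kappa mulr_ge0 ?divr_ge0 ?ler0n //= mulrA ler_pdivrMr ?ltr0n //.
by have := psi_small; rewrite -(ler_nat R) natrM; lra.
Qed.

Lemma card_split_le (T : finType) (X Y : {set T}) : (#|X| <= #|Y| + #|X :\: Y|)%N.
Proof. by rewrite -(cardsID Y X) leq_add2r subset_leq_card // subsetIr. Qed.

Section OneSet.
Variables (Z : {set V}) (z0 : V).
Hypothesis ZA : Z \subset A.
Hypothesis lZ : linked dn z0 Z.
Let g := #|N Z|.
Let C := cl Z.
Let t := (g - #|C|)%N.
Hypothesis hg : (n * n <= g)%N.

Lemma approximation : exists Sg Y : {set V},
  [/\ rconn (within dn A 8) z0 Sg /\ (#|Sg| <= (81 * L * g) %/ (n * n) + (10 * t) %/ psi + 1)%N,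
      (#|code_hull Sg| <= n * g)%N,
      Y \subset N (code_hull Sg) /\ (#|Y| <= (326 * L * t) %/ psi)%N,
      Z \subset code_set Sg Y /\ code_inner (code_set Sg Y) \subset N Z &
      #|code_set Sg Y|%:R <= #|code_inner (code_set Sg Y)|%:R +
        kappa * (g%:R - #|code_inner (code_set Sg Y)|%:R + (488 * L)%:R * t%:R)].
Proof.
have tg : (g <= 8 * n * t)%N := t_large LP n0 ZA.
have dt : (#|C| + t = g)%N := def_t LP n0 ZA.
have NB : N Z \subset B := shadow_sub LP ZA.
have z0Z : z0 \in Z by case/andP: lZ.
have [T [TN cT E1 E2]] := sample_set LP n0 hL hLn hL0 ZA hg.
rewrite -/g -/C -/t in cT E1 E2.
have [Z1 [Z1Z cZ1 covZ1]] := greedy_cover dn (sampled dn A B T) Z psi_gt0.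
pose Sg := z0 |: (T :|: Z1).
have z0Z1 : z0 |: Z1 \subset Z by rewrite subUset sub1set z0Z.
have SgB : Sg :&: B = T.
  have noA x : x \in A -> x \in B = false by move=> xA; exact: (disjointFr (lp_dis LP) xA).
  apply/setP=> x; rewrite !inE; case: (boolP (x \in T)) => [xT|_] /=.
    by rewrite orbT /=; apply: (subsetP NB); exact: (subsetP TN).
  case: eqP => [->|_] /=; first by apply: noA; exact: (subsetP ZA).
  by case: (boolP (x \in Z1)) => //= xZ1; apply/noA/(subsetP ZA)/(subsetP Z1Z).
have SgA : Sg :&: A = z0 |: Z1.
  apply/setP=> x; rewrite !inE; case: (boolP (x \in z0 |: Z1)) => [xz|].
    rewrite (subsetP ZA) ?(subsetP z0Z1) // andbT.
    by move: xz; rewrite !inE => /orP[->//|->]; rewrite !orbT.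
  rewrite !inE => /norP[/negbTE-> /negbTE->]; rewrite orbF /=; apply/negP=> /andP[xT xA].
  by have := disjointFr (lp_dis LP) xA; rewrite (subsetP NB) // (subsetP TN).
have F1e : code_shadow Sg = sampled dn A B T :|: N (z0 |: Z1) by rewrite /code_shadow SgB SgA.
have F1N : (#|code_shadow Sg :\: N Z| <= 162 * L * t)%N.
  apply: leq_trans E2; apply: subset_leq_card; rewrite F1e setDUl subUset subxx /=.
  apply: subset_trans (sub0set _); rewrite subset0 setD_eq0; exact: shadowS.
have thinZ z : z \in Z -> (#|dn z :\: code_shadow Sg| < psi)%N.
  move=> zZ; apply: leq_ltn_trans (covZ1 z zZ); apply: subset_leq_card.
  by rewrite F1e setDS // setUS // shadowS // subsetUr.
pose U := code_shadow Sg :|: N Z.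
have F1B : code_shadow Sg \subset B.
  rewrite F1e subUset; apply/andP; split; first by apply/subsetP=> y; rewrite inE => /andP[].
  by apply: subset_trans NB; exact: shadowS.
have UB : U \subset B by rewrite subUset F1B.
have cU : (#|U| <= g + 162 * L * t)%N.
  by apply: leq_trans (card_split_le U (N Z)) _; rewrite leq_add2l setDUl setDv setU0.
have S1A : code_hull Sg \subset A by apply/subsetP=> z; rewrite inE => /andP[].
have CA : C \subset A := clA dn A Z.
have cost (X : {set V}) : X \subset code_hull Sg :|: C ->
    \sum_(z in X) \sum_(y in dn z :\: U) w y <= kappa * #|X :\: C|%:R.
  move=> XS; rewrite (big_setID C) /= big1 ?add0r => [|z /setIP[_]]; last first.
    rewrite inE => /andP[_ zN]; rewrite (_ : _ :\: _ = set0) ?big_set0 //.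
    by apply/eqP; rewrite setD_eq0 (subset_trans zN) // subsetUr.
  rewrite mulr_natr -sumr_const; apply: ler_sum => z /setDP[zX zC].
  case/setUP: (subsetP XS z zX) => [|zC']; last by rewrite zC' in zC.
  rewrite inE => /andP[zA lt].
  apply: (weight_few LP); first by apply: subset_trans (subsetDl _ _) (lp_dn LP zA).
  apply: leq_trans (ltnW lt); apply: subset_leq_card; apply: setDS; exact: subsetUl.
have upU (X : {set V}) : \sum_(y in U) #|up y :&: X|%:R * w y <= #|U|%:R.
  rewrite -sum1_card natr_sum; apply: ler_sum => y yU.
  by apply: (weight_up_le1 LP); apply: (subsetP UB).
have /andP[k0 k2] := kappa_half.
have S1C : (#|code_hull Sg :\: C| <= 2 * (t + 162 * L * t))%N.
  have XA : code_hull Sg :|: C \subset A by rewrite subUset S1A.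
  have := weight_split LP XA UB.
  have := cost _ (subxx _); have := upU (code_hull Sg :|: C).
  rewrite setDUl setDv setU0.
  have -> : #|code_hull Sg :|: C| = (#|C| + #|code_hull Sg :\: C|)%N.
    by rewrite -(cardsID C (_ :|: _)) setDUl setDv setU0 (setIidPr _) ?subsetUr.
  move: cU; rewrite -!(ler_nat R) -dt !natrD !natrM.
  have : kappa * #|code_hull Sg :\: C|%:R <= 2^-1 * #|code_hull Sg :\: C|%:R by rewrite ler_wpM2r ?ler0n.
  lra.
pose D := (B :\: N Z) :&: N (code_hull Sg).
have [Y [YD cY covY]] := greedy_cover up (~: code_hull Sg) D psi_gt0.
have YN : Y \subset N (code_hull Sg) by apply: subset_trans YD (subsetIr _ _).
have Yout y : y \in Y -> y \notin N Z.
  by move/(subsetP YD); rewrite !inE => /andP[/andP[]].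
have SE : code_set Sg Y = code_hull Sg :\: \bigcup_(y in Y) up y.
  apply/setP=> z; rewrite !inE; case: (boolP (z \in A)) => [zA|_]; last by rewrite /= andbF.
  rewrite /= [RHS]andbC; congr (_ && _); apply/idP/idP => [dis|].
    apply/bigcupP=> -[y yY]; rewrite inE zA /= => yz.
    by have := disjointFr dis yz; rewrite yY.
  move=> hasse_near; rewrite disjoint_subset; apply/subsetP=> y yz; rewrite inE; apply: contra hasse_near => yY.
  by apply/bigcupP; exists y; rewrite // inE zA.
have FN : code_inner (code_set Sg Y) \subset N Z.
  apply/subsetP=> y; rewrite inE => /andP[yB big]; apply: contraT => yN.
  have /card_gt0P[z /setIP[]] : (0 < #|up y :&: code_set Sg Y|)%N by apply: leq_trans big; exact: psi_gt0.
  rewrite [z \in up y]inE [z \in code_set _ _]inE => /andP[zA yz] /andP[zS1 _].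
  have yD : y \in D by rewrite !inE yN yB /=; apply/bigcupP; exists z.
  have := covY y yD; rewrite ltnNge => /negP; case; apply: leq_trans big _.
  apply: subset_leq_card; rewrite SE; apply/subsetP=> x; rewrite !(inE, negb_or, negbK).
  by move=> /andP[-> /andP[-> ->]].
have SS1 : code_set Sg Y \subset code_hull Sg by apply/subsetP=> z; rewrite inE => /andP[].
exists Sg, Y; split.
- split.
    apply: (code_connected (B := B) ZA lZ TN Z1Z) => z zZ; rewrite -setI_eq0; apply/negP=> /eqP e.
    have := thinZ z zZ; rewrite F1e -(leq_add2l #|dn z :&: (sampled dn A B T :|: N (z0 |: Z1))|) addnS cardsID e cards0 add0n ltnNge.
    move/negP; apply; rewrite -(leq_pmul2l (isT : 0 < 4)%N); apply: leq_trans psi_small _.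
    by apply: leq_trans (lp_dn2 LP (subsetP ZA z zZ)) _; rewrite leq_mul2r orbT.
  apply: leq_trans (leq_card_setU _ _) _; rewrite cards1 addnC leq_add2r.
  apply: leq_trans (leq_card_setU _ _) _; apply: leq_add.
    by rewrite leq_divRL ?muln_gt0 ?n0.
  rewrite leq_divRL ?psi_gt0 // mulnC; apply: leq_trans cZ1 _; apply: leq_trans E1.
  by apply: subset_leq_card; apply: setSD; exact: shadowS.
- apply: leq_trans (card_split_le _ C) _.
  have nL : (1000 * L <= n)%N.
    apply: leq_trans hLn; rewrite (expnD L 7 1) leq_mul2r; apply/orP; right.
    apply: (@leq_trans L); first by move: hL0; clear; lia.
    by rewrite -[leqLHS]expn1 leq_pexp2l //; move: hL0; clear; lia.
  have L0 : (0 < L)%N by move: hL0; clear; lia.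
  have hCg : (#|C| <= g)%N by rewrite -dt leq_addr.
  have htg : (t <= g)%N by rewrite -dt leq_addl.
  have h1 : (2 * (t + 162 * L * t) <= 326 * (L * g))%N.
    apply: (@leq_trans (326 * (L * t))); last by rewrite !leq_mul2l htg orbT.
    by have := leq_pmull t L0; clear; lia.
  have h2 : (g <= L * g)%N by exact: leq_pmull.
  have h3 : (1000 * L * g <= n * g)%N by rewrite leq_mul2r nL orbT.
  by move: S1C hCg h1 h2 h3; clear; lia.
- split=> //; rewrite leq_divRL ?psi_gt0 // mulnC; apply: leq_trans cY _.
  have h : (#|\bigcup_(y in Y) up y :\: ~: code_hull Sg| <= #|code_hull Sg :\: C|)%N.
    apply: subset_leq_card; apply/subsetP=> z; rewrite setDE setCK => /setIP[/bigcupP[y yY]].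
    rewrite inE => /andP[zA yz] zS1; apply/setDP; split=> //.
    by apply: notin_cl yz _; exact: Yout.
  apply: leq_trans h _; apply: leq_trans S1C _.
  have L0 : (0 < L)%N by move: hL0; clear; lia.
  by have := leq_pmull t L0; clear; lia.
- split=> //; apply/subsetP=> z zZ; rewrite inE; apply/andP; split.
    by rewrite inE (subsetP ZA) //= thinZ.
  rewrite disjoint_subset; apply/subsetP=> y yz; rewrite inE; apply/negP=> /Yout.
  by rewrite (mem_shadow zZ yz).
- set S := code_set Sg Y in FN SS1 *; set F := code_inner S in FN *.
  have SA : S \subset A := subset_trans SS1 S1A.
  have := weight_split LP SA UB.
  have SSC : S \subset code_hull Sg :|: C by apply: subset_trans SS1 (subsetUl _ _).
  have := cost S SSC.
  have FU : F \subset U by apply: subset_trans FN (subsetUr _ _).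
  have : \sum_(y in U) #|up y :&: S|%:R * w y <= #|F|%:R + kappa * (#|U|%:R - #|F|%:R).
    rewrite (big_setID F) (setIidPr FU) /=; apply: lerD.
      rewrite -sum1_card natr_sum; apply: ler_sum => y yF.
      by apply: (weight_up_le1 LP); apply: (subsetP UB); apply: (subsetP FU).
    rewrite (_ : #|U|%:R - #|F|%:R = #|U :\: F|%:R); last first.
      by rewrite -(cardsID F U) (setIidPr FU) natrD addrAC subrr add0r.
    rewrite mulr_natr -sumr_const; apply: ler_sum => y /setDP[yU].
    have yB := subsetP UB y yU; rewrite inE yB /= -ltnNge => lt.
    have /andP[_ w2] := lp_w3 LP yB.
    by apply: ler_pM => //; rewrite ?ler0n ?(w_ge0 LP) // ler_nat ltnW.
  have : (#|S :\: C| <= 2 * (t + 162 * L * t))%N.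
    by apply: leq_trans S1C; apply: subset_leq_card; apply: setSD.
  have : t%:R <= L%:R * t%:R :> R by rewrite -natrM ler_nat leq_pmull //; move: hL0; clear; lia.
  move=> h0; move: cU; rewrite -!(ler_nat R) !(natrM, natrD).
  set a := #|U|%:R; set b := #|S :\: C|%:R; move=> h1 h2 h3 h4 h5.
  have h6 : kappa * a <= kappa * (g%:R + 162%:R * L%:R * t%:R) by rewrite ler_wpM2l.
  have h7 : kappa * b <= kappa * (2%:R * (t%:R + 162%:R * L%:R * t%:R)) by rewrite ler_wpM2l.
  have h8 : kappa * (2 * t%:R) <= kappa * (2 * (L%:R * t%:R)) by rewrite ler_wpM2l // ler_wpM2l.
  lra.
Qed.
End OneSet.

End Approximation.

Section CodeBudget.
Variables (R : realType) (V : finType) (dn : V -> {set V}) (A B : {set V}) (n L : nat) (w : V -> R).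
Hypothesis LP : layer_pair dn A B n w.
Hypothesis n0 : (0 < n)%N.
Notation N := (shadow dn).
Notation up := (upA dn A).
Notation cl := (cl dn A).
Hypothesis hL : (2 * n + 1)%:R <= expR L%:R :> R.
Hypothesis hLn : (L ^ 8 <= n)%N.
Hypothesis hL0 : (1000 * 1000 <= L)%N.

Lemma card_few (T : finType) (X : {set T}) (g t y : nat) :
  (#|X| <= n * (n * g))%N -> (g <= 8 * n * t)%N ->
  #|[set Y : {set T} | (Y \subset X) && (#|Y| <= y)%N]|%:R
    <= expR (4 * L%:R * y%:R + 8 * t%:R / n%:R) :> R.
Proof.
move=> cX gt; have nR : 0 < n%:R :> R by rewrite ltr0n.
apply: le_trans (card_small_subsets R X y (_ : (0 < n ^ 4)%N)) _; first by rewrite expn_gt0 n0.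
rewrite expRD; apply: ler_pM; rewrite ?exprn_ge0 ?ler0n ?expR_ge0 //.
  rewrite expRM_natr; apply: lerXn2r; rewrite ?nnegrE ?ler0n ?expR_ge0 //.
  rewrite natrX expRM_natl; apply: lerXn2r; rewrite ?nnegrE ?ler0n ?expR_ge0 //.
  by apply: le_trans hL; rewrite ler_nat; clear; lia.
rewrite ler_expR ler_pdivrMr ?ltr0n ?expn_gt0 ?n0 // mulrAC ler_pdivlMr //.
rewrite -!natrM ler_nat !expnS expn0 muln1.
have h : (n * (n * g) <= n * (n * (8 * n * t)))%N by rewrite !leq_mul2l gt !orbT.
apply: (@leq_trans (n * (n * (8 * n * t)) * n)); first by rewrite leq_mul2r (leq_trans cX h) orbT.
by rewrite leq_eqVlt; apply/orP; left; apply/eqP; ring.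
Qed.

Lemma code_budget (g t : nat) : (n * n <= g)%N -> (g <= 8 * n * t)%N ->
  16 * L%:R * ((81 * L * g) %/ (n * n) + (10 * t) %/ (L ^ 5) + 1)%:R
  + (4 * L%:R * ((326 * L * t) %/ (L ^ 5))%:R + 8 * t%:R / n%:R)
   <= t%:R / (2048 * L%:R) :> R.
Proof.
move=> ng gt; have nR : 0 < n%:R :> R by rewrite ltr0n.
have L0 : (0 < L)%N by move: hL0; clear; lia.
pose x : R := L%:R; pose i := x^-1; pose ni : R := n%:R^-1.
have x0 : 0 < x by rewrite /x ltr0n.
have i0 : 0 < i by rewrite invr_gt0.
have xi : x * i = 1 by rewrite /i divff // gt_eqF.
have ni0 : 0 <= ni by rewrite invr_ge0 ltW.
have i1 : 1000 * 1000 * i <= 1.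
  rewrite -[leRHS]xi; apply: ler_wpM2r; first exact: ltW.
  by move: hL0; rewrite -(ler_nat R) natrM.
have ni8 : ni <= i ^+ 8.
  rewrite /i exprVn lef_pV2 ?posrE ?exprn_gt0 // -natrX ler_nat //.
have tR : 0 <= t%:R :> R by rewrite ler0n.
have i3 : 1000 * 1000 * (1000 * 1000) * i ^+ 3 <= i.
  have -> : 1000 * 1000 * (1000 * 1000) * i ^+ 3 = i * ((1000 * 1000 * i) ^+ 2) by ring.
  by apply: ler_piMr; [exact: ltW|apply: exprn_ile1; rewrite ?mulr_ge0 // ltW].
have ik k : (3 <= k)%N -> i ^+ k <= i ^+ 3.
  move=> k3; apply: ler_wiXn2l => //; first exact: ltW.
  by apply: le_trans i1; rewrite ler_peMl // ?ltW //; lra.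
have d1 : ((81 * L * g) %/ (n * n))%:R <= 648 * x * t%:R * ni.
  rewrite -ler_pdivrMr ?invr_gt0 // invrK -natrM; apply: (@le_trans _ _ (8 * (81 * L * t))%:R).
    rewrite ler_nat; have h := leq_trunc_div (81 * L * g) (n * n).
    have h2 : (81 * L * g <= 81 * L * (8 * n * t))%N by rewrite leq_mul2l gt orbT.
    rewrite -(leq_pmul2r n0) -mulnA; apply: leq_trans h _; apply: leq_trans h2 _.
    by rewrite leq_eqVlt; apply/orP; left; apply/eqP; ring.
  by rewrite !natrM /x; lra.
have d2 : ((10 * t) %/ (L ^ 5))%:R <= 10 * t%:R * i ^+ 5.
  rewrite /i exprVn ler_pdivlMr ?exprn_gt0 // -natrX -!natrM ler_nat; exact: leq_trunc_div.
have d3 : ((326 * L * t) %/ (L ^ 5))%:R <= 326 * x * t%:R * i ^+ 5.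
  rewrite /i exprVn ler_pdivlMr ?exprn_gt0 // -natrX -!natrM ler_nat; exact: leq_trunc_div.
have d4 : 1 <= 8 * t%:R * ni.
  rewrite -ler_pdivrMr ?invr_gt0 // invrK mul1r -natrM ler_nat.
  rewrite -(leq_pmul2r n0); apply: leq_trans ng _; apply: leq_trans gt _.
  by rewrite mulnAC.
rewrite !natrD invfM mulrA -/x -/i -/ni.
have e1 : 16 * x * (648 * x * t%:R * ni) <= 10368 * t%:R * i ^+ 3.
  apply: (@le_trans _ _ (16 * x * (648 * x * t%:R * i ^+ 8))).
    by rewrite ler_pM2l ?mulr_gt0 // ler_wpM2l // !mulr_ge0 // ltW.
  have -> : 16 * x * (648 * x * t%:R * i ^+ 8) = 10368 * t%:R * (x * i) ^+ 2 * i ^+ 6 by ring.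
  by rewrite xi expr1n mulr1 ler_wpM2l ?mulr_ge0 ?ik.
have e2 : 16 * x * (10 * t%:R * i ^+ 5) <= 160 * t%:R * i ^+ 3.
  have -> : 16 * x * (10 * t%:R * i ^+ 5) = 160 * t%:R * (x * i) * i ^+ 4 by ring.
  by rewrite xi mulr1 ler_wpM2l ?mulr_ge0 ?ik.
have e3 : 4 * x * (326 * x * t%:R * i ^+ 5) <= 1304 * t%:R * i ^+ 3.
  have -> : 4 * x * (326 * x * t%:R * i ^+ 5) = 1304 * t%:R * (x * i) ^+ 2 * i ^+ 3 by ring.
  by rewrite xi expr1n mulr1.
have e4 : 16 * x * (8 * t%:R * ni) <= 128 * t%:R * i ^+ 3.
  apply: (@le_trans _ _ (16 * x * (8 * t%:R * i ^+ 8))).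
    by rewrite ler_pM2l ?mulr_gt0 // ler_wpM2l // !mulr_ge0.
  have -> : 16 * x * (8 * t%:R * i ^+ 8) = 128 * t%:R * (x * i) * i ^+ 7 by ring.
  by rewrite xi mulr1 ler_wpM2l ?mulr_ge0 ?ik.
have e5 : 8 * t%:R * ni <= 8 * t%:R * i ^+ 3.
  by rewrite ler_wpM2l ?mulr_ge0 //; apply: le_trans ni8 (ik _ _).
have f1 : 16 * x * ((81 * L * g) %/ (n * n))%:R <= 16 * x * (648 * x * t%:R * ni).
  by rewrite ler_pM2l ?mulr_gt0.
have f2 : 16 * x * ((10 * t) %/ (L ^ 5))%:R <= 16 * x * (10 * t%:R * i ^+ 5).
  by rewrite ler_pM2l ?mulr_gt0.
have f3 : 4 * x * ((326 * L * t) %/ (L ^ 5))%:R <= 4 * x * (326 * x * t%:R * i ^+ 5).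
  by rewrite ler_pM2l ?mulr_gt0.
have f4 : 16 * x * 1 <= 16 * x * (8 * t%:R * ni) by rewrite ler_pM2l ?mulr_gt0.
have f5 : 1000 * 1000 * (1000 * 1000) * (t%:R * i ^+ 3) <= t%:R * i.
  by rewrite mulrCA ler_wpM2l.
have f6 : 0 <= t%:R * i ^+ 3 by rewrite mulr_ge0 // exprn_ge0 // ltW.
lra.
Qed.

End CodeBudget.

Section Containers.
Variables (R : realType) (V : finType) (dn : V -> {set V}) (A B : {set V}) (n L : nat) (w : V -> R).
Hypothesis LP : layer_pair dn A B n w.
Hypothesis n0 : (0 < n)%N.
Notation N := (shadow dn).
Notation up := (upA dn A).
Notation cl := (cl dn A).
Hypothesis hL : (2 * n + 1)%:R <= expR L%:R :> R.
Hypothesis hLn : (L ^ 8 <= n)%N.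
Hypothesis hL0 : (1000 * 1000 <= L)%N.

Lemma card_bigcup_le_prod (I T : finType) (P : {set I}) (F : I -> {set T}) (a b : R) :
  0 <= b -> #|P|%:R <= a -> (forall i, i \in P -> #|F i|%:R <= b) ->
  #|\bigcup_(i in P) F i|%:R <= a * b.
Proof.
move=> b0 Pa Fb; apply: (@le_trans _ _ (\sum_(i in P) #|F i|)%:R); first by rewrite ler_nat card_bigcup_le.
rewrite natr_sum; apply: (@le_trans _ _ (\sum_(i in P) b)); first exact: ler_sum.
by rewrite sumr_const -[leLHS]mulr_natl ler_wpM2r.
Qed.

(* With [F = code_inner S] and [N Z \ F] large, the approximating set [S] itself misses
   [t / L] many points (family [X1]). Otherwise [N Z \ F] is cheap to specify and yields
   the exact closure of [Z], which has only [g - t] points (family [X2]). *)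
Lemma containers (z0 : V) (g t : nat) : (n * n <= g)%N -> (g <= 8 * n * t)%N ->
  exists X1 X2 : {set {set V}},
  [/\ forall X : {set V}, X \in X1 -> X \subset A /\ #|X|%:R + t%:R / (256 * L%:R) <= g%:R :> R,
      #|X1|%:R <= expR (t%:R / (2048 * L%:R)) :> R,
      forall X : {set V}, X \in X2 -> X \subset A /\ (#|X| + t <= g)%N,
      #|X2|%:R <= expR (t%:R / 4) :> R &
      forall Z : {set V}, Z \subset A -> linked dn z0 Z -> #|N Z| = g -> (#|cl Z| + t = g)%N ->
        exists2 X, X \in X1 :|: X2 & Z \subset X].
Proof.
move=> ng gt.
have nR : 0 < n%:R :> R by rewrite ltr0n.
have L0 : (0 < L)%N by move: hL0; clear; lia.
have t0 : (0 < t)%N by move: ng gt n0; clear; case: t => //; lia.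
have tR : 0 < t%:R :> R by rewrite ltr0n.
have LR : 0 < L%:R :> R by rewrite ltr0n.
have hLR : 1000 * 1000 <= L%:R :> R by move: hL0; rewrite -(ler_nat R) natrM.
pose psi := (L ^ 5)%N.
pose l := ((81 * L * g) %/ (n * n) + (10 * t) %/ psi + 1)%N.
pose y2 := ((326 * L * t) %/ psi)%N.
pose rho := (t %/ (64 * L))%N.
pose codeS := code_set dn A B L.
pose S1 := code_hull dn A B L.
pose Sgs := [set Sg : {set V} | (rconn (within dn A 8) z0 Sg && (#|Sg| <= l)%N) && (#|S1 Sg| <= n * g)%N].
pose Ys Sg := [set Y : {set V} | (Y \subset N (S1 Sg)) && (#|Y| <= y2)%N].
pose W := \bigcup_(Sg in Sgs) [set codeS Sg Y | Y in Ys Sg].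
pose Rs S := [set Rr : {set V} | (Rr \subset N S) && (#|Rr| <= rho)%N].
pose hull S Rr := [set z in A | dn z \subset code_inner dn A B L S :|: Rr].
pose W2 := \bigcup_(S in W) [set hull S Rr | Rr in Rs S].
pose X1 := [set X in W | (X \subset A) && (#|X|%:R + t%:R / (256 * L%:R) <= g%:R :> R)].
pose X2 := [set X in W2 | (X \subset A) && (#|X| + t <= g)%N].
have shadow_le (X : {set V}) : X \subset A -> (#|N X| <= n * #|X|)%N.
  move=> XA; apply: leq_trans (card_bigcup_le _ _) _.
  rewrite mulnC -sum_nat_const; apply: leq_sum => z zX; exact: (lp_dnn LP (subsetP XA z zX)).
have S1A Sg : S1 Sg \subset A by apply/subsetP=> z; rewrite inE => /andP[].
have cSgs : #|Sgs|%:R <= expR (16 * L%:R * l%:R) :> R.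
  apply: (@le_trans _ _ (((2 * n + 1) ^ 8) ^ l.*2)%:R).
    rewrite ler_nat; apply: leq_trans (_ : #|[set Z | rconn (within dn A 8) z0 Z & #|Z| <= l]%N| <= _)%N.
      by apply: subset_leq_card; apply/subsetP=> X; rewrite !inE => /andP[].
    apply: card_rconn; [exact: within_refl|exact: within_sym|exact: (card_within LP)].
  rewrite -expnM natrX (_ : 16 * L%:R * l%:R = (8 * l.*2)%:R * L%:R); last first.
    by rewrite -mul2n !natrM; ring.
  by rewrite expRM_natl; apply: lerXn2r; rewrite ?nnegrE ?ler0n ?expR_ge0.
have cW : #|W|%:R <= expR (t%:R / (2048 * L%:R)) :> R.
  apply: (@le_trans _ _ (expR (16 * L%:R * l%:R) * expR (4 * L%:R * y2%:R + 8 * t%:R / n%:R))).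
    apply: card_bigcup_le_prod => //; first exact: expR_ge0.
    move=> Sg; rewrite inE => /andP[_ cS1]; apply: (@le_trans _ _ #|Ys Sg|%:R).
      by rewrite ler_nat leq_imset_card.
    apply: card_few gt => //; apply: leq_trans (shadow_le _ (S1A Sg)) _.
    by rewrite leq_mul2l cS1 orbT.
  by rewrite -expRD ler_expR; apply: code_budget.
exists X1, X2; split.
- by move=> X; rewrite !inE => /and3P[].
- by apply: le_trans cW; rewrite ler_nat; apply: subset_leq_card; apply/subsetP=> X; rewrite inE => /andP[].
- by move=> X; rewrite !inE => /and3P[].
- apply: (@le_trans _ _ #|W2|%:R).
    by rewrite ler_nat; apply: subset_leq_card; apply/subsetP=> X; rewrite inE => /andP[].
  apply: (@le_trans _ _ (expR (t%:R / (2048 * L%:R)) * expR (4 * L%:R * rho%:R + 8 * t%:R / n%:R))).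
    apply: card_bigcup_le_prod => //; first exact: expR_ge0.
    move=> S /bigcupP[Sg]; rewrite inE => /andP[_ cS1] /imsetP[Y _ ->].
    apply: (@le_trans _ _ #|Rs (codeS Sg Y)|%:R); first by rewrite ler_nat leq_imset_card.
    have SS1 : codeS Sg Y \subset S1 Sg by apply/subsetP=> z; rewrite inE => /andP[].
    apply: card_few gt => //; apply: leq_trans (shadow_le _ (subset_trans SS1 (S1A Sg))) _.
    by rewrite leq_mul2l (leq_trans (subset_leq_card SS1) cS1) orbT.
  rewrite -expRD ler_expR.
  have r1 : 4 * L%:R * rho%:R <= t%:R / 16 :> R.
    have : (rho * (64 * L))%:R <= t%:R :> R by rewrite ler_nat leq_trunc_div.
    by rewrite !natrM; lra.
  have r2 : t%:R / (2048 * L%:R) <= t%:R / 16 :> R.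
    by rewrite ler_pM2l // lef_pV2 ?posrE ?mulr_gt0 //; lra.
  have r3 : 8 * t%:R / n%:R <= t%:R / 16 :> R.
    have : (128 <= n)%N.
      by apply: leq_trans hLn; apply: (@leq_trans L); [move: hL0; clear; lia|rewrite -[leqLHS]expn1 leq_pexp2l].
    rewrite -(ler_nat R) => n128; rewrite ler_pdivrMr //.
    have : t%:R * 128 <= t%:R * n%:R :> R by rewrite ler_pM2l.
    lra.
  lra.
move=> Z ZA lZ gE tE.
have ng' : (n * n <= #|N Z|)%N by rewrite gE.
have [Sg [Y [[cSg lSg] sS1 [YN cY] [ZS FN] bound]]] := approximation LP n0 hL hLn hL0 ZA lZ ng'.
have tE' : (#|N Z| - #|cl Z| = t)%N by rewrite gE -tE addKn.
rewrite tE' gE in lSg cY bound sS1.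
set S := codeS Sg Y in ZS FN bound *; set F := code_inner dn A B L S in FN bound.
have SS1 : S \subset S1 Sg by apply/subsetP=> z; rewrite inE => /andP[].
have SA : S \subset A := subset_trans SS1 (S1A Sg).
have SW : S \in W.
  apply/bigcupP; exists Sg; first by rewrite inE cSg lSg sS1.
  by apply: imset_f; rewrite inE YN.
have [small|large] := leqP #|N Z :\: F| rho.
  exists (hull S (N Z :\: F)); last first.
    apply/subsetP=> z zZ; rewrite inE (subsetP ZA) //=; apply/subsetP=> y yz.
    by rewrite !inE (mem_shadow zZ yz) andbT; case: (_ \in F) => //; rewrite ?orbT ?orbN.
  rewrite inE; apply/orP; right; rewrite inE; apply/and3P; split.
  - apply/bigcupP; exists S => //; apply: imset_f; rewrite inE small andbT.
    by apply: subset_trans (subsetDl _ _) _; exact: shadowS.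
  - by apply/subsetP=> z; rewrite inE => /andP[].
  - rewrite -tE leq_add2r; apply: subset_leq_card; apply/subsetP=> z; rewrite !inE => /andP[-> /= h].
    apply: subset_trans h _; rewrite subUset FN; exact: subsetDl.
exists S => //; rewrite inE; apply/orP; left; rewrite inE SW SA /=.
have cF : #|F|%:R + #|N Z :\: F|%:R = g%:R :> R.
  by rewrite -natrD -gE -(cardsID F (N Z)) (setIidPr FN).
have uL : t%:R / (64 * L%:R) <= #|N Z :\: F|%:R :> R.
  rewrite ler_pdivrMr ?mulr_gt0 // -natrM -natrM ler_nat.
  by have := ltn_ceil t (_ : 0 < 64 * L)%N; rewrite muln_gt0 L0 => /(_ isT) h; apply: leq_trans (ltnW h) _; rewrite leq_mul2r large orbT.
have kL : psi%:R * (2 / n%:R) * (488 * L)%:R <= (512 * L%:R)^-1 :> R.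
  rewrite [leLHS](_ : _ = psi%:R * 2 * (488 * L)%:R / n%:R); last by ring.
  rewrite ler_pdivrMr // ler_pdivlMl ?mulr_gt0 //.
  have h : (512 * L * (psi * 2 * (488 * L)) <= n)%N.
    apply: leq_trans hLn; rewrite /psi (_ : 512 * L * (L ^ 5 * 2 * (488 * L)) = (512 * 2 * 488) * L ^ 7)%N; last first.
      by rewrite (_ : 7 = 5 + 1 + 1)%N // !expnD expn1; ring.
    by rewrite (_ : 8 = 1 + 7)%N // expnD expn1 leq_mul2r; apply/orP; right; move: hL0; clear; lia.
  by move: h; rewrite -(ler_nat R) !natrM; lra.
have k2 : psi%:R * (2 / n%:R) <= 2^-1 :> R.
  have h : (4 * psi <= n)%N := psi_small hLn hL0; rewrite mulrA ler_pdivrMr //.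
  by move: h; rewrite -(ler_nat R) natrM; lra.
have kt : psi%:R * (2 / n%:R) * ((488 * L)%:R * t%:R) <= (512 * L%:R)^-1 * t%:R :> R.
  by rewrite mulrA ler_pM2r.
have ku : psi%:R * (2 / n%:R) * #|N Z :\: F|%:R <= 2^-1 * #|N Z :\: F|%:R :> R by rewrite ler_wpM2r.
have eu : g%:R - #|F|%:R = #|N Z :\: F|%:R :> R by rewrite -cF addrAC subrr add0r.
move: bound; rewrite eu mulrDr -cF => bound.
have i1 : t%:R / (64 * L%:R) = 4 * (t%:R / (256 * L%:R)) :> R by field; rewrite gt_eqF.
have i2 : (512 * L%:R)^-1 * t%:R = (t%:R / (256 * L%:R)) / 2 :> R by field; rewrite gt_eqF.
rewrite i1 in uL; rewrite i2 in kt.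
have q0 : 0 <= t%:R / (256 * L%:R) :> R by rewrite divr_ge0 ?mulr_ge0 // ltW.
rewrite -/psi in bound; move: bound ku kt uL q0 {hLR}; rewrite -/psi.
move: (psi%:R * (2 / n%:R) * #|N Z :\: F|%:R) (psi%:R * (2 / n%:R) * ((488 * L)%:R * t%:R)).
move: #|F|%:R #|N Z :\: F|%:R #|S|%:R (t%:R / (256 * L%:R)); clear=> f u s q a b *; lra.
Qed.

End Containers.

(** * Clusters above a layer *)

Section Component.
Variables (T : finType) (r : rel T).

Definition component (Z : {set T}) v := [set u | connect (rstr r Z) v u].

Lemma component_sub (Z : {set T}) v : v \in Z -> component Z v \subset Z.
Proof.
move=> vZ; apply/subsetP=> u; rewrite inE => /connectP[p pp ->].
elim: p v vZ pp => //= x p IH v vZ /andP[/and3P[_ xZ _] px]; exact: IH px.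
Qed.

Lemma component_rconn (Z : {set T}) v : v \in Z -> rconn r v (component Z v).
Proof.
move=> vZ; rewrite /rconn inE connect0 /=; apply/forall_inP=> u; rewrite inE => /connectP[p pp ->].
suff H v' : connect (rstr r Z) v v' -> path (rstr r Z) v' p -> connect (rstr r (component Z v)) v' (last v' p).
  by apply: H => //; exact: connect0.
elim: p v' {pp} => [|x p IH] v' cv' /=; first by rewrite connect0.
move=> /andP[vx px]; have cx : connect (rstr r Z) v x by apply: connect_trans cv' (connect1 vx).
apply: connect_trans (IH x cx px); apply: connect1; apply/and3P; rewrite !inE; split=> //.
by case/and3P: vx.
Qed.

Lemma component_closed (Z : {set T}) v x y : v \in Z -> x \in component Z v -> y \in Z -> r x y ->
  y \in component Z v.
Proof.
move=> vZ xc yZ rxy; have xZ := subsetP (component_sub vZ) x xc; move: xc; rewrite !inE => xc.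
by apply: connect_trans xc (connect1 _); apply/and3P.
Qed.
End Component.

Section Upper.
Variables (R : realType) (V : finType) (dn : V -> {set V}) (rk : V -> nat).
Notation N := (shadow dn).

Definition lay k := [set v : V | rk v == k].
Definition plus (S : {set V}) := [set v | (dn v != set0) && (dn v \subset S)].

(* [ups m S] counts the parts of a down-set lying in the [m] layers that start at the
   layer of [S] when it meets that layer inside [S]. *)
Fixpoint ups m (S : {set V}) : nat :=
  if m is m'.+1 then \sum_(Z : {set V} | Z \subset S) ups m' (plus Z) else 1.

Definition wt m (X : {set V}) : R := 2^-1 ^+ #|N X| * (ups m (plus X))%:R.

Hypothesis h_rk : forall v y, y \in dn v -> rk v = (rk y).+1.
Hypothesis h_ne : forall v, (0 < rk v)%N -> dn v != set0.
Hypothesis h_link : forall v x y, (1 < rk v)%N -> x \in dn v -> y \in dn v -> adj dn x y.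

Lemma plus_lay k (S : {set V}) : S \subset lay k -> plus S \subset lay k.+1.
Proof.
move=> SL; apply/subsetP=> v; rewrite !inE => /andP[/set0Pn[y yv] vS].
have := subsetP SL y (subsetP vS y yv); rewrite inE => /eqP <-; by rewrite (h_rk yv).
Qed.

Lemma plusS (S S' : {set V}) : S \subset S' -> plus S \subset plus S'.
Proof.
by move=> SS; apply/subsetP=> v; rewrite !inE => /andP[-> h]; exact: subset_trans h SS.
Qed.

Lemma shadow_plus (S : {set V}) : N (plus S) \subset S.
Proof. by apply/bigcupsP=> v; rewrite inE => /andP[]. Qed.

Lemma unlinked_disjoint k (S S' : {set V}) : (0 < k)%N -> S \subset lay k ->
  [disjoint N S & N S'] -> [disjoint S & S'].
Proof.
move=> k0 SL dis; rewrite -setI_eq0; apply/eqP/setP=> z; rewrite !inE; apply/negP=> /andP[zS zS'].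
have zk : (0 < rk z)%N by have := subsetP SL z zS; rewrite inE => /eqP->.
have /set0Pn[y yz] := h_ne zk.
by have := disjointFr dis (mem_shadow zS yz); rewrite (mem_shadow zS' yz).
Qed.

Lemma plusU k (S S' : {set V}) : (0 < k)%N -> S \subset lay k -> S' \subset lay k ->
  [disjoint N S & N S'] -> plus (S :|: S') = plus S :|: plus S'.
Proof.
move=> k0 SL SL' dis; apply/eqP; rewrite eqEsubset; apply/andP; split; last first.
  by rewrite subUset !plusS ?subsetUl ?subsetUr.
apply/subsetP=> v vp; have : v \in lay k.+1.
  by apply: subsetP v vp; apply: plus_lay; rewrite subUset SL.
rewrite inE => /eqP rv; move: vp; rewrite !inE => /andP[ne vSS]; rewrite ne /=.
have key (A B : {set V}) x : x \in A -> x \in dn v -> [disjoint N A & N B] ->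
    dn v \subset A :|: B -> dn v \subset A.
  move=> xA xv dAB sub; apply/subsetP=> y yv; have := subsetP sub y yv; case/setUP=> // yB.
  have : adj dn x y by apply: h_link xv yv; rewrite rv.
  case/orP=> [/eqP<-//|]; rewrite -setI_eq0 => /set0Pn[u /setIP[ux uy]].
  by have := disjointFr dAB (mem_shadow xA ux); rewrite (mem_shadow yB uy).
have /set0Pn[x xv] := ne; have /setUP[xS|xS'] := subsetP vSS x xv.
  by rewrite (key S S' x).
by apply/orP; right; rewrite (key S' S x) // ?(setUC S') // disjoint_sym.
Qed.

Lemma ups_plus_le m (S : {set V}) : (ups m (plus S) <= ups m.+1 S)%N.
Proof. by rewrite /= (bigD1 S) //= leq_addr. Qed.

Lemma sum_subsetU (F G : {set V} -> nat) (S S' : {set V}) : [disjoint S & S'] ->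
  \sum_(Z : {set V} | Z \subset S :|: S') F (Z :&: S) * G (Z :&: S') =
  ((\sum_(Z : {set V} | Z \subset S) F Z) * (\sum_(Z : {set V} | Z \subset S') G Z))%N.
Proof.
move=> dis; rewrite big_distrlr pair_big_dep /=.
rewrite (reindex_onto (fun Z => (Z :&: S, Z :&: S')) (fun p => p.1 :|: p.2)) /=; last first.
  move=> [Z1 Z2] /andP[/= s1 s2]; congr (_, _).
    rewrite setIUl (setIidPl s1); apply/setUidPl.
    apply/subsetP=> x /setIP[xZ2 xS]; have := disjointFr dis xS; by rewrite (subsetP s2).
  rewrite setIUl (setIidPl s2); apply/setUidPr.
  apply/subsetP=> x /setIP[xZ1 xS']; have := disjointFl dis xS'; by rewrite (subsetP s1).
apply: eq_bigl => Z; rewrite !subsetIr /= -setIUr.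
by apply/idP/eqP => [/setIidPl|<-] //; exact: subsetIr.
Qed.

Lemma ups_U m k (S S' : {set V}) : (0 < k)%N -> S \subset lay k -> S' \subset lay k ->
  [disjoint N S & N S'] -> ups m (S :|: S') = (ups m S * ups m S')%N.
Proof.
elim: m k S S' => // m IH k S S' k0 SL SL' dis /=.
have dS := unlinked_disjoint k0 SL dis.
rewrite -sum_subsetU //; apply: eq_bigr => Z ZS.
rewrite -[in LHS](setIidPl ZS) setIUr.
have s1 : Z :&: S \subset lay k by apply: subset_trans (subsetIr _ _) SL.
have s2 : Z :&: S' \subset lay k by apply: subset_trans (subsetIr _ _) SL'.
have d12 : [disjoint N (Z :&: S) & N (Z :&: S')].
  by apply: disjointWl (shadowS _ (subsetIr _ _)) _; apply: disjointWr (shadowS _ (subsetIr _ _)) dis.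
rewrite (plusU k0 s1 s2 d12) (IH k.+1) ?plus_lay //.
apply: disjointWl (shadow_plus _) _; apply: disjointWr (shadow_plus _) _.
by apply: disjointWl (subsetIr _ _) _; apply: disjointWr (subsetIr _ _) dS.
Qed.

Lemma wt_ge0 m X : 0 <= wt m X.
Proof. by rewrite mulr_ge0 ?ler0n // exprn_ge0 // invr_ge0. Qed.

Lemma wt_U m k (S S' : {set V}) : (0 < k)%N -> S \subset lay k -> S' \subset lay k ->
  [disjoint N S & N S'] -> wt m (S :|: S') = wt m S * wt m S'.
Proof.
move=> k0 SL SL' dis; rewrite /wt /shadow bigcup_setU -!/(shadow _ _).
rewrite cardsU (disjoint_setI0 dis) cards0 subn0 exprD (plusU k0 SL SL' dis).
rewrite (@ups_U m k.+1) ?plus_lay // ?natrM; first by ring.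
apply: disjointWl (shadow_plus _) _; apply: disjointWr (shadow_plus _) _.
exact: (unlinked_disjoint k0 SL dis).
Qed.

Lemma ler_sum_inj (I J : finType) (P : pred I) (Q : pred J) (h : I -> J) (G : J -> R) :
  (forall i i', P i -> P i' -> h i = h i' -> i = i') -> (forall i, P i -> Q (h i)) ->
  (forall j, 0 <= G j) -> \sum_(i | P i) G (h i) <= \sum_(j | Q j) G j.
Proof.
move=> hinj hPQ G0.
have -> : \sum_(i | P i) G (h i) = \sum_(j in [set h i | i in P]) G j.
  by rewrite big_imset // => i i'; exact: hinj.
rewrite [leRHS](bigID (mem [set h i | i in P])) /= -[leLHS]addr0; apply: lerD; last exact: sumr_ge0.
rewrite le_eqVlt; apply/orP; left; apply/eqP/eq_bigl => j; rewrite andbC.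
by case: imsetP => //= -[i iP ->]; rewrite hPQ.
Qed.

(* Split off the linked component of one point, across which [wt] is multiplicative. *)
Lemma cluster_expansion m k (W : {set V}) (eta : R) : (0 < k)%N -> 0 <= eta -> W \subset lay k ->
  (forall x, x \in lay k -> \sum_(X : {set V} | (X \subset lay k) && linked dn x X) wt m X <= eta) ->
  \sum_(X : {set V} | X \subset W) wt m X <= (1 + eta) ^+ #|W|.
Proof.
move=> k0 e0 WL Hx; have [c] := ubnP #|W|; elim: c W WL => // c IH W WL; rewrite ltnS => Wc.
have [->|/set0Pn[x xW]] := eqVneq W set0.
  rewrite (eq_bigl (pred1 set0)) => [|X]; last by rewrite subset0.
  rewrite big_pred1_eq cards0 expr0 /wt (_ : N set0 = set0); last by rewrite /shadow big_set0.
  rewrite cards0 expr0 mul1r (_ : plus set0 = set0); last first.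
    by apply/setP=> v; rewrite !inE subset0; case: (dn v == set0).
  suff -> : ups m set0 = 1%N by [].
  elim: {IH} m {Hx} => //= m IH; rewrite (eq_bigl (pred1 set0)) => [|X]; last by rewrite subset0.
  rewrite big_pred1_eq (_ : plus set0 = set0) //.
  by apply/setP=> v; rewrite !inE subset0; case: (dn v == set0).
pose W' := W :\ x.
have cW : #|W| = #|W'|.+1 by rewrite (cardsD1 x) xW.
have W'L : W' \subset lay k by apply: subset_trans (subsetDl _ _) WL.
have IH' : \sum_(X : {set V} | X \subset W') wt m X <= (1 + eta) ^+ #|W'|.
  by apply: IH => //; rewrite -cW.
pose S' := \sum_(X : {set V} | X \subset W') wt m X.
have S'0 : 0 <= S' by apply: sumr_ge0 => X _; exact: wt_ge0.
rewrite (bigID (fun X : {set V} => x \in X)) /= addrC cW exprS mulrDl mul1r.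
apply: lerD.
  apply: le_trans IH'; rewrite le_eqVlt; apply/orP; left; apply/eqP/eq_bigl => X.
  by rewrite /W' subsetD1.
pose comp (X : {set V}) := component (adj dn) X x.
apply: (@le_trans _ _ (eta * S')); last by rewrite ler_wpM2l.
rewrite (partition_big comp (fun X0 => (X0 \subset lay k) && linked dn x X0)) /=; last first.
  move=> X /andP[XW xX]; rewrite /comp /linked component_rconn // andbT.
  by apply: subset_trans (component_sub _ xX) _; apply: subset_trans XW WL.
apply: (@le_trans _ _ (\sum_(X0 : {set V} | (X0 \subset lay k) && linked dn x X0) wt m X0 * S')); last first.
  by rewrite -mulr_suml ler_wpM2r // Hx // (subsetP WL).
apply: ler_sum => X0 /andP[X0L lX0].
apply: (@le_trans _ _ (\sum_(X : {set V} | (X \subset W) && (x \in X) && (comp X == X0)) wt m X0 * wt m (X :\: X0))).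
  apply: ler_sum => X /andP[/andP[XW xX] /eqP cX].
  have X0X : X0 \subset X by rewrite -cX component_sub.
  have -> : wt m X = wt m (X0 :|: (X :\: X0)).
    by congr (wt m _); rewrite -{1}(setID X X0) (setIidPr X0X).
  rewrite (@wt_U m k) //.
    by apply: subset_trans (subsetDl _ _) _; apply: subset_trans XW WL.
  rewrite -setI_eq0; apply/eqP/setP=> y; rewrite in_set0; apply/negP=> /setIP[/bigcupP[z zX0 yz] /bigcupP[z' /setDP[z'X nz'] yz']].
  move/negP: nz'; apply; rewrite -cX; apply: (component_closed xX (x := z)) => //.
    by rewrite -/(comp X) cX.
  by apply/orP; right; rewrite -setI_eq0; apply/set0Pn; exists y; exact/setIP.
rewrite -mulr_sumr ler_wpM2l ?wt_ge0 //.
apply: (ler_sum_inj (P := fun X : {set V} => (X \subset W) && (x \in X) && (comp X == X0)) (Q := fun X : {set V} => X \subset W') (h := fun X : {set V} => X :\: X0) (G := wt m)).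
- have rec (X : {set V}) : (X \subset W) && (x \in X) && (comp X == X0) -> X = X0 :|: (X :\: X0).
    move=> /andP[/andP[XW xX] /eqP cX].
    have X0X : X0 \subset X by rewrite -cX component_sub.
    by rewrite -{1}(setID X X0) (setIidPr X0X).
  by move=> X Y /rec eX /rec eY e; rewrite eX e -eY.
- move=> X /andP[/andP[XW xX] /eqP cX]; rewrite /W' subsetD1 in_setD -cX.
  rewrite inE connect0 /= andbT; apply: subset_trans (subsetDl _ _) XW.
- exact: wt_ge0.
Qed.

Lemma card_between (X S : {set V}) : X \subset S ->
  (\sum_(Z : {set V} | (X \subset Z) && (Z \subset S)) 1 = 2 ^ (#|S| - #|X|))%N.
Proof.
move=> XS; rewrite (reindex_onto (fun Y => X :|: Y) (fun Z => Z :\: X)) /=; last first.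
  by move=> Z /andP[XZ _]; rewrite setUC -{2}(setID Z X) (setIidPr XZ) setUC.
rewrite (_ : #|S| - #|X| = #|S :\: X|)%N; last by rewrite cardsD (setIidPr XS).
rewrite -card_powerset -sum1_card; apply: eq_bigl => Y; rewrite !inE subsetUl subUset XS /=.
rewrite setDUl setDv set0U; apply/andP/idP => [[YS /eqP <-]|]; first exact: setSD.
rewrite subsetD => /andP[YS dis]; split=> //; apply/eqP/setDidPl; by [].
Qed.

Lemma ups_two m (S : {set V}) :
  (ups m.+2 S)%:R = 2 ^+ #|S| * \sum_(X : {set V} | X \subset plus S) wt m X :> R.
Proof.
rewrite /= (exchange_big_dep (fun X : {set V} => X \subset plus S)) /=; last first.
  by move=> Z X ZS XZ; apply: subset_trans XZ (plusS ZS).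
rewrite natr_sum mulr_sumr; apply: eq_bigr => X XS.
have NS : N X \subset S by apply: subset_trans (shadowS _ XS) (shadow_plus S).
rewrite (eq_bigl (fun Z : {set V} => (N X \subset Z) && (Z \subset S))); last first.
  move=> Z; rewrite andbC; congr (_ && _); apply/idP/idP => XZ.
    by apply: subset_trans (shadowS _ XZ) (shadow_plus _).
  apply/subsetP=> v vX; rewrite inE; have := subsetP XS v vX; rewrite inE => /andP[-> _] /=.
  by apply: subset_trans XZ; exact: bigcup_sup.
have -> : (\sum_(Z : {set V} | (N X \subset Z) && (Z \subset S)) ups m (plus X) =
    2 ^ (#|S| - #|N X|) * ups m (plus X))%N.
  by rewrite -card_between // big_distrl /=; apply: eq_bigr => Z _; rewrite mul1n.
rewrite natrM natrX /wt mulrA; congr (_ * _).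
have h2 : 2 ^+ #|N X| != 0 :> R by rewrite expf_neq0 // pnatr_eq0.
by rewrite -[in RHS](subnKC (subset_leq_card NS)) exprD mulrAC exprVn mulfV ?mul1r.
Qed.

End Upper.

Lemma half_le_expR (R : realType) k : 2^-1 ^+ k <= expR (- (k%:R / 2)) :> R.
Proof.
rewrite -mulrN expRM_natl; apply: lerXn2r; rewrite ?nnegrE ?invr_ge0 ?expR_ge0 //.
by apply: le_trans (expR_ge1Dx _); lra.
Qed.

Lemma two_le_expR (R : realType) : 2 <= expR 1 :> R.
Proof. by apply: le_trans (expR_ge1Dx _); lra. Qed.

Lemma geom_half (R : realType) M :
  \sum_(s < M.+1) (if s == 0 :> nat then 0 else 2^-1 ^+ s) = 1 - 2^-1 ^+ M :> R.
Proof.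
elim: M => [|M IH]; first by rewrite big_ord_recr big_ord0 /= expr0 subrr addr0.
by rewrite big_ord_recr /= IH exprS; field.
Qed.

Section Clusters.
Variables (R : realType) (V : finType) (dn : V -> {set V}) (rk : V -> nat) (n L : nat) (w : V -> R).
Notation N := (shadow dn).
Notation lay := (lay rk).
Notation wt := (wt R dn).
Notation ups := (ups dn).
Notation plus := (plus dn).
Hypothesis h_rk : forall v y, y \in dn v -> rk v = (rk y).+1.
Hypothesis h_ne : forall v, (0 < rk v)%N -> dn v != set0.
Hypothesis h_link : forall v x y, (1 < rk v)%N -> x \in dn v -> y \in dn v -> adj dn x y.
Hypothesis LPk : forall k, (n < k)%N -> layer_pair dn (lay k) (lay k.-1) n w.
Hypothesis n0 : (0 < n)%N.
Hypothesis hL : (2 * n + 1)%:R <= expR L%:R :> R.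
Hypothesis hLn : (L ^ 8 <= n)%N.
Hypothesis hL0 : (1000 * 1000 <= L)%N.
Hypothesis hV : #|V|.+1%:R <= expR (2 * n%:R) :> R.
Hypothesis h_small : forall k (Z : {set V}), (n < k)%N -> Z \subset lay k ->
  (#|N Z| <= n ^ 4)%N -> (32 * L * #|Z| <= #|N Z|)%N.

Let eta : R := (n%:R ^+ 2)^-1.
Let nR : 0 < n%:R :> R. Proof. by rewrite ltr0n. Qed.
Let L0 : (0 < L)%N. Proof. by move: hL0; clear; lia. Qed.
Let LR : 0 < L%:R :> R. Proof. by rewrite ltr0n. Qed.

Let eta0 : 0 <= eta. Proof. by rewrite invr_ge0 exprn_ge0. Qed.

Lemma n_big : (1000 * 1000 * 1000 * 1000 * L <= n)%N.
Proof.
apply: leq_trans hLn; rewrite (_ : 8 = 6 + 1 + 1)%N // !expnD expn1 leq_mul2r; apply/orP; right.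
apply: (@leq_trans ((1000 * 1000) * L)); first by move: hL0; clear; lia.
rewrite leq_mul2r; apply/orP; right; apply: leq_trans hL0 _.
by rewrite -[leqLHS]expn1 leq_pexp2l.
Qed.

Lemma half_growth (g : nat) (X : {set V}) : (#|X| <= g)%N ->
  2^-1 ^+ g * (2 * (1 + eta)) ^+ #|X| <= expR (- ((g%:R - #|X|%:R) / 2) + g%:R / n%:R ^+ 2).
Proof.
move=> Xg; rewrite expRD exprMn mulrA; apply: ler_pM.
- by rewrite mulr_ge0 ?exprn_ge0 // invr_ge0.
- by rewrite exprn_ge0 // addr_ge0.
- rewrite -{1}(subnK Xg) exprD -mulrA -exprMn mulVf ?expr1n ?mulr1; last by rewrite pnatr_eq0.
  by apply: le_trans (half_le_expR _ _) _; rewrite natrB.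
apply: (@le_trans _ _ (expR eta ^+ #|X|)).
  by apply: lerXn2r; rewrite ?nnegrE ?addr_ge0 ?expR_ge0 //; exact: expR_ge1Dx.
by rewrite -expRM_natl ler_expR ler_wpM2r // ler_nat.
Qed.

Section Layer.
Variables (k m : nat) (z0 : V).
Hypothesis nk : (n < k)%N.
Notation A := (lay k).
Hypothesis growth : forall X : {set V}, X \subset A -> (ups m.+1 X)%:R <= (2 * (1 + eta)) ^+ #|X|.

Let LP := LPk nk.

Lemma sum_below (X : {set V}) g : X \subset A ->
  \sum_(Z : {set V} | (Z \subset X) && (#|N Z| == g)) wt m Z <= 2^-1 ^+ g * (2 * (1 + eta)) ^+ #|X|.
Proof.
move=> XA; apply: (@le_trans _ _ (2^-1 ^+ g * (ups m.+1 X)%:R)); last first.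
  by rewrite ler_wpM2l ?growth // exprn_ge0 // invr_ge0.
rewrite /= natr_sum mulr_sumr [leRHS](bigID (fun Z : {set V} => #|N Z| == g)) /= -[leLHS]addr0.
apply: lerD; last by apply: sumr_ge0 => Z _; rewrite mulr_ge0 ?exprn_ge0 ?invr_ge0.
by apply: ler_sum => Z /andP[_ /eqP <-].
Qed.

Lemma class_sum g t : (n * n <= g)%N -> (g <= 8 * n * t)%N ->
  \sum_(Z : {set V} | [&& Z \subset A, linked dn z0 Z, #|N Z| == g & #|cl dn A Z| + t == g]%N) wt m Z
   <= 2 * expR (- (t%:R / (1024 * L%:R))).
Proof.
move=> ng gt.
have [X1 [X2 [h1 c1 h2 c2 cov]]] := containers LP n0 hL hLn hL0 z0 ng gt.
pose F (X : {set V}) := \sum_(Z : {set V} | (Z \subset X) && (#|N Z| == g)) wt m Z.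
have F0 X : 0 <= F X by apply: sumr_ge0 => Z _; exact: wt_ge0.
have gn : g%:R / n%:R ^+ 2 <= t%:R / (8192 * L%:R) :> R.
  rewrite ler_pdivrMr ?exprn_gt0 // mulrAC ler_pdivlMr ?mulr_gt0 //.
  have hg : g%:R <= 8 * n%:R * t%:R :> R by rewrite -!natrM ler_nat.
  have hn : 8 * 8192 * L%:R <= n%:R :> R.
    by have := n_big; rewrite -(ler_nat R) !natrM; have := LR; lra.
  apply: (@le_trans _ _ (8 * n%:R * t%:R * (8192 * L%:R))); first by rewrite ler_wpM2r ?mulr_ge0 // ltW.
  rewrite [leLHS](_ : _ = (8 * 8192 * L%:R) * (n%:R * t%:R)); last by ring.
  rewrite [leRHS](_ : _ = n%:R * (n%:R * t%:R)); last by ring.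
  by rewrite ler_wpM2r ?mulr_ge0.
have q0 : 0 <= t%:R / L%:R :> R by rewrite divr_ge0.
have qL : t%:R / L%:R <= t%:R :> R.
  by rewrite ler_pdivrMr // ler_peMr // ler1n.
have frac (c : R) : 0 < c -> t%:R / (c * L%:R) = c^-1 * (t%:R / L%:R).
  by move=> c0; field; rewrite !gt_eqF.
rewrite !frac // in h1 c1 gn *.
set q := t%:R / L%:R in q0 qL h1 c1 gn *.
have B1 : \sum_(X in X1) F X <= expR (- (1024^-1 * q)).
  apply: (@le_trans _ _ (\sum_(X in X1) expR (- (512^-1 * q) + 8192^-1 * q))).
    apply: ler_sum => X XX1; have [XA cX] := h1 X XX1.
    apply: le_trans (sum_below g XA) _; apply: le_trans (half_growth _) _.
      by rewrite -(ler_nat R); lra.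
    by rewrite ler_expR; lra.
  rewrite sumr_const -[leLHS]mulr_natl.
  apply: (@le_trans _ _ (expR (2048^-1 * q) * expR (- (512^-1 * q) + 8192^-1 * q))).
    by rewrite ler_wpM2r ?expR_ge0.
  by rewrite -expRD ler_expR; lra.
have B2 : \sum_(X in X2) F X <= expR (- (1024^-1 * q)).
  apply: (@le_trans _ _ (\sum_(X in X2) expR (- (2^-1 * t%:R) + 8192^-1 * q))).
    apply: ler_sum => X XX2; have [XA cX] := h2 X XX2.
    have cX' : #|X|%:R + t%:R <= g%:R :> R by rewrite -natrD ler_nat.
    apply: le_trans (sum_below g XA) _; apply: le_trans (half_growth _) _.
      by apply: leq_trans cX; exact: leq_addr.
    by rewrite ler_expR; lra.
  rewrite sumr_const -[leLHS]mulr_natl.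
  apply: (@le_trans _ _ (expR (t%:R / 4) * expR (- (2^-1 * t%:R) + 8192^-1 * q))).
    by rewrite ler_wpM2r ?expR_ge0.
  by rewrite -expRD ler_expR; lra.
apply: (@le_trans _ _ (\sum_(X in X1 :|: X2) F X)).
  rewrite /F (exchange_big_dep (fun Z : {set V} => #|N Z| == g)) /=; last by move=> X Z _ /andP[].
  rewrite [leRHS](bigID (fun Z : {set V} => [&& Z \subset A, linked dn z0 Z, #|N Z| == g & #|cl dn A Z| + t == g]%N)) /=.
  rewrite -[leLHS]addr0; apply: lerD; last first.
    by apply: sumr_ge0 => Z _; apply: sumr_ge0 => X _; exact: wt_ge0.
  rewrite [leRHS](eq_bigl (fun Z : {set V} => [&& Z \subset A, linked dn z0 Z, #|N Z| == g & #|cl dn A Z| + t == g]%N)).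
    apply: ler_sum => Z /and4P[ZA lZ /eqP gE /eqP tE].
    have [X XX ZX] := cov Z ZA lZ gE tE.
    rewrite (bigD1 X) /=; last by rewrite XX ZX gE eqxx.
    by rewrite lerDl; apply: sumr_ge0 => X' _; exact: wt_ge0.
  by move=> Z; case: (#|N Z| == g); rewrite ?andbF.
apply: (@le_trans _ _ (\sum_(X in X1) F X + \sum_(X in X2) F X)); last by lra.
rewrite [leLHS](big_setID X1) /= setUK setDUl setDv set0U lerD2l.
rewrite [leRHS](big_setID X1) /= lerDr; exact: sumr_ge0.
Qed.

Lemma large_clusters :
  \sum_(Z : {set V} | [&& Z \subset A, linked dn z0 Z & n ^ 4 <= #|N Z|]%N) wt m Z <= expR (- (n%:R ^+ 2)).
Proof.
pose M := #|V|.+1.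
pose key (Z : {set V}) : 'I_M * 'I_M := (inord #|N Z|, inord (#|N Z| - #|cl dn A Z|)).
rewrite (partition_big key xpredT) //=.
apply: (@le_trans _ _ (\sum_(p : 'I_M * 'I_M) 2 * expR (- (8192^-1 * (n%:R ^+ 3 / L%:R))))).
  apply: ler_sum => p _.
  case: (pickP (fun Z : {set V} => [&& Z \subset A, linked dn z0 Z & n ^ 4 <= #|N Z|]%N && (key Z == p))); last first.
    by move=> no; rewrite big_pred0 ?mulr_ge0 ?expR_ge0.
  have kval Z : (key Z == p) = (#|N Z| == p.1) && (#|N Z| - #|cl dn A Z| == p.2)%N.
    by rewrite /key; case: p => a b /=; rewrite xpair_eqE -!val_eqE /= !inordK ?ltnS ?max_card // (leq_trans (leq_subr _ _)) ?max_card.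
  move=> Z0 /andP[/and3P[Z0A _ n4]]; rewrite kval => /andP[/eqP g0E /eqP t0E].
  have gt : (p.1 <= 8 * n * p.2)%N by rewrite -g0E -t0E; exact: (t_large LP n0 Z0A).
  have ng : (n * n <= p.1)%N.
    by rewrite -g0E; apply: leq_trans n4; rewrite mulnn leq_pexp2l.
  apply: (@le_trans _ _ (2 * expR (- (p.2%:R / (1024 * L%:R))))).
    apply: le_trans (class_sum ng gt); rewrite le_eqVlt; apply/orP; left; apply/eqP.
    apply: eq_bigl => Z; rewrite kval; apply/idP/idP.
      move=> /andP[/and3P[ZA lZ _] /andP[/eqP gE /eqP tE]]; rewrite ZA lZ gE eqxx /= -tE -gE.
      by apply/eqP; exact: (def_t LP n0 ZA).
    move=> /and4P[ZA lZ /eqP gE /eqP tE]; rewrite ZA lZ gE -g0E n4 eqxx /= g0E -tE addKn //.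
  rewrite ler_pM2l // ler_expR lerN2.
  rewrite [leRHS](_ : _ = 1024^-1 * (p.2%:R / L%:R)); last by field; rewrite gt_eqF.
  rewrite mulrA [leRHS]mulrA ler_pM2r ?invr_gt0 //.
  have h : (n ^ 3 <= 8 * p.2)%N.
    by rewrite -(leq_pmul2r n0) -expnSr mulnAC; apply: leq_trans gt; rewrite -g0E.
  by move: h; rewrite -(ler_nat R) natrX natrM; lra.
rewrite sumr_const card_prod card_ord -[leLHS]mulr_natl natrM.
have two := two_le_expR R.
apply: (@le_trans _ _ (expR (2 * n%:R) * expR (2 * n%:R) * (expR 1 * expR (- (8192^-1 * (n%:R ^+ 3 / L%:R)))))).
  apply: ler_pM => //; rewrite ?mulr_ge0 ?expR_ge0 //.
    by apply: ler_pM.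
  by rewrite ler_wpM2r ?expR_ge0.
rewrite -!expRD ler_expR.
have h : 1000 * 1000 * 1000 * 1000 <= n%:R / L%:R :> R.
  by rewrite ler_pdivlMr //; have := n_big; rewrite -(ler_nat R) !natrM.
have n1 : 1 <= n%:R :> R by rewrite ler1n.
have n2 : n%:R <= n%:R ^+ 2 :> R by rewrite expr2 ler_peMl.
have h2 : 1000 * 1000 * 1000 * 1000 * n%:R ^+ 2 <= n%:R ^+ 3 / L%:R :> R.
  by rewrite [leRHS](_ : _ = n%:R / L%:R * n%:R ^+ 2); [rewrite ler_wpM2r // exprn_ge0|ring].
lra.
Qed.

Lemma adj_rb2 (Z : {set V}) : Z \subset A -> linked dn z0 Z -> rconn (within dn A 2) z0 Z.
Proof.
move=> ZA /andP[z0Z /forall_inP conZ]; rewrite /rconn z0Z; apply/forall_inP=> u uZ.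
apply: connect_sub (conZ u uZ) => x y /and3P[xZ yZ axy]; apply: connect1; apply/and3P; split=> //.
case/orP: axy => [/eqP->|]; first exact: within_refl.
rewrite -setI_eq0 => /set0Pn[v /setIP[vx vy]].
have [xA yA] := (subsetP ZA x xZ, subsetP ZA y yZ).
by apply: (@within_cat _ _ _ 1 1 _ v); rewrite within1 /hasse_near ?xA ?yA ?vx ?vy !orbT.
Qed.

Lemma linked_count :
  \sum_(Z : {set V} | (Z \subset A) && linked dn z0 Z) expR (- (7 * L%:R * #|Z|%:R)) <= 1 :> R.
Proof.
pose M := #|V|.+1.
rewrite (partition_big (fun Z : {set V} => inord #|Z| : 'I_M) xpredT) //=.
apply: (@le_trans _ _ (\sum_(s < M) (if s == 0 :> nat then 0 else 2^-1 ^+ s))).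
  apply: ler_sum => s _.
  have kval (Z : {set V}) : ((inord #|Z| : 'I_M) == s) = (#|Z| == s).
    by rewrite -val_eqE /= inordK // ltnS max_card.
  case: eqP => [s0|/eqP s0].
    rewrite big_pred0 // => Z; rewrite kval s0 cards_eq0; apply/negP=> /andP[/andP[_ /andP[zZ _]] /eqP Z0].
    by rewrite Z0 inE in zZ.
  apply: (@le_trans _ _ (\sum_(Z in [set Z | rconn (within dn A 2) z0 Z & #|Z| <= s]%N) expR (- (7 * L%:R * s%:R)))).
    rewrite [leRHS](bigID (fun Z : {set V} => (Z \subset A) && linked dn z0 Z && (inord #|Z| == s :> 'I_M))) /=.
    rewrite -[leLHS]addr0; apply: lerD; last by apply: sumr_ge0 => Z _; exact: expR_ge0.
    rewrite le_eqVlt; apply/orP; left; apply/eqP.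
    rewrite [RHS](eq_bigl (fun Z : {set V} => (Z \subset A) && linked dn z0 Z && (inord #|Z| == s :> 'I_M))).
      by apply: eq_bigr => Z /andP[_]; rewrite kval => /eqP ->.
    move=> Z; rewrite inE; apply/andP/idP => [[_]//|h]; split=> //; move: h => /andP[/andP[ZA lZ]].
    by rewrite kval => /eqP <-; rewrite leqnn andbT; exact: adj_rb2.
  rewrite sumr_const -[leLHS]mulr_natl.
  apply: (@le_trans _ _ (expR (4 * L%:R * s%:R) * expR (- (7 * L%:R * s%:R)))).
    rewrite ler_wpM2r ?expR_ge0 //; apply: (@le_trans _ _ (((2 * n + 1) ^ 2) ^ s.*2)%:R).
      by rewrite ler_nat; apply: card_rconn; [exact: within_refl|exact: within_sym|exact: (card_within LP)].
    rewrite -expnM natrX (_ : 4 * L%:R * s%:R = (2 * s.*2)%:R * L%:R); last first.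
      by rewrite -mul2n !natrM; ring.
    by rewrite expRM_natl; apply: lerXn2r; rewrite ?nnegrE ?ler0n ?expR_ge0.
  rewrite -expRD; apply: (@le_trans _ _ (expR (- 1) ^+ s)).
    rewrite -expRM_natl ler_expR mulrN1.
    have : 1 * s%:R <= L%:R * s%:R :> R by rewrite ler_wpM2r // ler1n.
    have := ler0n R s; lra.
  apply: lerXn2r; rewrite ?nnegrE ?expR_ge0 ?invr_ge0 // expRN lef_pV2 ?posrE ?expR_gt0 //.
  exact: two_le_expR.
by rewrite geom_half gerBl exprn_ge0 // invr_ge0.
Qed.



Lemma small_clusters (g0 : nat) :
  \sum_(Z : {set V} | [&& Z \subset A, linked dn z0 Z, #|N Z| < n ^ 4 & g0 <= #|N Z|]%N) wt m Z
    <= expR (- (g0%:R / 4)).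
Proof.
apply: (@le_trans _ _ (\sum_(Z : {set V} | (Z \subset A) && linked dn z0 Z) expR (- (g0%:R / 4)) * expR (- (7 * L%:R * #|Z|%:R)))); last first.
  by rewrite -mulr_sumr ler_piMr ?expR_ge0 ?linked_count.
rewrite [leRHS](bigID (fun Z : {set V} => [&& Z \subset A, linked dn z0 Z, #|N Z| < n ^ 4 & g0 <= #|N Z|]%N)) /=.
rewrite -[leLHS]addr0; apply: lerD; last by apply: sumr_ge0 => Z _; rewrite mulr_ge0 ?expR_ge0.
rewrite [leRHS](eq_bigl (fun Z : {set V} => [&& Z \subset A, linked dn z0 Z, #|N Z| < n ^ 4 & g0 <= #|N Z|]%N)); last first.
  by move=> Z; case: (Z \subset A); case: (linked dn z0 Z).
apply: ler_sum => Z /and4P[ZA lZ lt gN].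
have h := h_small nk ZA (ltnW lt).
have two := two_le_expR R.
have e1 : eta <= 1.
  by rewrite /eta invf_le1 ?exprn_gt0 // exprn_ege1 // ler1n.
have u4 : (ups m (plus Z))%:R <= expR (2 * #|Z|%:R) :> R.
  apply: (@le_trans _ _ (ups m.+1 Z)%:R); first by rewrite ler_nat ups_plus_le.
  apply: le_trans (growth ZA) _; rewrite [X in expR X]mulrC expRM_natl; apply: lerXn2r; rewrite ?nnegrE ?expR_ge0 ?mulr_ge0 ?addr_ge0 //.
  rewrite (_ : 2 = 1 + 1 :> R) // expRD; apply: ler_pM => //; rewrite ?addr_ge0 //.
  by apply: le_trans two; rewrite lerD2l.
rewrite /wt -expRD; apply: (@le_trans _ _ (expR (- (#|N Z|%:R / 2)) * expR (2 * #|Z|%:R))).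
  by apply: ler_pM; rewrite ?exprn_ge0 ?invr_ge0 ?half_le_expR.
rewrite -expRD ler_expR.
have hg : g0%:R <= #|N Z|%:R :> R by rewrite ler_nat.
have h' : 32 * L%:R * #|Z|%:R <= #|N Z|%:R :> R by rewrite -!natrM ler_nat.
have hL' : 2 * #|Z|%:R <= L%:R * #|Z|%:R :> R.
  by rewrite ler_wpM2r // ler_nat; move: hL0; clear; lia.
lra.
Qed.

Lemma all_clusters (g0 : nat) : (g0 <= 4 * n ^ 2)%N ->
  \sum_(Z : {set V} | [&& Z \subset A, linked dn z0 Z & g0 <= #|N Z|]%N) wt m Z
    <= 2 * expR (- (g0%:R / 4)).
Proof.
move=> gn; rewrite (bigID (fun Z : {set V} => #|N Z| < n ^ 4)%N) /= mulr_natl mulr2n; apply: lerD.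
  apply: le_trans (small_clusters g0); rewrite le_eqVlt; apply/orP; left; apply/eqP/eq_bigl => Z.
  by case: (Z \subset A); case: (linked dn z0 Z); rewrite //= andbC.
apply: (@le_trans _ _ (expR (- (n%:R ^+ 2)))); last first.
  by rewrite ler_expR lerN2 ler_pdivrMr // -natrX -natrM ler_nat mulnC.
apply: le_trans large_clusters.
rewrite [leRHS](bigID (fun Z : {set V} => (g0 <= #|N Z|)%N)) /= -[leLHS]addr0; apply: lerD; last first.
  by apply: sumr_ge0 => Z _; exact: wt_ge0.
rewrite le_eqVlt; apply/orP; left; apply/eqP/eq_bigl => Z; rewrite -leqNgt.
by case: (Z \subset A); case: (linked dn z0 Z); rewrite //= andbC.
Qed.

End Layer.

Lemma cluster_eta k m x : (n < k)%N ->
  (forall X : {set V}, X \subset lay k -> (ups m.+1 X)%:R <= (2 * (1 + eta)) ^+ #|X|) ->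
  x \in lay k -> \sum_(X : {set V} | (X \subset lay k) && linked dn x X) wt m X <= eta.
Proof.
move=> nk growth xk.
have LP := LPk nk.
rewrite (eq_bigl (fun X : {set V} => [&& X \subset lay k, linked dn x X & n./2 <= #|N X|]%N)); last first.
  move=> X; case: (boolP (X \subset lay k)) => //= XA; case: (boolP (linked dn x X)) => //= lX.
  apply/esym; have xX : x \in X by case/andP: lX.
  apply: (@leq_trans #|dn x|); last by apply: subset_leq_card; exact: bigcup_sup.
  by rewrite -(leq_pmul2l (isT : 0 < 2)%N); apply: leq_trans (lp_dn2 LP xk); rewrite mul2n -[leqRHS]odd_double_half leq_addl.
have n1 : (n ./2 <= 4 * n ^ 2)%N.
  apply: (@leq_trans n); first by rewrite -[leqRHS]odd_double_half -addnn addnA leq_addl.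
  by rewrite expnS expn1 mulnCA leq_pmulr // muln_gt0 n0.
apply: le_trans (all_clusters x nk growth n1) _.
have two := two_le_expR R.
apply: (@le_trans _ _ (expR 1 * expR (- ((n./2)%:R / 4)))); first by rewrite ler_wpM2r ?expR_ge0.
rewrite -expRD; apply: (@le_trans _ _ (expR (- (2 * L%:R)))).
  rewrite ler_expR.
  have : (n <= 2 * n./2 + 1)%N by rewrite -[leqLHS]odd_double_half mul2n addnC leq_add2l; case: (odd n).
  rewrite -(ler_nat R) natrD natrM.
  have := n_big; rewrite -(ler_nat R) !natrM.
  have : 1 <= L%:R :> R by rewrite ler1n.
  lra.
rewrite /eta expRN lef_pV2 ?posrE ?exprn_gt0 ?expR_gt0 // mulrC expRM_natr.
apply: lerXn2r; rewrite ?nnegrE ?expR_ge0 ?ler0n //; apply: le_trans hL.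
by rewrite ler_nat; clear; lia.
Qed.

Lemma ups_growth m k (S : {set V}) : (n < k)%N -> S \subset lay k ->
  (ups m S)%:R <= (2 * (1 + eta)) ^+ #|S|.
Proof.
have e1 : 1 <= 1 + eta by rewrite lerDl.
suff H : (forall k (S : {set V}), (n < k)%N -> S \subset lay k -> (ups m S)%:R <= (2 * (1 + eta)) ^+ #|S|) /\
         (forall k (S : {set V}), (n < k)%N -> S \subset lay k -> (ups m.+1 S)%:R <= (2 * (1 + eta)) ^+ #|S|).
  by move=> nk Sk; apply: H.1 nk Sk.
elim: m {k S} => [|m [_ IH]]; split=> // k S nk Sk.
- by rewrite exprn_ege1 //; lra.
- rewrite /= sum1_card -cardsE (_ : [set Z : {set V} | _] = powerset S); last by apply/setP=> Z; rewrite !inE.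
  rewrite card_powerset natrX; apply: lerXn2r; rewrite ?nnegrE //; lra.
- rewrite (ups_two R) exprMn ler_wpM2l ?exprn_ge0 //.
  have nk1 : (n < k.+1)%N by apply: leq_trans nk _.
  have pL : plus S \subset lay k.+1 := plus_lay h_rk Sk.
  apply: (@le_trans _ _ ((1 + eta) ^+ #|plus S|)).
    apply: (cluster_expansion h_rk h_ne h_link _ eta0 pL) => // x xk.
    by apply: cluster_eta xk => // X XL; apply: IH nk1 XL.
  apply: ler_weXn2l => //.
  have ex := lp_ex (LPk nk1) pL; have := subset_leq_card (shadow_plus dn S).
  apply: leq_trans; rewrite -(leq_pmul2l (_ : 0 < 8 * n)%N) ?muln_gt0 ?n0 //.
  by apply: leq_trans ex; rewrite leq_addl.
Qed.

End Clusters.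

(** * The grid *)

Section Grid.
Variable n : nat.
Notation V := (grid3 n).
Implicit Types (v x y z : V) (i j : 'I_n).

Definition co v i : nat := tnth v i.
Definition upd v i (a : 'I_3) : V := [tuple if j == i then a else tnth v j | j < n].
Definition dec v i := upd v i (inord (co v i).-1).
Definition inc v i := upd v i (inord (co v i).+1).
Definition rank v := (\sum_i co v i)%N.
Definition supp v := [set i | (0 < co v i)%N].
Definition room v := [set i | (co v i < 2)%N].
Definition dn v := [set dec v i | i in supp v].
Definition cnt v (a : nat) := #|[set i | co v i == a]|.

Lemma co_lt3 v i : (co v i < 3)%N. Proof. exact: ltn_ord. Qed.

Lemma coP x y : (forall i, co x i = co y i) -> x = y.
Proof. by move=> h; apply: eq_from_tnth => i; apply: val_inj; exact: h. Qed.

Lemma co_dec v i j : co (dec v i) j = (co v j - (j == i))%N.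
Proof.
rewrite /co tnth_mktuple; case: eqP => [->|_]; last by rewrite subn0.
rewrite inordK ?subn1 //; have := co_lt3 v i; lia.
Qed.

Lemma co_inc v i j : i \in room v -> co (inc v i) j = (co v j + (j == i))%N.
Proof.
rewrite inE => lt; rewrite /co tnth_mktuple; case: eqP => [->|_]; last by rewrite addn0.
by rewrite inordK ?addn1.
Qed.

Lemma decK v i : i \in supp v -> inc (dec v i) i = v.
Proof.
rewrite inE => h; apply: coP => j; rewrite co_inc ?inE co_dec.
  by case: eqP => [->|_] /=; lia.
by rewrite eqxx; have := co_lt3 v i; lia.
Qed.

Lemma incK v i : i \in room v -> dec (inc v i) i = v.
Proof. by move=> h; apply: coP => j; rewrite co_dec co_inc // addnK. Qed.

Lemma room_dec v i : i \in supp v -> i \in room (dec v i).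
Proof. by rewrite !inE co_dec eqxx; have := co_lt3 v i; lia. Qed.

Lemma supp_inc v i : i \in room v -> i \in supp (inc v i).
Proof. by move=> h; rewrite inE co_inc // eqxx addn1. Qed.

Lemma dec_coord_inj v : {in supp v &, injective (dec v)}.
Proof.
move=> i j; rewrite !inE => hi hj e; apply/eqP; apply: contraT => ij.
have := congr1 (fun u => co u i) e; rewrite /= !co_dec eqxx (negbTE ij); lia.
Qed.

Lemma inc_coord_inj v : {in room v &, injective (inc v)}.
Proof.
move=> i j hi hj e; apply/eqP; apply: contraT => ij.
have := congr1 (fun u => co u i) e; rewrite /= !co_inc // eqxx (negbTE ij); lia.
Qed.

Lemma card_dn v : #|dn v| = #|supp v|.
Proof. by rewrite card_in_imset //; exact: dec_coord_inj. Qed.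

Lemma rank_dec v i : i \in supp v -> rank v = (rank (dec v i)).+1.
Proof.
rewrite inE => h; rewrite /rank (bigD1 i) //= [in RHS](bigD1 i) //= co_dec eqxx.
rewrite (eq_bigr (fun j => co (dec v i) j)) => [|j /negbTE ji]; last by rewrite co_dec ji subn0.
lia.
Qed.

Lemma rank_dn v y : y \in dn v -> rank v = (rank y).+1.
Proof. by case/imsetP=> i iv ->; exact: rank_dec. Qed.

Lemma dn_nonempty v : (0 < rank v)%N -> dn v != set0.
Proof.
move=> rv; rewrite -card_gt0 card_dn card_gt0; apply: contraTneq rv => e.
rewrite /rank big1 // => i _; apply/eqP; rewrite -leqn0 leqNgt.
by have := in_set0 i; rewrite -e inE => ->.
Qed.

Lemma dec_dec v i j : dec (dec v i) j = dec (dec v j) i.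
Proof. by apply: coP => l; rewrite !co_dec -!subnDA addnC. Qed.

Lemma dn_adj v x y : x \in dn v -> y \in dn v -> adj dn x y.
Proof.
move=> /imsetP[i iv ->] /imsetP[j jv ->]; rewrite /adj; case: (eqVneq i j) => [->|ij]; first by rewrite eqxx.
apply/orP; right; rewrite -setI_eq0; apply/set0Pn; exists (dec (dec v i) j).
move: iv jv; rewrite !inE => iv jv; apply/andP; split; last rewrite dec_dec.
  by apply: imset_f; rewrite inE co_dec eq_sym (negbTE ij) subn0.
by apply: imset_f; rewrite inE co_dec (negbTE ij) subn0.
Qed.

Lemma dn_mem y z : (y \in dn z) = [exists i in room y, z == inc y i].
Proof.
apply/imsetP/exists_inP => [[i iz ->]|[i iy /eqP ->]].
  by exists i; rewrite ?room_dec // decK.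
by exists i; rewrite ?supp_inc // incK.
Qed.

Lemma upA_lay k y : rank y = k.-1 -> (0 < k)%N -> upA dn (lay rank k) y = [set inc y i | i in room y].
Proof.
move=> ry k0; apply/setP=> z; rewrite !inE dn_mem; apply/andP/imsetP.
  by move=> [_ /exists_inP[i iy /eqP->]]; exists i.
move=> [i iy ->]; split; last by apply/exists_inP; exists i.
by rewrite (rank_dec (supp_inc iy)) incK // ry prednK.
Qed.

Lemma card_up k y : rank y = k.-1 -> (0 < k)%N -> #|upA dn (lay rank k) y| = #|room y|.
Proof. by move=> ry k0; rewrite (upA_lay ry k0) card_in_imset //; exact: inc_coord_inj. Qed.

Lemma card_sum (P : pred 'I_n) : #|[set i | P i]| = (\sum_i P i)%N.
Proof. by rewrite cardsE -sum1_card big_mkcond /=; apply: eq_bigr => i _; rewrite unfold_in. Qed.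

Lemma cnt_sum v : (cnt v 0 + cnt v 1 + cnt v 2)%N = n.
Proof.
transitivity (\sum_(i < n) 1)%N; last by rewrite sum1_card card_ord.
rewrite /cnt !card_sum -!big_split /=.
by apply: eq_bigr => i _; have := co_lt3 v i; case: (co v i) => [|[|[|]]].
Qed.

Lemma rank_cnt v : rank v = (cnt v 1 + 2 * cnt v 2)%N.
Proof.
rewrite /rank /cnt !card_sum big_distrr /= -!big_split /=.
by apply: eq_bigr => i _; have := co_lt3 v i; case: (co v i) => [|[|[|]]].
Qed.

Lemma supp_cnt v : #|supp v| = (cnt v 1 + cnt v 2)%N.
Proof.
rewrite /cnt !card_sum -!big_split /=.
by apply: eq_bigr => i _; have := co_lt3 v i; case: (co v i) => [|[|[|]]].
Qed.

Lemma room_cnt v : #|room v| = (cnt v 0 + cnt v 1)%N.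
Proof.
rewrite /cnt !card_sum -!big_split /=.
by apply: eq_bigr => i _; have := co_lt3 v i; case: (co v i) => [|[|[|]]].
Qed.

Lemma cnt_dec v i a : i \in supp v ->
  (cnt (dec v i) a + (co v i == a) = cnt v a + (co v i == a.+1))%N.
Proof.
rewrite inE => h; rewrite /cnt !card_sum (bigD1 i) //= [in RHS](bigD1 i) //= co_dec eqxx.
rewrite (eq_bigr (fun j => nat_of_bool (co v j == a))) => [|j /negbTE ji]; last by rewrite co_dec ji subn0.
by rewrite subn1; case: (co v i) h => //= c _; rewrite eqSS; lia.
Qed.

Lemma dn_cod z z' : z != z' -> (#|dn z :&: dn z'| <= 1)%N.
Proof.
move=> zz'; rewrite leqNgt; apply/negP=> /card_gt1P[y1 [y2 [/setIP[y1z y1z'] /setIP[y2z y2z'] ne]]].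
have /imsetP[i iz e1] := y1z; have /imsetP[j jz e2] := y2z.
move: y1z'; rewrite dn_mem => /exists_inP[i' i'r /eqP e1'].
move: y2z'; rewrite dn_mem => /exists_inP[j' j'r /eqP e2'].
have ij : i != j by apply: contraNneq ne => ij; rewrite e1 e2 ij.
have := congr1 (fun u => co u i) e2'; rewrite /= {1}e1' !co_inc // e1 e2 !co_dec eqxx (negbTE ij).
case: (eqVneq i i') => [ii'|ii'] /=; last first.
  by move: iz; rewrite inE; case: (i == j'); lia.
by case/eqP: zz'; rewrite e1' e1 -ii' decK.
Qed.

Lemma supp_bounds y : (n <= rank y)%N -> [/\ (n <= 2 * #|supp y|)%N, (#|room y| <= #|supp y|)%N,
  (#|supp y| <= n)%N & (#|supp y| + n = #|room y| + rank y)%N].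
Proof. by have := cnt_sum y; rewrite rank_cnt supp_cnt room_cnt => e h; split; lia. Qed.

End Grid.

(** * Expansion in the grid *)

Lemma flow_bound (R : realDomainType) (V : finType) (dn : V -> {set V}) (A X : {set V})
    (phi : V -> V -> R) (c C : R) :
  X \subset A -> (forall y z, 0 <= phi y z) ->
  (forall z, z \in A -> c <= \sum_(y in dn z) phi y z) ->
  (forall y, y \in shadow dn X -> \sum_(z in upA dn A y) phi y z <= C) ->
  c * #|X|%:R <= C * #|shadow dn X|%:R.
Proof.
move=> XA phi0 hc hC; rewrite !mulr_natr -!sumr_const.
apply: (@le_trans _ _ (\sum_(z in X) \sum_(y in dn z) phi y z)).
  by apply: ler_sum => z zX; apply/hc/(subsetP XA).
apply: (@le_trans _ _ (\sum_(y in shadow dn X) \sum_(z in upA dn A y) phi y z)); last exact: ler_sum.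
rewrite (exchange_big_dep (fun y => y \in shadow dn X)) /=; last first.
  by move=> z y zX yz; exact: mem_shadow yz.
apply: ler_sum => y _; rewrite [leRHS](bigID (fun z => z \in X)) /= -[leLHS]addr0.
apply: lerD; last exact: sumr_ge0.
rewrite le_eqVlt; apply/orP; left; apply/eqP/eq_bigl => z; rewrite inE.
by case: (boolP (z \in X)) => [zX|]; rewrite ?andbF // (subsetP XA z zX) andbT.
Qed.

Lemma flow_gain (R : realFieldType) (a b : R) : 0 <= a -> 0 <= b -> 0 < a + b -> 2 <= 2 * a + b ->
  1 + (7 * (2 * a + b + 1))^-1 <=
  (a + 1) * ((a + b + 1)^-1 * (1 + a / (2 * (2 * a + b + 1) ^+ 2))) +
  b * ((a + b)^-1 * (1 - (b - 1) / (2 * (2 * a + b + 1) ^+ 2))).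
Proof.
move=> a0 b0 s0 N2; set s := a + b; set M := 2 * a + b + 1.
have M0 : 0 < M by rewrite /M; lra.
have sM : s + 1 <= M by rewrite /s /M; lra.
have s1 : 0 < s + 1 by rewrite /s; lra.
have ne : [/\ s != 0, s + 1 != 0 & M != 0] by rewrite !gt_eqF.
case: ne => n1 n2 n3.
have -> : (a + 1) * ((s + 1)^-1 * (1 + a / (2 * M ^+ 2))) + b * (s^-1 * (1 - (b - 1) / (2 * M ^+ 2))) =
  1 + b / (s * (s + 1)) + (a * (a + 1) / (s + 1) - b * (b - 1) / s) / (2 * M ^+ 2).
  by rewrite /s in n1 n2 *; field; rewrite n1 n2 n3.
have h1 : b / M ^+ 2 <= b / (s * (s + 1)).
  rewrite ler_wpM2l // lef_pV2 ?posrE ?mulr_gt0 ?exprn_gt0 //.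
  by rewrite expr2; apply: ler_pM => //; rewrite ?ltW //; lra.
have h2 : a - b <= a * (a + 1) / (s + 1) - b * (b - 1) / s.
  have e : a * (a + 1) / (s + 1) - b * (b - 1) / s - (a - b) = (a * b + b * (s + 1)) / (s * (s + 1)).
    by rewrite /s in n1 n2 *; field; rewrite n1 n2.
  rewrite -subr_ge0 e divr_ge0 ?mulr_ge0 ?addr_ge0 ?mulr_ge0 ?addr_ge0 //; exact: ltW.
have h3 : (a - b) / (2 * M ^+ 2) <= (a * (a + 1) / (s + 1) - b * (b - 1) / s) / (2 * M ^+ 2).
  by rewrite ler_pM2r // invr_gt0 mulr_gt0 // exprn_gt0.
have h4 : b / M ^+ 2 + (a - b) / (2 * M ^+ 2) = s / (2 * M ^+ 2).
  by rewrite /s; field; rewrite n3.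
have h5 : (7 * M)^-1 <= s / (2 * M ^+ 2).
  rewrite ler_pdivlMr ?mulr_gt0 ?exprn_gt0 //.
  rewrite (_ : (7 * M)^-1 * (2 * M ^+ 2) = 2 / 7 * M); last by field; rewrite n3.
  by rewrite /s /M in sM *; lra.
lra.
Qed.

Section GridLayers.
Variables (R : realType) (n : nat).
Notation V := (grid3 n).
Hypothesis n100 : (100 <= n)%N.
Notation N := (shadow (@dn n)).
Notation lay := (lay (@rank n)).

Definition wsupp (y : V) : R := (#|supp y|%:R)^-1.

Let n0 : (0 < n)%N. Proof. by apply: leq_trans n100. Qed.
Let nR : 0 < n%:R :> R. Proof. by rewrite ltr0n. Qed.

Lemma sum_supp_value (z : V) (al be : R) :
  \sum_(i in supp z) (if co z i == 1%N then al else be) = (cnt z 1)%:R * al + (cnt z 2)%:R * be.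
Proof.
rewrite /cnt !card_sum !natr_sum !mulr_suml -big_split /= big_mkcond /=.
apply: eq_bigr => i _; rewrite inE; have := co_lt3 z i.
by case: (co z i) => [|[|[|]]] //= _; rewrite ?mul0r ?mul1r ?addr0 ?add0r.
Qed.

Lemma sum_room_value (z : V) (al be : R) :
  \sum_(i in room z) (if co z i == 0%N then al else be) = (cnt z 0)%:R * al + (cnt z 1)%:R * be.
Proof.
rewrite /cnt !card_sum !natr_sum !mulr_suml -big_split /= big_mkcond /=.
apply: eq_bigr => i _; rewrite inE; have := co_lt3 z i.
by case: (co z i) => [|[|[|]]] //= _; rewrite ?mul0r ?mul1r ?addr0 ?add0r.
Qed.

Lemma sum_dn (z : V) (F : V -> R) : \sum_(y in dn z) F y = \sum_(i in supp z) F (dec z i).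
Proof. by rewrite /dn big_imset // => i j iz jz; exact (dec_coord_inj iz jz). Qed.

Lemma sum_up k (y : V) (F : V -> R) : rank y = k.-1 -> (0 < k)%N ->
  \sum_(z in upA (@dn n) (lay k) y) F z = \sum_(i in room y) F (inc y i).
Proof. by move=> ry k0; rewrite (upA_lay ry k0) big_imset //; exact: inc_coord_inj. Qed.

Lemma rank_shadow k (X : {set V}) y : X \subset lay k -> y \in N X -> rank y = k.-1.
Proof.
move=> XL /bigcupP[z zX yz]; have := subsetP XL z zX; rewrite inE => /eqP <-.
by rewrite (rank_dn yz).
Qed.

Lemma wsupp_dn (z : V) : (n < rank z)%N -> 1 <= \sum_(y in dn z) wsupp y.
Proof.
move=> nz; have [h1 h2 h3 h4] := supp_bounds (ltnW nz).
have s0 : (0 < #|supp z|)%N by lia.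
apply: (@le_trans _ _ (\sum_(y in dn z) (#|supp z|%:R)^-1)).
  by rewrite sumr_const card_dn -[leRHS]mulr_natl mulfV // pnatr_eq0 -lt0n.
apply: ler_sum => y yz; have ry := rank_dn yz.
have hr : (n <= rank y)%N by lia.
have [g1 g2 g3 g4] := supp_bounds hr.
rewrite lef_pV2 ?posrE ?ltr0n ?ler_nat //; last by lia.
have /imsetP[i _ ->] := yz.
by apply: subset_leq_card; apply/subsetP=> j; rewrite !inE co_dec; lia.
Qed.

(* In the pair of layers [n], [n.+1] the uniform flow [wsupp] is tight on some elements; the
   second-order corrections, of opposite signs for the steps 0 -> 1 and 1 -> 2, create a gain
   of order [1 / n] at each element of layer [n.+1] (see [flow_gain]). *)
Definition kind_flow (y z : V) : R :=
  if cnt z 0 == cnt y 0 then (#|supp y|%:R)^-1 * (1 + (cnt y 0)%:R / (2 * n%:R ^+ 2))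
  else (#|supp y|%:R)^-1 * (1 - (cnt y 1)%:R / (2 * n%:R ^+ 2)).

Lemma kind_flow_ge0 y z : 0 <= kind_flow y z.
Proof.
rewrite /kind_flow; case: ifP => _; rewrite mulr_ge0 ?invr_ge0 //.
  by rewrite addr_ge0 // divr_ge0 ?mulr_ge0 ?exprn_ge0.
rewrite subr_ge0 ler_pdivrMr ?mulr_gt0 ?exprn_gt0 // mul1r -natrX -natrM ler_nat.
have le : (cnt y 1 <= n)%N by have := cnt_sum y; lia.
by apply: leq_trans le _; rewrite expnS expn1 mulnCA leq_pmulr // muln_gt0 n0.
Qed.

Lemma kind_flow_up y : rank y = n -> \sum_(z in upA (@dn n) (lay n.+1) y) kind_flow y z <= 1.
Proof.
move=> ry; rewrite (@sum_up n.+1 y _ ry) //.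
have hr : (n <= rank y)%N by rewrite ry.
have [h1 h2 h3 h4] := supp_bounds hr.
rewrite (eq_bigr (fun i => if co y i == 0%N then (#|supp y|%:R)^-1 * (1 - (cnt y 1)%:R / (2 * n%:R ^+ 2))
   else (#|supp y|%:R)^-1 * (1 + (cnt y 0)%:R / (2 * n%:R ^+ 2)))) => [|i ir]; last first.
  have := cnt_dec 0 (supp_inc ir); rewrite incK // co_inc // eqxx addn1 !eqSS /=.
  rewrite addn0 /kind_flow => ->; case: (co y i == 0%N); last by rewrite addn0 eqxx.
  by rewrite ifF //; apply/eqP; lia.
rewrite sum_room_value.
have e : (cnt y 0)%:R + (cnt y 1)%:R = #|supp y|%:R :> R.
  rewrite -natrD; congr (_%:R); move: h4 ry; rewrite rank_cnt supp_cnt room_cnt; have := cnt_sum y; lia.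
have s0 : #|supp y|%:R != 0 :> R by rewrite pnatr_eq0 -lt0n; lia.
rewrite le_eqVlt; apply/orP; left; apply/eqP; rewrite -e in s0 *; field.
by rewrite s0 gt_eqF.
Qed.

Lemma kind_flow_dn z : rank z = n.+1 -> 1 + (7 * n%:R)^-1 <= \sum_(y in dn z) kind_flow y z.
Proof.
move=> rz; rewrite sum_dn.
have hr : (n <= rank z)%N by rewrite rz.
have [h1 h2 h3 h4] := supp_bounds hr.
have e0 : (cnt z 2 = cnt z 0 + 1)%N by move: rz; rewrite rank_cnt; have := cnt_sum z; lia.
have e1 : (n = 2 * cnt z 0 + cnt z 1 + 1)%N by have := cnt_sum z; lia.
have c0 : 0 <= (cnt z 0)%:R :> R by [].
have c1 : 0 <= (cnt z 1)%:R :> R by [].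
have nE : n%:R = 2 * (cnt z 0)%:R + (cnt z 1)%:R + 1 :> R.
  transitivity ((2 * cnt z 0 + cnt z 1 + 1)%N%:R : R); first by congr (_%:R); exact: e1.
  by rewrite !(natrM, natrD).
rewrite (eq_bigr (fun i => if co z i == 1%N then
   ((cnt z 0)%:R + (cnt z 1)%:R)^-1 * (1 - ((cnt z 1)%:R - 1) / (2 * n%:R ^+ 2))
   else ((cnt z 0)%:R + (cnt z 1)%:R + 1)^-1 * (1 + (cnt z 0)%:R / (2 * n%:R ^+ 2)))) => [|i iz]; last first.
  have := cnt_dec 0 iz; have := cnt_dec 1 iz; have := cnt_dec 2 iz.
  rewrite /kind_flow !supp_cnt; move: iz; rewrite inE; have := co_lt3 z i.
  case: (co z i) => [|[|[|c]]] //= _ _; rewrite !addn0 ?addn1 => d2 d1 d0.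
    rewrite d0 ifF; last by apply/eqP; lia.
    have -> : (cnt (dec z i) 1 + cnt (dec z i) 2 = cnt z 0 + cnt z 1)%N by lia.
    have -> : (cnt (dec z i) 1)%:R = (cnt z 1)%:R - 1 :> R by rewrite -d1 -[in RHS]addn1 natrD addrK.
    by rewrite natrD.
  rewrite d0 eqxx; have -> : (cnt (dec z i) 1 + cnt (dec z i) 2 = cnt z 0 + cnt z 1 + 1)%N by lia.
  by rewrite !natrD.
have p0 : 0 < (cnt z 0)%:R + (cnt z 1)%:R :> R by rewrite -natrD ltr0n; lia.
have p2 : 2 <= 2 * (cnt z 0)%:R + (cnt z 1)%:R :> R by rewrite -natrM -natrD ler_nat; lia.
by rewrite sum_supp_value e0 natrD [leRHS]addrC nE; exact: flow_gain.
Qed.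

Lemma expansion k (X : {set V}) : (n < k)%N -> X \subset lay k ->
  (#|N X| + 8 * n * #|X| <= 8 * n * #|N X|)%N.
Proof.
move=> nk XL; rewrite -(ler_nat R) natrD !natrM.
have [e|nk1] := eqVneq k n.+1.
  subst k; have H : (1 + (7 * n%:R)^-1) * #|X|%:R <= 1 * #|N X|%:R :> R.
    apply: (flow_bound XL kind_flow_ge0) => [z|y yN]; first by rewrite inE => /eqP; exact: kind_flow_dn.
    by apply: kind_flow_up; rewrite (rank_shadow XL yN).
  rewrite mul1r mulrDl mul1r in H.
  have H2 : n%:R * ((7 * n%:R)^-1 * #|X|%:R) = 7^-1 * #|X|%:R :> R by field; rewrite gt_eqF.
  have H3 : n%:R * (#|X|%:R + (7 * n%:R)^-1 * #|X|%:R) <= n%:R * #|N X|%:R :> R by rewrite ler_pM2l.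
  have H4 : 100 * #|X|%:R <= n%:R * #|X|%:R :> R by rewrite ler_wpM2r // ler_nat.
  have H5 : 0 <= #|N X|%:R :> R by [].
  have H6 : 100 * #|N X|%:R <= n%:R * #|N X|%:R :> R by rewrite ler_wpM2r // ler_nat.
  have [small|big] := leP (#|N X|%:R : R) (8 / 7 * #|X|%:R); first by rewrite mulrDr H2 in H3; lra.
  have H7 : 8 / 7 * (n%:R * #|X|%:R) <= n%:R * #|N X|%:R :> R by rewrite mulrCA ler_pM2l // ltW.
  lra.
have k0 : (0 < k)%N by lia.
have H : 1 * #|X|%:R <= (1 - (n%:R)^-1) * #|N X|%:R :> R.
  apply: (flow_bound (phi := fun y _ => wsupp y) XL) => [y _|z|y yN].
  - by rewrite invr_ge0.
  - by rewrite inE => /eqP rz; apply: wsupp_dn; rewrite rz.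
  have ry := rank_shadow XL yN.
  have hr : (n <= rank y)%N by rewrite ry; lia.
  have [h1 h2 h3 h4] := supp_bounds hr.
  rewrite sumr_const (card_up ry k0) -[leLHS]mulr_natl /wsupp.
  have s0 : (0 < #|supp y|)%N by lia.
  rewrite ler_pdivrMr ?ltr0n // mulrBl mul1r.
  have : (#|room y| + 1 <= #|supp y|)%N by lia.
  rewrite -(ler_nat R) natrD => g.
  have : (n%:R)^-1 * #|supp y|%:R <= 1 :> R by rewrite ler_pdivrMl // mulr1 ler_nat.
  lra.
have H3 : n%:R * #|X|%:R <= n%:R * ((1 - (n%:R)^-1) * #|N X|%:R) :> R by move: H; rewrite mul1r ler_pM2l.
have H2 : n%:R * ((1 - (n%:R)^-1) * #|N X|%:R) = n%:R * #|N X|%:R - #|N X|%:R :> R by field; rewrite gt_eqF.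
have H5 : 0 <= #|N X|%:R :> R by [].
lra.
Qed.

Lemma expansion_high k (X : {set V}) : (4 * n < 3 * k.-1)%N -> X \subset lay k ->
  (#|N X| + 10 * #|X| <= 10 * #|N X|)%N.
Proof.
move=> nk XL; rewrite -(ler_nat R) natrD !natrM.
have k0 : (0 < k)%N by lia.
have H : 1 * #|X|%:R <= (2 / 3) * #|N X|%:R :> R.
  apply: (flow_bound (phi := fun y _ => wsupp y) XL) => [y _|z|y yN].
  - by rewrite invr_ge0.
  - by rewrite inE => /eqP rz; apply: wsupp_dn; rewrite rz; lia.
  have ry := rank_shadow XL yN.
  have hr : (n <= rank y)%N by rewrite ry; lia.
  have [h1 h2 h3 h4] := supp_bounds hr.
  rewrite sumr_const (card_up ry k0) -[leLHS]mulr_natl /wsupp.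
  have s0 : (0 < #|supp y|)%N by lia.
  rewrite ler_pdivrMr ?ltr0n //.
  have : (3 * #|room y| <= 2 * #|supp y|)%N by lia.
  by rewrite -(ler_nat R) !natrM; lra.
have H5 : 0 <= #|N X|%:R :> R by [].
lra.
Qed.

Lemma grid_layer_pair k : (n < k)%N -> layer_pair (@dn n) (lay k) (lay k.-1) n wsupp.
Proof.
move=> nk; have k0 : (0 < k)%N by lia.
split.
- move=> z; rewrite inE => /eqP rz; apply/subsetP=> y yz; rewrite inE.
  by have := rank_dn yz; rewrite rz => ->.
- rewrite disjoint_subset; apply/subsetP=> z; rewrite !inE => /eqP ->; lia.
- move=> y; rewrite inE => /eqP ry; rewrite (card_up ry k0).
  by apply: leq_trans (max_card _) _; rewrite card_ord.
- by move=> z _; rewrite card_dn; apply: leq_trans (max_card _) _; rewrite card_ord.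
- move=> z; rewrite inE card_dn => /eqP rz.
  have hr : (n <= rank z)%N by rewrite rz ltnW.
  by have [] := supp_bounds hr.
- by move=> z z' _ _; exact: dn_cod.
- by move=> z; rewrite inE => /eqP rz; apply: wsupp_dn; rewrite rz.
- move=> y; rewrite inE => /eqP ry; rewrite (card_up ry k0) /wsupp.
  have hr : (n <= rank y)%N by rewrite ry; lia.
  have [h1 h2 h3 h4] := supp_bounds hr.
  by rewrite ler_pdivrMr ?ltr0n ?mul1r ?ler_nat //; lia.
- move=> y; rewrite inE => /eqP ry; rewrite /wsupp.
  have hr : (n <= rank y)%N by rewrite ry; lia.
  have [h1 h2 h3 h4] := supp_bounds hr.
  have s0 : (0 < #|supp y|)%N by lia.
  rewrite lef_pV2 ?posrE ?ltr0n ?ler_nat // h3 /= ler_pdivlMr // mulrC ler_pdivrMr ?ltr0n //.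
  by rewrite -natrM ler_nat.
- by move=> X; exact: expansion.
have [hi|lo] := ltnP (4 * n) (3 * k.-1); [right|left].
  by move=> X; exact: expansion_high.
move=> y; rewrite inE => /eqP ry; rewrite (card_up ry k0).
have := cnt_sum y; have := ry; rewrite rank_cnt room_cnt; lia.
Qed.

End GridLayers.

Section EdgeIsoperimetry.
Variables (R : realType) (n : nat).
Notation V := (grid3 n).
Notation N := (shadow (@dn n)).
Notation lay := (lay (@rank n)).

Definition xlnx (a : nat) : R := a%:R * ln a%:R.

Lemma xlnx_add (a b : nat) : xlnx a + xlnx b + (minn a b)%:R * ln 2 <= xlnx (a + b).
Proof.
wlog ab : a b / (a <= b)%N.
  by move=> H; case/orP: (leq_total a b) => [/H //|/H]; rewrite minnC addnC [xlnx b + _]addrC.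
rewrite (minn_idPl ab) /xlnx; case: (posnP a) => [->|a0]; first by rewrite !mul0r !add0r addr0.
have aR : 0 < a%:R :> R by rewrite ltr0n.
have bR : 0 < b%:R :> R by rewrite ltr0n (leq_trans a0 ab).
rewrite [X in _ <= X * _]natrD mulrDl addrAC -mulrDr.
apply: lerD; rewrite ler_wpM2l ?ler0n //.
  rewrite -lnM ?posrE // ler_ln ?posrE ?mulr_gt0 ?ltr0n ?addn_gt0 ?a0 //.
  by rewrite -natrM ler_nat; lia.
by rewrite ler_ln ?posrE // ?ltr0n ?addn_gt0 ?a0 // ler_nat leq_addl.
Qed.

Definition edges (i : 'I_n) (W : {set V}) := #|[set v in W | (i \in room v) && (inc v i \in W)]|.
Definition slab (i : 'I_n) (W : {set V}) c := [set v in W | co v i == c].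

Lemma slab_sum i (W : {set V}) (P : pred V) :
  #|[set v in W | P v]| = (#|[set v in slab i W 0 | P v]| + #|[set v in slab i W 1 | P v]| +
    #|[set v in slab i W 2 | P v]|)%N.
Proof.
have e c : #|[set v in slab i W c | P v]| = (\sum_(v in W) (P v && (co v i == c)))%N.
  rewrite -sum1_card big_mkcond [RHS]big_mkcond /=; apply: eq_bigr => v _; rewrite !inE.
  by case: (v \in W); case: (P v); case: (co v i == c).
rewrite !e -!big_split /= -sum1_card big_mkcond [RHS]big_mkcond /=; apply: eq_bigr => v _.
rewrite inE; case: (v \in W) => //=; have := co_lt3 v i.
by case: (P v); case: (co v i) => [|[|[|]]].
Qed.

Lemma edges_slab i j (W : {set V}) : i != j ->
  edges j W = (edges j (slab i W 0) + edges j (slab i W 1) + edges j (slab i W 2))%N.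
Proof.
move=> ij; rewrite /edges (slab_sum i).
have e c : [set v in slab i W c | (j \in room v) && (inc v j \in W)] =
    [set v in slab i W c | (j \in room v) && (inc v j \in slab i W c)].
  apply/setP=> v; rewrite !inE; case: (boolP (j \in room v)); rewrite inE => jr; rewrite ?jr ?(negbTE jr) ?andbF //=.
  by rewrite co_inc ?inE // (negbTE ij) addn0; case: (v \in W); case: (co v i == c); rewrite ?andbF ?andbT.
by rewrite !e.
Qed.

Lemma edges_cut i (W : {set V}) :
  (edges i W <= minn #|slab i W 0| #|slab i W 1| + minn #|slab i W 1| #|slab i W 2|)%N.
Proof.
have lo c : (#|[set v in slab i W c | (i \in room v) && (inc v i \in W)]| <= #|slab i W c|)%N.
  by apply: subset_leq_card; apply/subsetP=> v; rewrite inE => /andP[].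
have hi c : (#|[set v in slab i W c | (i \in room v) && (inc v i \in W)]| <= #|slab i W c.+1|)%N.
  rewrite -(card_in_imset (f := fun v => inc v i)).
    apply: subset_leq_card; apply/subsetP=> u /imsetP[v]; rewrite !inE => /andP[/andP[vW /eqP vc] /andP[ir iW]] ->.
    by rewrite iW co_inc ?inE // eqxx vc addn1 eqxx.
  move=> u v; rewrite !inE => /andP[_ /andP[ur _]] /andP[_ /andP[vr _]] e.
  by rewrite -(incK (i := i) (v := u)) ?inE // e incK // inE.
rewrite /edges (slab_sum i) [X in (_ + X)%N](_ : _ = 0)%N ?addn0; last first.
  apply/eqP; rewrite cards_eq0; apply/eqP/setP=> v; rewrite !inE.
  by case: (v \in W); case: eqP => //= ->.
by apply: leq_add; rewrite leq_min lo hi.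
Qed.

(* Cut along the coordinates one after the other; [xlnx_add] pays for the edges across a cut. *)
Lemma edge_isoperimetry (s : seq 'I_n) (W : {set V}) : uniq s ->
  (\sum_(i <- s) edges i W)%:R * ln 2 <= xlnx #|W|.
Proof.
elim: s W => [|i s IH] W /= => [_|/andP[nis us]].
  rewrite big_nil mul0r /xlnx; case: (posnP #|W|) => [->|W0]; first by rewrite mul0r.
  by rewrite mulr_ge0 // ln_ge0 // ler1n.
rewrite big_cons.
have -> : (\sum_(j <- s) edges j W = \sum_(j <- s) edges j (slab i W 0) +
    \sum_(j <- s) edges j (slab i W 1) + \sum_(j <- s) edges j (slab i W 2))%N.
  rewrite -!big_split /= big_seq [RHS]big_seq; apply: eq_bigr => j js.
  by apply: edges_slab; apply: contraNneq nis => ->.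
have cW : #|W| = (#|slab i W 0| + (#|slab i W 1| + #|slab i W 2|))%N.
  have e (A : {set V}) : [set v in A | predT v] = A by apply/setP=> v; rewrite inE andbT.
  by have := slab_sum i W predT; rewrite !e addnA.
have l2 : 0 <= ln 2 :> R by rewrite ln_ge0 // ler1n.
have h0 := IH (slab i W 0) us; have h1 := IH (slab i W 1) us; have h2 := IH (slab i W 2) us.
have := xlnx_add #|slab i W 0| (#|slab i W 1| + #|slab i W 2|).
have := xlnx_add #|slab i W 1| #|slab i W 2|; rewrite -cW.
have : (edges i W)%:R * ln 2 <= (minn #|slab i W 0| (#|slab i W 1| + #|slab i W 2|))%:R * ln 2 +
   (minn #|slab i W 1| #|slab i W 2|)%:R * ln 2 :> R.
  rewrite -mulrDl ler_wpM2r // -natrD ler_nat; apply: leq_trans (edges_cut _ _) _.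
  by rewrite leq_add2r leq_min geq_minl /= (leq_trans (geq_minr _ _)) // leq_addr.
rewrite !natrD !mulrDl; lra.
Qed.

Lemma small_expansion L k (Z : {set V}) : (100 <= n)%N -> (2 * n + 1)%:R <= expR L%:R :> R ->
  (1280 * L ^ 2 <= n)%N -> (0 < L)%N -> (n < k)%N -> Z \subset lay k ->
  (#|N Z| <= n ^ 4)%N -> (32 * L * #|Z| <= #|N Z|)%N.
Proof.
move=> n100 hL nL L0 nk ZL small.
have ex := expansion R n100 nk ZL.
have ZN : (#|Z| <= #|N Z|)%N.
  by rewrite -(leq_pmul2l (_ : 0 < 8 * n)%N) ?muln_gt0 ?(leq_trans _ n100) //; apply: leq_trans ex; rewrite leq_addl.
have [->|Z0] := posnP #|Z|; first by rewrite muln0.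
have N0 : (0 < #|N Z|)%N := leq_trans Z0 ZN.
pose W := Z :|: N Z.
have cW : (#|W| <= 2 * #|N Z|)%N.
  by apply: leq_trans (leq_card_setU _ _) _; rewrite mul2n -addnn leq_add2r.
have iso := edge_isoperimetry W (enum_uniq 'I_n).
have deg : (#|Z| * n <= 2 * \sum_(i <- enum 'I_n) edges i W)%N.
  apply: (@leq_trans (2 * \sum_(z in Z) #|supp z|)).
    rewrite -sum_nat_const big_distrr /=; apply: leq_sum => z zZ.
    have := subsetP ZL z zZ; rewrite inE => /eqP rz.
    have hr : (n <= rank z)%N by rewrite rz ltnW.
    by have [] := supp_bounds hr.
  rewrite leq_mul2l /= big_enum /=.
  rewrite (eq_bigr (fun z : V => \sum_(i < n) (i \in supp z))%N) => [|z _]; last by rewrite {1}/supp card_sum; apply: eq_bigr => i _; rewrite inE.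
  rewrite exchange_big /=; apply: leq_sum => i _.
  rewrite -[leqLHS](_ : #|[set dec z i | z in [set z in Z | i \in supp z]]| = _).
    apply: subset_leq_card; apply/subsetP=> v /imsetP[z]; rewrite inE => /andP[zZ iz] ->.
    rewrite !inE decK // zZ /=; have -> /= : (co (dec z i) i < 2)%N by have := room_dec iz; rewrite inE.
    by rewrite (mem_shadow zZ) ?orbT //; apply: imset_f.
  rewrite card_in_imset => [|z z']; last first.
    rewrite !inE => /andP[_ zi] /andP[_ zi'] e.
    by rewrite -(decK (i := i) (v := z)) ?inE // e decK // inE.
  by rewrite -sum1_card big_mkcond [RHS]big_mkcond; apply: eq_bigr => z _; rewrite !inE; case: (z \in Z); case: (_ < _)%N.
have l2 : 2^-1 <= ln 2 :> R.
  rewrite -ler_expR lnK ?posrE //; have := half_le_expR R 1; rewrite expr1 expRN => h.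
  by rewrite -lef_pV2 ?posrE ?expR_gt0 //; move: h; rewrite mul1r.
have lnn : ln #|W|%:R <= 5 * L%:R :> R.
  rewrite -ler_expR lnK ?posrE ?ltr0n; last by apply: leq_trans Z0 _; apply: subset_leq_card; exact: subsetUl.
  apply: (@le_trans _ _ ((2 * n + 1) ^ 5)%:R).
    rewrite ler_nat; apply: leq_trans cW _; apply: (@leq_trans (2 * n ^ 4)); first by rewrite leq_mul2l.
    rewrite (expnS _ 4); apply: leq_mul; first by lia.
    by rewrite leq_exp2r //; clear; lia.
  by rewrite natrX (expRM_natl 5); apply: lerXn2r; rewrite ?nnegrE ?expR_ge0 ?ler0n.
have f1 : #|Z|%:R * n%:R <= 2 * (\sum_(i <- enum 'I_n) edges i W)%:R :> R by rewrite -!natrM ler_nat.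
have f2 : (\sum_(i <- enum 'I_n) edges i W)%:R * 2^-1 <= (\sum_(i <- enum 'I_n) edges i W)%:R * ln 2 :> R.
  by rewrite ler_wpM2l.
have f3 : xlnx #|W| <= 2 * #|N Z|%:R * (5 * L%:R).
  rewrite /xlnx; apply: ler_pM => //; first by rewrite ln_ge0 // ler1n; apply: leq_trans Z0 _; apply: subset_leq_card; exact: subsetUl.
  by rewrite -natrM ler_nat.
have f4 : #|Z|%:R * n%:R <= 40 * L%:R * #|N Z|%:R :> R by lra.
move: f4; rewrite -!natrM ler_nat => f4.
rewrite -(leq_pmul2l (_ : 0 < 40 * L)%N) ?muln_gt0 //; apply: leq_trans f4.
apply: (@leq_trans ((1280 * L ^ 2) * #|Z|)); last by rewrite mulnC leq_mul2l nL orbT.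
by rewrite leq_eqVlt; apply/orP; left; apply/eqP; rewrite expnS expn1; ring.
Qed.

Lemma card_grid : (0 < n)%N -> #|{: V}|.+1%:R <= expR (2 * n%:R) :> R.
Proof.
move=> n0; have -> : #|{: V}| = (3 ^ n)%N by have := card_tuple n 'I_3; rewrite card_ord.
apply: (@le_trans _ _ (4 ^ n)%:R).
  by rewrite ler_nat; apply: ltn_exp2r.
rewrite (_ : 4 = 2 ^ 2)%N // -expnM natrX -natrM -[(2 * n)%:R]mulr1 expRM_natl.
by apply: lerXn2r; rewrite ?nnegrE ?expR_ge0 //; exact: two_le_expR.
Qed.

Lemma double_shadow (x : V) : rank x = n.+2 -> (n * n <= 8 * #|N (dn x)|)%N.
Proof.
move=> rx; pose drop (u : V) := [set l | (co u l < co x l)%N].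
have sub : [set B : {set 'I_n} | B \subset supp x & #|B| == 2] \subset [set drop u | u in N (dn x)].
  apply/subsetP=> B; rewrite inE => /andP[Bx /cards2P[i [j [ij eB]]]].
  have ix : i \in supp x by apply: (subsetP Bx); rewrite eB !inE eqxx.
  have jx : j \in supp x by apply: (subsetP Bx); rewrite eB !inE eqxx orbT.
  apply/imsetP; exists (dec (dec x i) j).
    apply/bigcupP; exists (dec x i); first exact: imset_f.
    by apply: imset_f; move: jx; rewrite !inE co_dec eq_sym (negbTE ij) subn0.
  rewrite eB; apply/setP=> l; rewrite !inE !co_dec; move: ix jx; rewrite !inE.
  by case: (eqVneq l i) => [->|li]; case: (eqVneq l j) => [lj|lj] /=; rewrite ?lj ?subn0 ?ltnn //; lia.
have := leq_trans (subset_leq_card sub) (leq_imset_card _ _); rewrite cards_draws bin2.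
have := cnt_sum x; move: rx; rewrite rank_cnt supp_cnt => e1 e2.
set q := (cnt x 1 + cnt x 2)%N; have hq : (n + 2 <= 2 * q)%N by rewrite /q; lia.
have ev : (q * q.-1 = 2 * (q * q.-1)./2)%N.
  rewrite -{1}(odd_double_half (q * q.-1)) oddM mul2n.
  by rewrite (_ : odd q && odd q.-1 = false) //; case: (q) => //= q'; case: (odd q').
move: (_./2) ev => c ev le.
have : (n * n <= 4 * (q * q.-1))%N by nia.
lia.
Qed.

End EdgeIsoperimetry.

(** * Removing a cluster from a down-set *)

Section Downsets.
Variables (R : realType) (V : finType) (dn : V -> {set V}) (rk : V -> nat).
Notation N := (shadow dn).
Notation plus := (plus dn).
Notation ups := (ups dn).
Notation lay := (lay rk).

Implicit Types (D S X : {set V}).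

Definition downset (D : {set V}) := [forall v in D, dn v \subset D].
Definition downsets := [set D | downset D].
Definition above m S := \bigcup_(i < m) iter i plus S.
Definition traces m S := [set D :&: above m S | D in downsets].

Lemma downsetP (D : {set V}) v y : downset D -> v \in D -> y \in dn v -> y \in D.
Proof. by move=> /forall_inP dD vD; apply: subsetP (dD v vD) y. Qed.

Lemma aboveS m S : above m.+1 S = S :|: above m (plus S).
Proof. by rewrite /above big_ord_recl /=; congr (_ :|: _); apply: eq_bigr => i _; rewrite -iterSr. Qed.

Lemma plus_downset (D S : {set V}) : downset D -> D :&: plus S = D :&: plus (D :&: S).
Proof.
move=> /forall_inP dD; apply/setP=> v; rewrite !inE; case: (boolP (v \in D)) => //= vD.
by rewrite subsetI dD.
Qed.

Lemma above_downset m (D S : {set V}) : downset D -> D :&: above m S = D :&: above m (D :&: S).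
Proof.
move=> dD; elim: m S => [|m IH] S; first by rewrite /above !big_ord0.
rewrite !aboveS !setIUr setIA setIid; congr (_ :|: _).
by rewrite IH plus_downset // -IH.
Qed.

Lemma card_traces m S : (#|traces m S| <= ups m S)%N.
Proof.
elim: m S => [|m IH] S /=.
  apply: (@leq_trans #|[set (set0 : {set V})]|); last by rewrite cards1.
  apply: subset_leq_card; apply/subsetP=> E /imsetP[D _ ->].
  by rewrite /above big_ord0 setI0 inE.
apply: (@leq_trans #|\bigcup_(Z : {set V} | Z \subset S) [set Z :|: E | E in traces m (plus Z)]|).
  apply: subset_leq_card; apply/subsetP=> E /imsetP[D]; rewrite inE => dD ->.
  apply/bigcupP; exists (D :&: S); first exact: subsetIr.
  apply/imsetP; exists (D :&: above m (plus (D :&: S))); first by apply: imset_f; rewrite inE.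
  by rewrite aboveS setIUr above_downset // plus_downset // -above_downset.
apply: leq_trans (card_bigcup_le _ _) _; apply: leq_sum => Z _.
by apply: leq_trans (leq_imset_card _ _) (IH _).
Qed.

Hypothesis h_rk : forall v y, y \in dn v -> rk v = (rk y).+1.
Hypothesis h_ne : forall v, (0 < rk v)%N -> dn v != set0.
Hypothesis h_link : forall v x y, (1 < rk v)%N -> x \in dn v -> y \in dn v -> adj dn x y.

Lemma iter_plus_lay k i (Z : {set V}) : Z \subset lay k -> iter i plus Z \subset lay (k + i)%N.
Proof. by move=> ZL; elim: i => [|i IH]; rewrite ?addn0 // addnS iterS; exact: plus_lay IH. Qed.

(* From a down-set [D] in which [Z] is a linked component of the layer [k], remove [Z],
   everything above [Z], and an arbitrary part of the shadow of [Z]: the result is a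
   down-set, and what lies above [Z] can be chosen in at most [ups m (plus Z)] ways. *)
Section Removal.
Variables (k m : nat) (z : V) (Z : {set V}).
Hypotheses (k0 : (0 < k)%N) (hm : forall v, (rk v <= k + m)%N) (zZ : z \in Z) (ZL : Z \subset lay k).

Definition with_cluster :=
  [set D in downsets | (z \in D) && (component (adj dn) (D :&: lay k) z == Z)].

Definition remove (p : {set V} * {set V}) := p.1 :\: (Z :|: above m (plus Z) :|: p.2).

Lemma cluster_sub D : D \in with_cluster -> Z \subset D.
Proof.
rewrite !inE => /andP[_ /andP[zD /eqP <-]].
apply: subset_trans (subsetIl D (lay k)); apply: component_sub.
by apply/setIP; split=> //; exact: (subsetP ZL z zZ).
Qed.

Lemma cluster_adj D u v : D \in with_cluster -> u \in Z -> v \in D -> v \in lay k -> adj dn u v -> v \in Z.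
Proof.
move=> DF uZ vD vL uv; move: DF; rewrite !inE => /andP[_ /andP[zD /eqP eZ]]; rewrite -eZ in uZ *.
by apply: component_closed uZ _ uv; apply/setIP; split=> //; exact: subsetP ZL z zZ.
Qed.

Lemma iter_plus_closed D i v y : D \in with_cluster -> v \in D -> y \in dn v -> y \in iter i plus Z ->
  v \in iter i.+1 plus Z.
Proof.
move=> DF; have dD : downset D by move: DF; rewrite !inE => /andP[].
elim: i v y => [|i IH] v y vD yv yi.
  have yk : rk y = k by apply/eqP; have := subsetP ZL y yi; rewrite inE.
  have rv : rk v = k.+1 by rewrite (h_rk yv) yk.
  rewrite /= inE; apply/andP; split; first by apply: h_ne; rewrite rv.
  apply/subsetP=> y' y'v; apply: (cluster_adj DF yi); first exact: downsetP dD vD y'v.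
    by rewrite inE -eqSS -(h_rk y'v) rv.
  by apply: h_link yv y'v; rewrite rv ltnS.
have yk : rk y = (k + i.+1)%N by apply/eqP; have := subsetP (iter_plus_lay i.+1 ZL) y yi; rewrite inE.
have rv : rk v = (k + i.+1).+1 by rewrite (h_rk yv) yk.
have /andP[yne ysub] : (dn y != set0) && (dn y \subset iter i plus Z) by move: yi; rewrite iterS inE.
rewrite iterS inE; apply/andP; split; first by apply: h_ne; rewrite rv.
apply/subsetP=> y' y'v.
have : adj dn y y' by apply: h_link yv y'v; rewrite rv; lia.
case/orP => [/eqP <- //|]; rewrite -setI_eq0 => /set0Pn[u /setIP[uy uy']].
by apply: (IH y' u) => //; [exact: downsetP dD vD y'v | exact: subsetP ysub u uy].
Qed.

Lemma remove_downset D X : D \in with_cluster -> X \subset N Z -> downset (remove (D, X)).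
Proof.
move=> DF XN; have dD : downset D by move: DF; rewrite !inE => /andP[].
apply/forall_inP=> v; rewrite /remove /= !in_setD !in_setU !negb_or => /andP[/andP[/andP[vZ vU] _] vD].
apply/subsetP=> y yv; rewrite !in_setD !in_setU !negb_or (downsetP dD vD yv) andbT.
have key i : y \in iter i plus Z -> False.
  move=> yi; have vi := iter_plus_closed DF vD yv yi; case/negP: vU; apply/bigcupP.
  have := subsetP (iter_plus_lay i.+1 ZL) v vi; rewrite inE => /eqP rv.
  have im : (i < m)%N by have := hm v; rewrite rv; lia.
  by exists (Ordinal im) => //=; rewrite -iterSr.
apply/andP; split; first (apply/andP; split); apply/negP.
- exact: (key 0%N).
- by case/bigcupP=> i _; rewrite -iterSr; exact: key.
move=> yX; have /bigcupP[u uZ yu] := subsetP XN y yX.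
case/negP: vZ; apply: (cluster_adj DF uZ) => //.
  by have := subsetP ZL u uZ; rewrite !inE (h_rk yu) (h_rk yv).
by apply/orP; right; rewrite -setI_eq0; apply/set0Pn; exists y; exact/setIP.
Qed.

Lemma shadow_disj u : u \in N Z -> (u \in Z :|: above m (plus Z)) = false.
Proof.
move=> /bigcupP[v vZ uv]; have := subsetP ZL v vZ; rewrite inE (h_rk uv) => /eqP ru.
apply/negP=> /setUP[uZ|/bigcupP[i _]]; first by have := subsetP ZL u uZ; rewrite inE; lia.
by rewrite -iterSr => /(subsetP (iter_plus_lay _ ZL)); rewrite inE; lia.
Qed.

Lemma card_with_cluster : (#|with_cluster| * 2 ^ #|N Z| <= #|downsets| * ups m (plus Z))%N.
Proof.
rewrite -card_powerset -cardsX.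
pose f (p : {set V} * {set V}) := (remove p, p.1 :&: above m (plus Z)).
rewrite -(card_in_imset (f := f)).
  apply: (@leq_trans #|setX downsets (traces m (plus Z))|).
    apply: subset_leq_card; apply/subsetP=> q /imsetP[[D X]]; rewrite !inE /= => /andP[DF XN] ->.
    rewrite /f /= remove_downset ?inE //=; apply: imset_f; rewrite inE; by case/andP: DF.
  by rewrite cardsX leq_mul2l card_traces orbT.
have rec D X : D \in with_cluster -> X \subset N Z ->
    D = remove (D, X) :|: (D :&: above m (plus Z)) :|: Z :|: N Z /\ X = N Z :\: remove (D, X).
  move=> DF XN; have ZD := cluster_sub DF.
  have dD : downset D by move: DF; rewrite !inE => /andP[].
  have ND : N Z \subset D by apply/bigcupsP=> v vZ; apply/subsetP=> y; exact: downsetP dD (subsetP ZD v vZ).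
  split; apply/setP=> u; rewrite /remove !(in_setU, in_setD, in_setI) /=.
    have := subsetP XN u; have := subsetP ZD u; have := subsetP ND u.
    case: (u \in X); case: (u \in N Z); case: (u \in Z); case: (u \in D); case: (u \in above _ _) => //=; by do ?[move=> /(_ isT) //|move=> _].
  have := subsetP XN u; case: (boolP (u \in N Z)) => uN; last by move=> h; rewrite andbF; apply/negP=> /h.
  by move=> _; have := shadow_disj uN; rewrite in_setU => ->; rewrite (subsetP ND u uN) /= andbT andbT negbK.
move=> [D X] [D' X']; rewrite !in_setX !(powersetE) /= => /andP[DF XN] /andP[DF' XN'] [e1 e2].
have [r1 r2] := rec D X DF XN; have [r1' r2'] := rec D' X' DF' XN'.
by congr (_, _); [rewrite r1 e1 e2 -r1' | rewrite r2 e1 -r2'].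
Qed.

End Removal.

Lemma downsets_through k m x z g0 : (0 < k)%N -> (forall v, (rk v <= k + m)%N) -> rk x = k.+1 -> z \in dn x ->
  (g0 <= #|N (dn x)|)%N ->
  #|[set D in downsets | x \in D]|%:R <=
  #|downsets|%:R * \sum_(Z : {set V} | [&& Z \subset lay k, linked dn z Z & (g0 <= #|N Z|)%N]) wt R dn m Z.
Proof.
move=> k0 hm rx zx hg; pose P (Z : {set V}) := [&& Z \subset lay k, linked dn z Z & (g0 <= #|N Z|)%N].
have zk : z \in lay k by rewrite inE -eqSS -(h_rk zx) rx.
have cov : [set D in downsets | x \in D] \subset \bigcup_(Z : {set V} | P Z) with_cluster k z Z.
  apply/subsetP=> D; rewrite !inE => /andP[dD xD].
  have zD : z \in D := downsetP dD xD zx.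
  have zDk : z \in D :&: lay k by rewrite inE zD.
  apply/bigcupP; exists (component (adj dn) (D :&: lay k) z); last by rewrite !inE dD zD eqxx.
  apply/and3P; split.
  - exact: subset_trans (component_sub _ zDk) (subsetIr _ _).
  - exact: component_rconn.
  apply: leq_trans hg _; apply: subset_leq_card; apply: shadowS; apply/subsetP=> y yx.
  apply: component_closed zDk (_ : z \in _) _ _; first by rewrite inE connect0.
    by rewrite inE (downsetP dD xD yx) inE -eqSS -(h_rk yx) rx /=.
  by apply: h_link zx yx; rewrite rx.
apply: (@le_trans _ _ (\sum_(Z : {set V} | P Z) #|with_cluster k z Z|%:R)).
  rewrite -natr_sum ler_nat; apply: leq_trans (subset_leq_card cov) _; exact: card_bigcup_le.
rewrite mulr_sumr; apply: ler_sum => Z /and3P[ZL lZ _].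
have zZ : z \in Z by case/andP: lZ.
have := card_with_cluster k0 hm zZ ZL; rewrite -(ler_nat R) !natrM natrX => h.
by rewrite /wt exprVn mulrCA ler_pdivlMl ?exprn_gt0 // mulrC.
Qed.

End Downsets.

(** * Antichains and down-sets *)

Lemma pow8_le_exp2 t : (56 <= t)%N -> ((t + 2) ^ 8 <= 2 ^ t)%N.
Proof.
move=> ht; have e k : (7 <= k)%N -> (8 * k + 9 <= 2 ^ k)%N.
  elim: k => // k IH; rewrite leq_eqVlt => /orP[/eqP <- //|]; rewrite ltnS => /IH h.
  by rewrite expnS; lia.
have k7 : (7 <= t %/ 8)%N by lia.
apply: (@leq_trans ((2 ^ (t %/ 8)) ^ 8)).
  by rewrite leq_exp2r //; apply: leq_trans (e _ k7); lia.
by rewrite -expnM leq_exp2l //; lia.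
Qed.

Section LargeGrid.
Variables (R : realType) (n : nat).
Notation V := (grid3 n).
Hypothesis hn : (1000 * 1000 <= trunc_log 2 n)%N.

Let L := (trunc_log 2 n + 2)%N.

Lemma log_facts : [/\ (2 * n + 1)%:R <= expR L%:R :> R, (L ^ 8 <= n)%N, (1000 * 1000 <= L)%N,
  (1280 * L ^ 2 <= n)%N & (1000 <= n)%N].
Proof.
have n0 : (0 < n)%N by rewrite lt0n; apply: contraTneq hn => ->; rewrite trunc_log0.
have hL0 : (1000 * 1000 <= L)%N by rewrite (leq_trans hn) // leq_addr.
have hLn : (L ^ 8 <= n)%N.
  by apply: leq_trans (trunc_logP (p := 2) _ n0) => //; apply: pow8_le_exp2; move: hn; lia.
have L1 : (0 < L)%N by rewrite /L addn2.
have h2 : (1280 * L ^ 2 <= n)%N.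
  apply: leq_trans hLn; rewrite (_ : 8 = 1 + 5 + 2)%N // !expnD expn1 leq_mul2r; apply/orP; right.
  apply: (@leq_trans L); first by move: hL0; clear; lia.
  by rewrite leq_pmulr // expn_gt0 L1.
have Ln : (L <= n)%N by apply: leq_trans hLn; rewrite -{1}[L]expn1 leq_pexp2l.
split=> //; last by apply: leq_trans Ln; move: hL0; clear; lia.
apply: (@le_trans _ _ (2 ^ L)%:R).
  rewrite ler_nat /L addn2 expnS; have := trunc_log_ltn (p := 2) n isT.
  by move: (2 ^ _)%N => q; lia.
rewrite natrX -[L%:R]mulr1 expRM_natl; apply: lerXn2r; rewrite ?nnegrE ?expR_ge0 //; exact: two_le_expR.
Qed.

Lemma rank_le (v : V) : (rank v <= 2 * n)%N.
Proof. by rewrite rank_cnt; have := cnt_sum v; lia. Qed.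

Lemma grid_downsets_through (x : V) : rank x = n.+2 ->
  #|[set D in downsets (@dn n) | x \in D]|%:R <=
  #|downsets (@dn n)|%:R * (2 * expR (- ((n * n %/ 8)%:R / 4))) :> R.
Proof.
move=> rx; have [hL hLn hL0 h2 n1000] := log_facts.
have n0 : (0 < n)%N by apply: leq_trans n1000.
have n100 : (100 <= n)%N by apply: leq_trans n1000.
have hrk (v y : V) : y \in dn v -> rank v = (rank y).+1 by exact: rank_dn.
have hne (v : V) : (0 < rank v)%N -> dn v != set0 by exact: dn_nonempty.
have hlink (v a b : V) : (1 < rank v)%N -> a \in dn v -> b \in dn v -> adj (@dn n) a b by move=> _; exact: dn_adj.
have LP : forall k, (n < k)%N -> layer_pair (@dn n) (lay (@rank n) k) (lay (@rank n) k.-1) n (@wsupp R n).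
  by move=> k; exact: grid_layer_pair.
have L0 : (0 < L)%N by rewrite /L addn2.
have hV := card_grid R n0.
have hsmall k (Z : {set V}) : (n < k)%N -> Z \subset lay (@rank n) k ->
    (#|shadow (@dn n) Z| <= n ^ 4)%N -> (32 * L * #|Z| <= #|shadow (@dn n) Z|)%N.
  exact: (small_expansion n100 hL h2 L0).
have rx0 : (0 < rank x)%N by rewrite rx.
have /set0Pn[z zx] := hne x rx0.
have hm (v : V) : (rank v <= n.+1 + n)%N by apply: leq_trans (rank_le v) _; lia.
have hg : (n * n %/ 8 <= #|shadow (@dn n) (dn x)|)%N.
  by have := double_shadow rx; move: #|_|; move: (n * n)%N; lia.
apply: le_trans (downsets_through R hrk hne hlink (ltn0Sn n) hm rx zx hg) _.
rewrite ler_wpM2l //; apply: (all_clusters LP n0 hL hLn hL0 hV hsmall) => //.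
  by move=> X; exact: (ups_growth hrk hne hlink LP n0 hL hLn hL0 hV hsmall).
by apply: leq_trans (leq_div _ _) _; rewrite expnS expn1; lia.
Qed.

End LargeGrid.

Section Ideals.
Variables (d : Order.disp_t) (T : finPOrderType d).
Implicit Types (A D : {set T}) (x y : T).

Definition ideal A := [set x | [exists a in A, (x <= a)%O]].
Definition maximal D := [set x in D | [forall y in D, ~~ (x < y)%O]].

Lemma maximal_ideal A : antichain A -> maximal (ideal A) = A.
Proof.
move=> /forall_inP aA; apply/setP=> x; rewrite !inE; apply/andP/idP => [[/exists_inP[a aA' xa] /forall_inP mx]|xA].
  have := mx a; rewrite inE lt_neqAle xa andbT negbK => -/(_ _)/eqP -> //.
  by apply/exists_inP; exists a.
split; first by apply/exists_inP; exists x.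
apply/forall_inP=> y; rewrite inE => /exists_inP[a aA' ya]; apply/negP=> xy.
have xa : (x < a)%O := lt_le_trans xy ya.
have /forall_inP/(_ a aA') := aA x xA; rewrite lt_eqF //= => /negP; apply.
by rewrite /Order.comparable (ltW xa).
Qed.

Lemma maximal_antichain D : antichain (maximal D).
Proof.
apply/forall_inP=> x; rewrite inE => /andP[xD /forall_inP mx].
apply/forall_inP=> y; rewrite inE => /andP[yD /forall_inP my]; apply/implyP=> xy.
by rewrite /Order.comparable negb_or !le_eqVlt (negbTE xy) eq_sym (negbTE xy) /= mx // my.
Qed.

Lemma maximal_above D x : x \in D -> exists2 y, y \in maximal D & (x <= y)%O.
Proof.
have [c] := ubnP #|[set y in D | (x < y)%O]|; elim: c x => // c IH x; rewrite ltnS => cx xD.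
case: (boolP [forall y in D, ~~ (x < y)%O]) => [mx|]; first by exists x; rewrite ?inE ?xD.
rewrite negb_forall_in => /exists_inP[y yD]; rewrite negbK => xy.
have [|u um yu] := IH y _ yD; last by exists u => //; apply: le_trans (ltW xy) yu.
apply: leq_trans cx; apply: proper_card; apply/properP; split.
  by apply/subsetP=> u; rewrite !inE => /andP[-> /(lt_trans xy)].
by exists y; rewrite !inE ?yD // ltxx.
Qed.

End Ideals.

Section Antichains.
Variable n : nat.
Notation V := (grid3 n).
Implicit Types (x y v : V) (A D : {set V}).

Lemma grid_le x y : (x <= y)%O = [forall i, (co x i <= co y i)%N].
Proof. by rewrite leEtprod. Qed.

Lemma dn_lt x y : y \in dn x -> (y < x)%O.
Proof.
move=> yx; rewrite lt_neqAle; apply/andP; split.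
  by apply/eqP=> e; have := rank_dn yx; rewrite e; lia.
by rewrite grid_le; have /imsetP[i _ ->] := yx; apply/forallP=> j; rewrite co_dec leq_subr.
Qed.

Lemma dn_between x y : (x < y)%O -> exists2 u, u \in dn y & (x <= u)%O.
Proof.
rewrite lt_neqAle grid_le => /andP[ne /forallP le].
have [i xi] : exists i, (co x i < co y i)%N.
  apply/existsP; apply: contraNT ne; rewrite negb_exists => /forallP h.
  by apply/eqP/coP => i; apply/eqP; rewrite eqn_leq le leqNgt h.
exists (dec y i); first by apply: imset_f; rewrite inE (leq_ltn_trans _ xi).
rewrite grid_le; apply/forallP=> j; rewrite co_dec; have := le j.
by case: eqP => [->|_]; lia.
Qed.

Lemma downset_le D x y : downset (@dn n) D -> y \in D -> (x <= y)%O -> x \in D.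
Proof.
move=> dD; have [c] := ubnP (rank y); elim: c y => // c IH y; rewrite ltnS => ry yD.
rewrite le_eqVlt => /orP[/eqP-> //|/dn_between[u uy xu]].
by apply: (IH u) => //; [rewrite (leq_trans _ ry) // (rank_dn uy) | exact: downsetP dD yD uy].
Qed.

Lemma ideal_downset A : downset (@dn n) (ideal A).
Proof.
apply/forall_inP=> v; rewrite inE => /exists_inP[a aA va]; apply/subsetP=> y yv.
by rewrite inE; apply/exists_inP; exists a => //; apply: le_trans (ltW (dn_lt yv)) va.
Qed.

Lemma card_downsets_le : (#|downsets (@dn n)| <= alpha [set: V])%N.
Proof.
rewrite -(card_in_imset (f := @maximal _ _ : {set V} -> {set V})).
  apply: subset_leq_card; apply/subsetP=> A /imsetP[D _ ->].
  by rewrite inE subsetT maximal_antichain.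
have rec D : downset (@dn n) D -> D = ideal (maximal D).
  move=> dD; apply/setP=> x; rewrite [RHS]inE; apply/idP/exists_inP.
    by case/maximal_above=> y ym xy; exists y.
  by case=> y; rewrite inE => /andP[yD _]; exact: downset_le.
by move=> D D'; rewrite !inE => /rec e /rec e' eq; rewrite e eq -e'.
Qed.

Lemma downset_rank D x k : downset (@dn n) D -> x \in D -> (k <= rank x)%N -> exists2 y, y \in D & rank y = k.
Proof.
move=> dD; have [c] := ubnP (rank x); elim: c x => // c IH x; rewrite ltnS => rx xD.
rewrite leq_eqVlt => /orP[/eqP->|kx]; first by exists x.
have /dn_nonempty/set0Pn[y yx] : (0 < rank x)%N by apply: leq_ltn_trans kx.
apply: (IH y) => //; first by rewrite (leq_trans _ rx) // (rank_dn yx).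
  exact: downsetP dD xD yx.
by move: kx; rewrite (rank_dn yx).
Qed.

Definition high_antichains := [set A : {set V} | antichain A & [exists v in A, (n.+2 <= rank v)%N]].
Definition low_antichains := [set A : {set V} | antichain A & [exists v in A, (rank v + 2 <= n)%N]].

Lemma card_high_antichains :
  (#|high_antichains| <= \sum_(x : V | rank x == n.+2) #|[set D in downsets (@dn n) | x \in D]|)%N.
Proof.
rewrite -(card_in_imset (f := @ideal _ _ : {set V} -> {set V})).
  apply: leq_trans (card_bigcup_le _ _); apply: subset_leq_card.
  apply/subsetP=> D /imsetP[A]; rewrite inE => /andP[_ /exists_inP[v vA rv]] ->.
  have vi : v \in ideal A by rewrite inE; apply/exists_inP; exists v.
  have [x xi rx] := downset_rank (ideal_downset A) vi rv.
  by apply/bigcupP; exists x; rewrite ?rx // !inE ideal_downset /=; move: xi; rewrite inE.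
by move=> A A'; rewrite !inE => /andP[aA _] /andP[aA' _] e; rewrite -(maximal_ideal aA) e maximal_ideal.
Qed.

Definition flip v : V := [tuple rev_ord (tnth v i) | i < n].

Lemma co_flip v i : (co (flip v) i + co v i = 2)%N.
Proof. by rewrite /co tnth_mktuple; case: (tnth v i) => a /=; lia. Qed.

Lemma flipK : involutive flip.
Proof. by move=> v; apply: coP => i; have := co_flip v i; have := co_flip (flip v) i; lia. Qed.

Lemma flip_le x y : (flip x <= flip y)%O = (y <= x)%O.
Proof.
rewrite !grid_le; apply: eq_forallb => i; have := co_flip x i; have := co_flip y i.
by lia.
Qed.

Lemma rank_flip v : (rank (flip v) + rank v = 2 * n)%N.
Proof.
rewrite /rank -big_split /= (eq_bigr (fun=> 2%N)) => [|i _]; last exact: co_flip.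
by rewrite sum_nat_const card_ord mulnC.
Qed.

Lemma card_low_antichains : (#|low_antichains| <= #|high_antichains|)%N.
Proof.
rewrite -(card_imset _ (imset_inj (inv_inj flipK))); apply: subset_leq_card.
apply/subsetP=> B /imsetP[A]; rewrite !inE => /andP[/forall_inP aA /exists_inP[v vA rv]] ->.
apply/andP; split; last first.
  apply/exists_inP; exists (flip v); first exact: imset_f.
  by have := rank_flip v; lia.
apply/forall_inP=> _ /imsetP[x xA ->]; apply/forall_inP=> _ /imsetP[y yA ->].
rewrite (inj_eq (inv_inj flipK)) /Order.comparable !flip_le orbC.
by have /forall_inP/(_ y yA) := aA x xA.
Qed.

Lemma alpha_split : (alpha [set: V] <= alpha (middle_layers n) + #|high_antichains|.*2)%N.
Proof.
rewrite -addnn; apply: (@leq_trans (alpha (middle_layers n) + (#|high_antichains| + #|low_antichains|))); last first.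
  by rewrite !leq_add2l card_low_antichains.
apply: leq_trans (leq_add (leqnn _) (leq_card_setU _ _)); apply: leq_trans (leq_card_setU _ _).
apply: subset_leq_card; apply/subsetP=> A; rewrite !inE subsetT /= => aA; rewrite aA !andbT /=.
case: (boolP [exists v in A, (n.+2 <= rank v)%N]) => [_|hi]; first by rewrite orbT.
case: (boolP [exists v in A, (rank v + 2 <= n)%N]) => [_|lo]; first by rewrite !orbT.
rewrite !orbF; apply/subsetP=> v vA.
have h1 : (rank v < n.+2)%N.
  by rewrite ltnNge; apply: contra hi => h; apply/exists_inP; exists v.
have h2 : (n < rank v + 2)%N.
  by rewrite ltnNge; apply: contra lo => h; apply/exists_inP; exists v.
have e : (\sum_(i < n) tnth v i)%N = rank v by [].
by rewrite !inE e; lia.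
Qed.

Lemma alpha_middle_le : (alpha (middle_layers n) <= alpha [set: V])%N.
Proof. by apply: subset_leq_card; apply/subsetP=> A; rewrite !inE subsetT => /andP[]. Qed.

Lemma alpha_gt0 (S : {set V}) : (0 < alpha S)%N.
Proof.
apply/card_gt0P; exists set0; rewrite inE sub0set; apply/forall_inP=> x; by rewrite inE.
Qed.

End Antichains.

Section ErrorTerm.
Variables (R : realType) (n : nat).
Notation V := (grid3 n).
Hypothesis hn : (1000 * 1000 <= trunc_log 2 n)%N.

Lemma exponent_bound : (1000 <= n)%N ->
  8 * #|{: V}|%:R * expR (- ((n * n %/ 8)%:R / 4)) <= expR (- (n%:R ^+ 2 / 64)) :> R.
Proof.
move=> n1000; apply: (@le_trans _ _ (expR 3 * expR (2 * n%:R) * expR (- ((n * n %/ 8)%:R / 4)))).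
  rewrite ler_wpM2r ?expR_ge0 //; apply: ler_pM; rewrite ?ler0n //.
    have -> : expR 3 = expR 1 ^+ 3 :> R by rewrite -expRM_natl mulr1.
    have -> : 8 = 2 ^+ 3 :> R by ring.
    by apply: lerXn2r; rewrite ?nnegrE ?expR_ge0 //; exact: two_le_expR.
  have n0 : (0 < n)%N by apply: leq_trans n1000.
  by apply: le_trans (card_grid R n0); rewrite ler_nat leqnSn.
rewrite -!expRD ler_expR.
have g : n%:R ^+ 2 <= 8 * (n * n %/ 8)%:R + 7 :> R.
  rewrite -natrX -natrM -(natrD _ _ 7) ler_nat expnS expn1.
  by move: (n * n)%N; clear; lia.
have h : 1000 * n%:R <= n%:R ^+ 2 :> R by rewrite expr2 ler_wpM2r // ler_nat.
have h1 : 1000 <= n%:R :> R by rewrite ler_nat.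
lra.
Qed.

Lemma alpha_error : (alpha [set: V])%:R - (alpha (middle_layers n))%:R <=
  expR (- (n%:R ^+ 2 / 64)) * (alpha (middle_layers n))%:R :> R.
Proof.
have [_ _ _ _ n1000] := log_facts R hn; have := exponent_bound n1000.
set q := expR (- (n%:R ^+ 2 / 64)); set e := expR (- ((n * n %/ 8)%:R / 4)) => eq.
have q1 : q <= 1 by rewrite -expR0 ler_expR oppr_le0 divr_ge0 // exprn_ge0.
have q0 : 0 <= q := expR_ge0 _.
set P : R := (alpha [set: V])%:R; set M : R := (alpha (middle_layers n))%:R.
have hi : #|high_antichains n|%:R <= #|{: V}|%:R * (P * (2 * e)).
  apply: (@le_trans _ _ (\sum_(x : V | rank x == n.+2) #|[set D in downsets (@dn n) | x \in D]|)%:R).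
    by rewrite ler_nat card_high_antichains.
  rewrite natr_sum; apply: (@le_trans _ _ (\sum_(x : V | rank x == n.+2) (P * (2 * e)))).
    apply: ler_sum => x /eqP rx; apply: le_trans (grid_downsets_through R hn rx) _.
    by rewrite ler_wpM2r ?mulr_ge0 ?expR_ge0 // ler_nat card_downsets_le.
  rewrite sumr_const -[leLHS]mulr_natl ler_wpM2r ?mulr_ge0 ?expR_ge0 //.
  by rewrite ler_nat max_card.
have := alpha_split n; rewrite -(ler_nat R) natrD -muln2 natrM -/P -/M => sp.
have P0 : 0 <= P by rewrite ler0n.
have h1 : 8 * #|{: V}|%:R * e * P <= q * P by rewrite ler_wpM2r.
have h2 : q * P <= P by rewrite -[leRHS]mul1r ler_wpM2r.
have h3 : P <= M + 2^-1 * (q * P).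
  lra.
have h4 : q * P <= q * (2 * M) by rewrite ler_wpM2l //; lra.
lra.
Qed.

End ErrorTerm.

(* Imported this late because classical sets shadow the notations for finite sets. *)
From mathcomp Require Import all_classical all_reals all_analysis.
Import numFieldNormedType.Exports.

(* The existential hides [2 ^ t], which would be evaluated in unary for the [t] used below. *)
Lemma exists_large_log t : exists M, forall n, (M <= n)%N -> (t <= trunc_log 2 n)%N.
Proof. by exists (2 ^ t)%N => n; exact: trunc_log_max. Qed.

Theorem theorem1p3 (R : realType) :
  exists2 eps : nat -> R, exp_neg_Omega_sq eps &
    forall n : nat,
      (alpha [set: grid3 n])%:R = (1 + eps n) * (alpha (middle_layers n))%:R.
Proof.
pose eps n : R := (alpha [set: grid3 n])%:R / (alpha (middle_layers n))%:R - 1.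
have M0 n : 0 < (alpha (middle_layers n))%:R :> R by rewrite ltr0n alpha_gt0.
exists eps => [|n]; last by rewrite /eps addrC subrK divfK // gt_eqF.
exists 64^-1; first by rewrite invr_gt0.
have [M HM] := exists_large_log (1000 * 1000).
exists M => // n /= /HM hn; rewrite ger0_norm /eps.
  rewrite lerBlDr ler_pdivrMr // mulrDl mul1r -lerBlDr (mulrC 64^-1); exact: alpha_error.
by rewrite subr_ge0 ler_pdivlMr // mul1r ler_nat alpha_middle_le.
Qed.
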